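(* Let $p$ be a complex polynomial in one variable and $t\ge0$. Then $$p(X(t))=\sum_{k=1}^\infty\int_0^t\frac1{k!}\,\phi_{k+1}\bigl[\partial^k(p)(X(s))\bigr]\,\sharp\, d\Delta_k(s).$$
   Context: Setting. $\mathcal{A}$ is a finite von Neumann algebra with a faithful normal trace state $\phi$; $\|S\|_p=\phi[|S|^p]^{1/p}$, $\|S\|_\infty=\|S\|$ is the operator norm, $L^p(\mathcal{A},\phi)$ are the completions of $\mathcal{A}$. $(\mathcal{A}_t)_{t\ge0}$ is an increasing family of von Neumann subalgebras of $\mathcal{A}$. $\mu$ is a compactly supported freely infinitely divisible probability measure on $\mathbb{R}$ of variance $1$; $r_k$ are its free cumulants, and $(\mu_t)_{t\ge0}$ is the free convolution semigroup whose free cumulants are $t r_k$. $X$ is a fixed adapted free stochastic measure with distribution $\mu$: a map $I\mapsto X(I)$ from finite half-open intervals $I=[a,b)\subset[0,\infty)$ to self-adjoint elements of $\mathcal{A}$ such that $X(I_1)+X(I_2)=X(I_1\cup I_2)$ when $I_1\cap I_2=\emptyset$ and $I_1\cup I_2$ is an interval; $X(I)$ has distribution $\mu_{|I|}$; $X(I_1),\dots,X(I_n)$ are freely independent for disjoint $I_1,\dots,I_n$; $X(I)\in\mathcal{A}_t$ if $I\subset[0,t)$; and $X(I)$ is freely independent from $\mathcal{A}_t$ if $I\cap[0,t)=\emptyset$. Put $X(t)=X([0,t))$. Diagonal measures. For $I=[a,b)$, $\Delta_k(I)=\lim_{N\to\infty}\sum_{i=1}^N X\bigl([a+\tfrac{i-1}{N}(b-a),a+\tfrac{i}{N}(b-a))\bigr)^k$,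 the limit being in operator norm (it is known to exist); $\Delta_k(t)=\Delta_k([0,t))$, $\Delta_1=X$. Each $\Delta_k$ is known to be an adapted process with freely independent stationary increments, and the free cumulants of $\Delta_k(t)$ are $r_n(\Delta_k(t))=t\,r_{nk}$. Biprocesses and integrals. A biprocess is a map $[0,\infty)\to\mathcal{A}\otimes\mathcal{A}^{op}$. $\mathcal{B}$ is the space of simple adapted biprocesses, spanned by $S\otimes T\,\mathbf{1}_{[a,b)}$ with $S,T\in\mathcal{A}_a$. For such a biprocess $\int (S\otimes T\mathbf{1}_{[a,b)})\,\sharp\, d\Delta_k=S(\Delta_k(b)-\Delta_k(a))T$, extended linearly; $\int_{t_1}^{t_2}U\,\sharp\, d\Delta_k=\int U\mathbf{1}_{[t_1,t_2)}\,\sharp\, d\Delta_k$. For non-simple adapted $W$ the integral is defined by continuous extension: if $W_n\in\mathcal{B}$ with $\int\|W_n-W\|_2^2ds\to0$ and $\|\int m(W_n-W)ds\|_2\to0$, then $\int W\,\sharp\, d\Delta_k$ is the limit of $\int W_n\,\sharp\, d\Delta_k$ in $L^2(\mathcal{A},\phi)$; here $m(S\otimes T)=ST$, and $\|\cdot\|_2$ on $\mathcal{A}\otimes\mathcal{A}^{op}$ comes from $\langle A\otimes B,C\otimes D\rangle=\phi[C^*A]\phi[BD^*]$. Notation. $\partial^k:\mathbb{C}[x]\to\mathbb{C}[x]^{\otimes(k+1)}$ is the linear map $\partial^k x^n=k!\sum_{i(0)+\dots+i(k)=n-k,\ i(j)\ge0}x^{i(0)}\otimes\dots\otimes x^{i(k)}$,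 and $\partial^k(p)(X(s))$ means that $X(s)$ is substituted for $x$ in every tensor factor. For $k\ge2$, $\phi_k:\mathcal{A}^{\otimes k}\to\mathcal{A}\otimes\mathcal{A}$ is $\phi_k=\mathrm{id}\otimes\phi^{\otimes(k-2)}\otimes \mathrm{id}$, and its value is regarded as an element of $\mathcal{A}\otimes\mathcal{A}^{op}$.
   Formalization: The constant term is missing: for p = 1 the left side is 1 while every ∂^k(p) with k ≥ 1 vanishes, so the right side is 0. The identity proved has p(X(t)) − p(0)·1 on the left, for every complex polynomial p; it is the printed one when p(0) = 0. *)

(* Defs.v *)
From HB Require Import structures.
From mathcomp Require Import all_boot all_order all_algebra.
From mathcomp Require Import sesquilinear complex.
From mathcomp Require Import all_classical all_reals all_analysis.

Set Implicit Arguments.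
Unset Strict Implicit.
Unset Printing Implicit Defensive.
Import Order.TTheory GRing.Theory Num.Theory.
Import numFieldNormedType.Exports.
Local Open Scope classical_set_scope.
Local Open Scope ring_scope.

(** * Noncrossing partitions, free cumulants, free infinite divisibility *)

Definition noncrossing (n : nat) (P : {set {set 'I_n}}) : bool :=
  [forall B in P, forall B' in P, forall a : 'I_n, forall b : 'I_n,
   forall c : 'I_n, forall d : 'I_n,
     [&& (a < b)%N, (b < c)%N, (c < d)%N,
         a \in B, c \in B, b \in B' & d \in B'] ==> (B == B')].

Section Measures.
Context {R : realType}.

Definition moment (mu : probability (measurableTypeR R) R) (n : nat) : R :=
  \int[mu]_x (x ^+ n).

Definition compactly_supported (mu : probability (measurableTypeR R) R) : Prop :=
  exists2 K : set R, compact K & mu (~` K) = 0%E.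

(* Speicher's moment-cumulant formula; it determines [r k] for [0 < k], the
   value [r 0] being irrelevant. *)
Definition is_free_cumulants (mu : probability (measurableTypeR R) R)
    (r : nat -> R) : Prop :=
  forall n : nat, moment mu n =
    \sum_(P : {set {set 'I_n}} |
            finset.partition P (finset.setTfor 'I_n) && noncrossing P)
       \prod_(B in P) r #|B|.

(* [mu] has an [n.+1]-st root for free convolution, for every [n]; on compactly
   supported measures free convolution is addition of free cumulants. *)
Definition freely_infinitely_divisible
    (mu : probability (measurableTypeR R) R) : Prop :=
  forall n : nat, exists nu : probability (measurableTypeR R) R,
    compactly_supported nu /\
    exists r : nat -> R,
      is_free_cumulants nu r /\ is_free_cumulants mu (fun k => r k *+ n.+1).

End Measures.

(** * Von Neumann algebras of operators on a Hilbert space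

   A Hilbert space is a complete normed module [H] over R[i] with an inner
   product [dot] (linear in its first argument) inducing the norm.  Operators
   are functions [H -> H]: the module structure is the pointwise one, the
   product is [\o] and [S ^ n] is [iter n S]. *)

Section Operators.
Context {R : realType} {H : completeNormedModType R[i]}.
Variable dot : {dot H for @Num.conj R[i]}.

Definition hilbert_norm : Prop := forall x : H, `|x| ^+ 2 = dot x x.

Definition bounded_op (S : H -> H) : Prop :=
  linear S /\ exists M : R[i], forall x, `|S x| <= M * `|x|.

Definition is_adj (S T : H -> H) : Prop :=
  forall x y, dot (S x) y = dot x (T y).

(* The adjoint, which exists and is unique for bounded operators. *)
Definition adj (S : H -> H) : H -> H := xget 0 [set T | is_adj S T].

Definition commutant (M : set (H -> H)) : set (H -> H) :=
  [set T | bounded_op T /\ forall S, M S -> S \o T = T \o S].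

Definition von_neumann_algebra (M : set (H -> H)) : Prop :=
  [/\ M `<=` bounded_op,
      forall S, M S -> exists2 T, M T & is_adj S T &
      commutant (commutant M) = M].

Definition le_op (S T : H -> H) : Prop := forall x, 0 <= dot (T x - S x) x.

(* [phi] preserves least upper bounds of upward directed sets of self-adjoint
   elements of [A]. *)
Definition normal_functional (A : set (H -> H)) (phi : (H -> H) -> R[i]) : Prop :=
  forall (D : set (H -> H)) (T : H -> H),
    D !=set0 -> D `<=` A -> (forall S, D S -> is_adj S S) ->
    (forall S1 S2, D S1 -> D S2 -> exists2 S, D S & le_op S1 S /\ le_op S2 S) ->
    A T -> is_adj T T -> (forall S, D S -> le_op S T) ->
    (forall T', A T' -> is_adj T' T' -> (forall S, D S -> le_op S T') ->
       le_op T T') ->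
    forall e : R[i], 0 < e -> exists2 S, D S & `|phi T - phi S| < e.

(* [phi] is only meaningful on [A]. *)
Record faithful_normal_trace_state (A : set (H -> H))
    (phi : (H -> H) -> R[i]) : Prop := {
  trace_linear : forall c S T, A S -> A T ->
    phi (c *: S + T) = c * phi S + phi T;
  trace_unit : phi id = 1;
  trace_positive : forall S, A S -> 0 <= phi (adj S \o S);
  trace_faithful : forall S, A S -> phi (adj S \o S) = 0 -> S = 0;
  trace_tracial : forall S T, A S -> A T -> phi (S \o T) = phi (T \o S);
  trace_normal : normal_functional A phi }.

Definition polyop (p : {poly R[i]}) (S : H -> H) : H -> H :=
  \sum_(i < size p) p`_i *: iter i S.

Definition poly_alg (S : H -> H) : set (H -> H) := [set polyop p S | p in setT].

(* Free independence of a family of unital subalgebras. *)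
Definition free_family (phi : (H -> H) -> R[i]) (I : eqType)
    (B : I -> set (H -> H)) : Prop :=
  forall (n : nat) (i : nat -> I) (a : nat -> (H -> H)),
    (forall j, (j <= n)%N -> B (i j) (a j) /\ phi (a j) = 0) ->
    (forall j, (j < n)%N -> i j != i j.+1) ->
    phi (\big[(fun S T => S \o T)/id]_(j < n.+1) a j) = 0.

(* For self-adjoint [S]; on compactly supported [mu], the moments determine
   [mu]. *)
Definition has_distribution (phi : (H -> H) -> R[i]) (S : H -> H)
    (mu : probability (measurableTypeR R) R) : Prop :=
  forall n : nat, phi (iter n S) = (moment mu n)%:C%C.

Definition opnorm_cvg (u : nat -> (H -> H)) (S : H -> H) : Prop :=
  forall e : R[i], 0 < e ->
    \forall N \near \oo, forall x, `|u N x - S x| <= e * `|x|.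

(* [X a b] is the value on [[a, b[], for [0 <= a <= b]. *)
Record adapted_free_stochastic_measure (A : set (H -> H))
    (phi : (H -> H) -> R[i]) (A_ : R -> set (H -> H))
    (mu_ : R -> probability (measurableTypeR R) R)
    (X : R -> R -> (H -> H)) : Prop := {
  fsm_mem : forall a b, 0 <= a <= b -> A (X a b);
  fsm_self_adjoint : forall a b, 0 <= a <= b -> is_adj (X a b) (X a b);
  fsm_additive : forall a b c, 0 <= a -> a <= b -> b <= c ->
    X a b + X b c = X a c;
  fsm_distribution : forall a b, 0 <= a <= b ->
    has_distribution phi (X a b) (mu_ (b - a));
  fsm_free : forall (n : nat) (a b : 'I_n -> R),
    (forall i, 0 <= a i <= b i) ->
    trivIset setT (fun i => `[a i, b i[%classic) ->
    free_family phi (fun i => poly_alg (X (a i) (b i)));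
  fsm_adapted : forall a b t, 0 <= a <= b -> 0 <= t ->
    `[a, b[%classic `<=` `[0, t[%classic -> A_ t (X a b);
  fsm_free_past : forall a b t, 0 <= a <= b -> 0 <= t ->
    `[a, b[%classic `&` `[0, t[%classic = set0 ->
    free_family phi (fun i : bool => if i then poly_alg (X a b) else A_ t) }.

(* [D a b] is the [k]-th diagonal measure of [[a, b[], a limit in operator
   norm. *)
Definition is_diagonal_measure (X : R -> R -> (H -> H)) (k : nat)
    (D : R -> R -> (H -> H)) : Prop :=
  forall a b, 0 <= a <= b ->
    opnorm_cvg
      (fun N => \sum_(1 <= i < N.+1)
         iter k (X (a + i.-1%:R / N%:R * (b - a)) (a + i%:R / N%:R * (b - a))))
      (D a b).

End Operators.

(** * Algebraic tensor powers

   An element of the [n]-th algebraic tensor power of [V] is represented by a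
   formal combination of elementary tensors, [(c, v)] standing for
   [c (v_0 (x) ... (x) v_(n-1))].  Every operation below is multilinear in the
   factors, hence independent of the representative. *)

Definition tensor (C V : Type) (n : nat) : Type := seq (C * n.-tuple V).

Section Tensors.
Context {R : realType} {H : completeNormedModType R[i]}.
Variables (dot : {dot H for @Num.conj R[i]}) (phi : (H -> H) -> R[i]).

(* k! times the sum of the x^i(0) (x) ... (x) x^i(k) over i(0) + ... + i(k) + k = n;
   [dpoly k] is its linear extension to polynomials. *)
Definition dpoly_monomial (k n : nat) : tensor R[i] {poly R[i]} k.+1 :=
  [seq (k`!%:R, map_tuple (fun j : 'I_n.+1 => 'X^j) i)
     | i : k.+1.-tuple 'I_n.+1
     <- enum [pred i : k.+1.-tuple 'I_n.+1 | ((\sum_(j <- i) j) + k == n)%N]].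

Definition dpoly (k : nat) (p : {poly R[i]}) : tensor R[i] {poly R[i]} k.+1 :=
  flatten [seq [seq (p`_n * w.1, w.2) | w <- dpoly_monomial k n]
             | n <- iota 0 (size p)].

Definition subst_tensor (k : nat) (S : H -> H)
    (w : tensor R[i] {poly R[i]} k) : tensor R[i] (H -> H) k :=
  [seq (v.1, map_tuple (fun q => polyop q S) v.2) | v <- w].

(* Elements of A (x) A^op, with the same representation. *)
Definition bitensor : Type := seq (R[i] * ((H -> H) * (H -> H))).

Definition bi_scale (c : R[i]) (u : bitensor) : bitensor :=
  [seq (c * v.1, v.2) | v <- u].

Definition bi_sub (u w : bitensor) : bitensor := u ++ bi_scale (-1) w.

(* id (x) phi^(k-2) (x) id on the [k]-th tensor power, here for [k = n.+2]. *)
Definition phi_mid (n : nat) (w : tensor R[i] (H -> H) n.+2) : bitensor :=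
  [seq (v.1 * \prod_(1 <= j < n.+1) phi (tnth v.2 (inord j)),
        (tnth v.2 ord0, tnth v.2 ord_max)) | v <- w].

Definition bi_mul (u : bitensor) : H -> H :=
  \sum_(v <- u) v.1 *: (v.2.1 \o v.2.2).

(* <a (x) b, c (x) d> = phi (adj c \o a) * phi (b \o adj d). *)
Definition bi_dot (u w : bitensor) : R[i] :=
  \sum_(v <- u) \sum_(v' <- w) v.1 * (v'.1)^* *
    (phi (adj dot v'.2.1 \o v.2.1) * phi (v.2.2 \o adj dot v'.2.2)).

Definition bi_normsq (u : bitensor) : R := complex.Re (bi_dot u u).

End Tensors.
Arguments bitensor {R} H.

(** * Biprocesses and stochastic integrals *)

Section Integrals.
Context {R : realType} {H : completeNormedModType R[i]}.

Definition half_line : set (measurableTypeR R) := `[(0 : R), +oo[%classic.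

(* The sum over [i] of [S_i (x) T_i 1_[a_i, b_i[]. *)
Record simple_biprocess := SimpleBiprocess {
  sb_size : nat;
  sb_lo : 'I_sb_size -> R;
  sb_hi : 'I_sb_size -> R;
  sb_left : 'I_sb_size -> (H -> H);
  sb_right : 'I_sb_size -> (H -> H) }.

Definition sb_adapted (A_ : R -> set (H -> H)) (U : simple_biprocess) : Prop :=
  forall i : 'I_(sb_size U),
    [/\ 0 <= sb_lo i <= sb_hi i, A_ (sb_lo i) (sb_left i) &
        A_ (sb_lo i) (sb_right i)].

Definition sb_eval (U : simple_biprocess) (s : R) : bitensor H :=
  [seq (1, (sb_left i, sb_right i))
     | i <- enum [pred i : 'I_(sb_size U) | sb_lo i <= s < sb_hi i]].

(* The argument [D] is an interval function, [D(t)] being [D 0 t]. *)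
Definition sb_integral (D : R -> R -> (H -> H)) (U : simple_biprocess) : H -> H :=
  \sum_(i < sb_size U)
    (sb_left i \o (D 0 (sb_hi i) - D 0 (sb_lo i)) \o sb_right i).

Definition adapted_biprocess (A_ : R -> set (H -> H)) (W : R -> bitensor H) : Prop :=
  forall s, 0 <= s ->
    forall v, v \in W s -> A_ s v.2.1 /\ A_ s v.2.2.

Definition bi_restrict (t1 t2 : R) (W : R -> bitensor H) (s : R) : bitensor H :=
  if t1 <= s < t2 then W s else [::].

Variables (dot : {dot H for @Num.conj R[i]}) (A : set (H -> H))
  (phi : (H -> H) -> R[i]) (A_ : R -> set (H -> H)).

(* [emb : A -> L2] exhibits [L2] as the completion of [A] for
   [S |-> phi (S^* S)^(1/2)]. *)
Record is_L2_completion (L2 : completeNormedModType R[i])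
    (emb : (H -> H) -> L2) : Prop := {
  L2_linear : forall c S T, A S -> A T -> emb (c *: S + T) = c *: emb S + emb T;
  L2_isometric : forall S, A S -> `|emb S| ^+ 2 = phi (adj dot S \o S);
  L2_dense : forall (v : L2) (e : R[i]), 0 < e ->
    exists2 S, A S & `|v - emb S| < e }.

Variables (L2 : completeNormedModType R[i]) (emb : (H -> H) -> L2).

(* [y] is the (Pettis) integral of [g] over [[0, +oo[]. *)
Definition is_vector_integral (g : R -> L2) (y : L2) : Prop :=
  forall f : {scalar L2}, (exists M : R[i], forall v, `|f v| <= M * `|v|) ->
    [/\ (@lebesgue_measure R).-integrable half_line
          (fun s => (complex.Re (f (g s)))%:E),
        (@lebesgue_measure R).-integrable half_line
          (fun s => (complex.Im (f (g s)))%:E),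
        complex.Re (f y) =
          \int[@lebesgue_measure R]_(s in half_line) complex.Re (f (g s)) &
        complex.Im (f y) =
          \int[@lebesgue_measure R]_(s in half_line) complex.Im (f (g s))].

Definition approximates (W_ : nat -> simple_biprocess) (W : R -> bitensor H) : Prop :=
  [/\ forall n, sb_adapted A_ (W_ n),
      forall n, measurable_fun half_line
        (fun s => bi_normsq dot phi (bi_sub (sb_eval (W_ n) s) (W s))),
      (fun n => \int[@lebesgue_measure R]_(s in half_line)
         (bi_normsq dot phi (bi_sub (sb_eval (W_ n) s) (W s)))%:E)%E
        @ \oo --> 0%E &
      exists Y : nat -> L2,
        (forall n, is_vector_integral
           (fun s => emb (bi_mul (bi_sub (sb_eval (W_ n) s) (W s)))) (Y n)) /\
        Y @ \oo --> 0].

(* [J] is the integral of [W] against [D], as an element of [L2]. *)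
Definition is_stochastic_integral (D : R -> R -> (H -> H))
    (W : R -> bitensor H) (J : L2) : Prop :=
  [/\ adapted_biprocess A_ W,
      exists W_, approximates W_ W &
      forall W_, approximates W_ W ->
        (fun n => emb (sb_integral D (W_ n))) @ \oo --> J].

End Integrals.
Arguments simple_biprocess {R} H.

(* Main.v *)
Require Import Defs.
From HB Require Import structures.
From mathcomp Require Import all_boot all_order all_algebra.
From mathcomp Require Import sesquilinear complex.
From mathcomp Require Import all_classical all_reals all_analysis.
From mathcomp Require Import measurable_realfun.
From mathcomp Require Import ring lra zify.

Set Implicit Arguments.
Unset Strict Implicit.
Unset Printing Implicit Defensive.
Import Order.TTheory GRing.Theory Num.Theory.
Import numFieldNormedType.Exports.
Local Open Scope classical_set_scope.
Local Open Scope ring_scope.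

(** The formula is obtained from the expansion of a telescoping sum.  Cut the
    time from 0 to [t] into small cells and write the increment of [X ^ n] over
    a cell as the sum of the words in [x] and [d] other than [x ^ n], where [x]
    is the value of the process at the beginning of the cell and [d] its
    increment, which is free from the past.

    Freeness decides the size of each word.  Inside a word, a factor [x ^ j]
    between two letters [d] may be replaced by its trace: the remaining word,
    with a centered factor between two letters [d], pairs with the past as the
    square of the length of the cell and has a norm of the order of this length
    ([order2_expand]).  Such terms are nearly orthogonal to one another, and
    their sum over all cells tends to zero ([words_to_leading]).  What is left
    of the words with [k] letters [d] is [x ^ i_0 d ^ k x ^ i_k] times the
    traces of the inner powers: this is the biprocess of the theorem acting on
    [d ^ k].  Freezing the biprocess on a coarse partition and refining the
    partition replaces the sums of [d ^ k] by the diagonal measures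
    ([ito_monomial]).  Thus the increment of [X ^ n] is a limit of Riemann sums
    against the diagonal measures.

    To recognize these limits as stochastic integrals one needs a bound on
    integrals of simple adapted biprocesses.  A diagonal measure is, on each
    interval, its mean times the identity plus a centered element free from the
    past; the centered parts satisfy the covariance formula [pair_formula], and
    the integral is bounded by an energy, the integral of the squared norm of
    the biprocess, and a drift ([integral_bound]).  These are the two quantities
    that tend to zero along an approximating sequence, so the integrals along
    any two such sequences have the same limit ([approximation_limit]), and the
    biprocess frozen on uniform partitions is one of them
    ([uniform_approximates]).  The covariance formula uses that the diagonal
    measures are additive; this holds because in the expansion of [X ^ k] over
    adjacent intervals all terms of lower order add up ([D_additive], by
    induction on [k]).

    All estimates are made in the trace norm, in an abstract algebra with a
    faithful trace ([tracial]).  The von Neumann algebra yields such an algebra;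
    the bounds that come from the operator norm follow from square roots of
    positive operators ([sqrt_one_minus]).  The norm of a tensor [a (x) b] is
    computed in this algebra as the norm of [a y b], with [y] free, centered
    and of variance 1 ([tensor_normsqE]).  In the completion, drifts are vector
    integrals; they are determined by bounded functionals, which polarization
    of the norm provides ([separation]). *)

(** * Complex numbers *)

Section Complexes.
Variable R : realType.
Local Notation C := R[i].
Local Notation cabs := (@ComplexField.Normc.normc R).
Local Notation Re := (@complex.Re R).
Local Notation Im := (@complex.Im R).

Lemma cabsE (z : C) : `|z| = (cabs z)%:C%C.
Proof. by []. Qed.

Lemma cabs_ge0 (z : C) : 0 <= cabs z.
Proof. by case: z => a b; rewrite /= sqrtr_ge0. Qed.

Lemma sqr_cabs (z : C) : cabs z ^+ 2 = Re z ^+ 2 + Im z ^+ 2.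
Proof. by case: z => a b /=; rewrite sqr_sqrtr // addr_ge0 // sqr_ge0. Qed.

Lemma cabs_real (x : R) : cabs x%:C%C = `|x|.
Proof. by rewrite /= expr0n addr0 sqrtr_sqr. Qed.

Lemma cabsM (z w : C) : cabs (z * w) = cabs z * cabs w.
Proof. exact: ComplexField.Normc.normcM. Qed.

Lemma cabsD (z w : C) : cabs (z + w) <= cabs z + cabs w.
Proof. exact: le_normcD. Qed.

Lemma cabsN (z : C) : cabs (- z) = cabs z.
Proof. exact: normcN. Qed.

Lemma cabs0 : cabs 0 = 0.
Proof. exact: ComplexField.Normc.normc0. Qed.

Lemma cabsJ (z : C) : cabs z^* = cabs z.
Proof. by case: z => a b; rewrite /= sqrrN. Qed.

Lemma Re_le_cabs (z : C) : `|Re z| <= cabs z.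
Proof. by rewrite -lecR; apply: normc_ge_Re. Qed.

Lemma Im_le_cabs (z : C) : `|Im z| <= cabs z.
Proof.
rewrite -(@ler_pXn2r _ 2) ?nnegrE ?cabs_ge0 // sqr_cabs real_normK ?num_real //.
by rewrite lerDr sqr_ge0.
Qed.

Lemma cReD (z w : C) : Re (z + w) = Re z + Re w.
Proof. by case: z w => a b [c d]. Qed.
Lemma cImD (z w : C) : Im (z + w) = Im z + Im w.
Proof. by case: z w => a b [c d]. Qed.
Lemma cReN (z : C) : Re (- z) = - Re z.
Proof. by case: z. Qed.
Lemma cImN (z : C) : Im (- z) = - Im z.
Proof. by case: z. Qed.
Lemma cReM (z w : C) : Re (z * w) = Re z * Re w - Im z * Im w.
Proof. by case: z w => a b [c d]. Qed.
Lemma cImM (z w : C) : Im (z * w) = Re z * Im w + Im z * Re w.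
Proof. by case: z w => a b [c d]. Qed.
Lemma cReJ (z : C) : Re z^* = Re z.
Proof. by case: z. Qed.
Lemma cImJ (z : C) : Im z^* = - Im z.
Proof. by case: z. Qed.

Lemma conjN (z : C) : (- z)^* = - z^*.
Proof. exact: rmorphN. Qed.
Lemma conjM (z w : C) : (z * w)^* = z^* * w^*.
Proof. exact: rmorphM. Qed.
Lemma conj_RC (x : R) : (x%:C%C)^* = x%:C%C :> C.
Proof. exact: conjc_real. Qed.
Lemma RCM (x y : R) : (x * y)%:C%C = x%:C%C * y%:C%C :> C.
Proof. exact: rmorphM. Qed.
Lemma RCD (x y : R) : (x + y)%:C%C = x%:C%C + y%:C%C :> C.
Proof. exact: rmorphD. Qed.
Lemma RCN (x : R) : (- x)%:C%C = - x%:C%C :> C.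
Proof. exact: rmorphN. Qed.
Lemma RCX (x : R) n : (x ^+ n)%:C%C = x%:C%C ^+ n :> C.
Proof. exact: rmorphXn. Qed.
Lemma RC_le (x y : R) : (x%:C%C <= y%:C%C :> C) = (x <= y).
Proof. exact: lecR. Qed.

Lemma cRe_sum (I : Type) (s : seq I) (P : pred I) (F : I -> C) :
  Re (\sum_(i <- s | P i) F i) = \sum_(i <- s | P i) Re (F i).
Proof. by apply: (big_morph _ cReD). Qed.

Lemma cIm_sum (I : Type) (s : seq I) (P : pred I) (F : I -> C) :
  Im (\sum_(i <- s | P i) F i) = \sum_(i <- s | P i) Im (F i).
Proof. by apply: (big_morph _ cImD). Qed.

Lemma complex_ext (z w : C) : Re z = Re w -> Im z = Im w -> z = w.
Proof. by case: z w => a b [c d] /= -> ->. Qed.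

Lemma ge0_Re (z : C) : 0 <= z -> z = (Re z)%:C%C /\ 0 <= Re z.
Proof.
move=> z0; split; last by move: z0; rewrite lecE /= => /andP[].
by apply: complex_ext => //=; rewrite ger0_Im.
Qed.

Lemma cabs_conjM (z : C) : z^* * z = (cabs z ^+ 2)%:C%C.
Proof.
rewrite sqr_cabs; apply: complex_ext; rewrite ?cReM ?cImM cReJ cImJ /=; ring.
Qed.
End Complexes.
Notation cabs := (@ComplexField.Normc.normc _).

(** * Tracial algebras *)

(** Finite von Neumann algebras enter only through the following algebraic
    data; [tracial_bounded] says that left multiplication by a fixed element is
    bounded for the trace norm. *)
Record tracial (R : realType) (A : algType R[i]) (star : A -> A)
    (phi : {scalar A}) : Prop := {
  starD : forall a b, star (a + b) = star a + star b;
  starZ : forall c a, star (c *: a) = c^* *: star a;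
  starM : forall a b, star (a * b) = star b * star a;
  starK : forall a, star (star a) = a;
  tr1 : phi 1 = 1;
  tracial_ge0 : forall a, 0 <= phi (star a * a);
  tracial_faithful : forall a, phi (star a * a) = 0 -> a = 0;
  trC : forall a b, phi (a * b) = phi (b * a);
  tracial_bounded : forall a, exists2 M : R, 0 <= M & forall b,
    phi (star (a * b) * (a * b)) <= M%:C%C * phi (star b * b) }.

Section Tracial.
Variables (R : realType) (A : algType R[i]) (star : A -> A) (phi : {scalar A}).
Hypothesis tA : tracial star phi.
Local Notation C := R[i].
Local Notation Re := (@complex.Re R).
Local Notation Im := (@complex.Im R).
Implicit Types (a b : A) (c : C).

Let sD := starD tA.
Let sZ := starZ tA.
Let sM := starM tA.
Let sK := starK tA.

Lemma phiD a b : phi (a + b) = phi a + phi b.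
Proof. exact: linearD. Qed.
Lemma phiN a : phi (- a) = - phi a.
Proof. exact: linearN. Qed.
Lemma phiB a b : phi (a - b) = phi a - phi b.
Proof. exact: linearB. Qed.
Lemma phiZ c a : phi (c *: a) = c * phi a.
Proof. exact: linearZ. Qed.
Lemma phi0 : phi 0 = 0.
Proof. exact: linear0. Qed.
Lemma phi_sum (I : Type) (s : seq I) (P : pred I) (F : I -> A) :
  phi (\sum_(i <- s | P i) F i) = \sum_(i <- s | P i) phi (F i).
Proof. exact: linear_sum. Qed.

Lemma star0 : star 0 = 0.
Proof. by apply: (@addrI _ (star 0)); rewrite -sD !addr0. Qed.
Lemma starN a : star (- a) = - star a.
Proof. by apply: (@addrI _ (star a)); rewrite -sD !subrr star0. Qed.
Lemma starB a b : star (a - b) = star a - star b.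
Proof. by rewrite sD starN. Qed.
Lemma star1 : star 1 = 1.
Proof. by have := sM 1 (star 1); rewrite mul1r sK mul1r => {2}->. Qed.
Lemma star_sum (I : Type) (s : seq I) (P : pred I) (F : I -> A) :
  star (\sum_(i <- s | P i) F i) = \sum_(i <- s | P i) star (F i).
Proof. by apply: (big_morph _ sD star0). Qed.
Lemma starX a n : star (a ^+ n) = star a ^+ n.
Proof.
elim: n => [|n IH]; first by rewrite !expr0 star1.
by rewrite exprS sM IH -exprSr.
Qed.

Definition nm a : R := Num.sqrt (Re (phi (star a * a))).

Lemma nm_ge0 a : 0 <= nm a. Proof. exact: sqrtr_ge0. Qed.

Lemma nmE a : phi (star a * a) = (nm a ^+ 2)%:C%C.
Proof.
have [e h] := ge0_Re (tracial_ge0 tA a).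
by rewrite /nm sqr_sqrtr.
Qed.

Lemma sqr_nm a : nm a ^+ 2 = Re (phi (star a * a)).
Proof. by rewrite nmE. Qed.

Lemma nm0 : nm 0 = 0.
Proof. by rewrite /nm mulr0 linear0 sqrtr0. Qed.

Lemma nm_eq0 a : nm a = 0 -> a = 0.
Proof. by move=> h; apply: (tracial_faithful tA); rewrite nmE h expr0n. Qed.

Lemma nm1 : nm 1 = 1.
Proof. by rewrite /nm star1 mulr1 (tr1 tA) sqrtr1. Qed.

Lemma nmZ c a : nm (c *: a) = cabs c * nm a.
Proof.
apply: (@pexpIrn _ 2); rewrite ?nnegrE ?mulr_ge0 ?cabs_ge0 ?nm_ge0 //.
rewrite exprMn sqr_nm sZ -scalerAl -scalerAr scalerA linearZ /= nmE cabs_conjM.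
by rewrite -RCM.
Qed.

Lemma nmN a : nm (- a) = nm a.
Proof. by rewrite /nm starN mulrNN. Qed.

Lemma nmBC a b : nm (a - b) = nm (b - a).
Proof. by rewrite -nmN opprB. Qed.

(** Positivity at [star z * z] for [z = 1 + c a] forces the imaginary part of
    [c phi (a) + c^* phi (star a)] to vanish; take [c = 1] and [c = i]. *)
Lemma phi_star a : phi (star a) = (phi a)^*.
Proof.
have key c : Im (c * phi a + c^* * phi (star a)) = 0.
  have [h _] := ge0_Re (tracial_ge0 tA (1 + c *: a)).
  have /(congr1 Im) : phi (star (1 + c *: a) * (1 + c *: a)) =
     1 + (c * phi a + c^* * phi (star a)) + (c^* * c) * (nm a ^+ 2)%:C%C.
    rewrite sD star1 sZ mulrDl mul1r mulrDr mulr1 -scalerAl -scalerAr scalerA.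
    by rewrite !phiD !phiZ (tr1 tA) nmE; ring.
  rewrite h cabs_conjM -RCM cImD (cImD 1) /= => e.
  by move: e; rewrite add0r addr0 => <-.
apply: complex_ext; rewrite ?cReJ ?cImJ.
  have := key 'i%C; rewrite cImD !cImM /=; lra.
have := key 1; rewrite rmorph1 !mul1r cImD; lra.
Qed.

Lemma nm_star a : nm (star a) = nm a.
Proof. by rewrite /nm sK (trC tA). Qed.

Lemma cauchy_schwarz a b : cabs (phi (star a * b)) <= nm a * nm b.
Proof.
set z := phi (star a * b).
(* Positivity at [b - t z a]; the best [t] is the inverse of [nm a ^+ 2]. *)
have key (t : R) : 0 <= t ^+ 2 * cabs z ^+ 2 * nm a ^+ 2 - 2 * t * cabs z ^+ 2
     + nm b ^+ 2.
  have [h h0] := ge0_Re (tracial_ge0 tA ((- (t%:C%C * z)) *: a + b)).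
  set Q := (X in 0 <= X); move: h0.
  rewrite sD sZ mulrDl !mulrDr -!scalerAl -!scalerAr scalerA !phiD.
  rewrite !phiZ !nmE -/z.
  have -> : phi (star b * a) = z^* by rewrite -phi_star sM sK.
  rewrite conjN conjM conj_RC mulrNN.
  have -> : t%:C%C * z^* * (t%:C%C * z) = (t ^+ 2 * cabs z ^+ 2)%:C%C :> C.
    by rewrite mulrACA cabs_conjM -!RCM.
  have -> : - (t%:C%C * z^*) * z = (- (t * cabs z ^+ 2))%:C%C :> C.
    by rewrite mulNr -mulrA cabs_conjM -RCM RCN.
  have -> : - (t%:C%C * z) * z^* = (- (t * cabs z ^+ 2))%:C%C :> C.
    by rewrite mulNr -mulrA [z * _]mulrC cabs_conjM -RCM RCN.
  rewrite -RCM -!RCD /Q /=; lra.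
rewrite -(@ler_pXn2r _ 2) ?nnegrE ?mulr_ge0 ?cabs_ge0 ?nm_ge0 //.
rewrite exprMn; have [z0|z0] := eqVneq (cabs z ^+ 2) 0.
  by rewrite z0 mulr_ge0 // sqr_ge0.
have zp : 0 < cabs z ^+ 2 by rewrite lt_def z0 sqr_ge0.
have [a0|a0] := eqVneq (nm a ^+ 2) 0.
  have := key ((nm b ^+ 2 + 1) / (2 * cabs z ^+ 2)); rewrite a0.
  have -> : 2 * ((nm b ^+ 2 + 1) / (2 * cabs z ^+ 2)) * cabs z ^+ 2 = nm b ^+ 2 + 1.
    by field; move: z0; rewrite expf_eq0.
  lra.
have := key ((nm a ^+ 2)^-1).
have -> : (nm a ^+ 2)^-1 ^+ 2 * cabs z ^+ 2 * nm a ^+ 2 -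
   2 * (nm a ^+ 2)^-1 * cabs z ^+ 2 = - (cabs z ^+ 2 / nm a ^+ 2).
  by field; move: a0; rewrite expf_eq0.
have ap : 0 < nm a ^+ 2 by rewrite lt_def a0 sqr_ge0.
by rewrite addrC subr_ge0 ler_pdivrMr // mulrC.
Qed.

Lemma cabs_phi_mul a b : cabs (phi (a * b)) <= nm a * nm b.
Proof. by rewrite -{1}[a]sK -(nm_star a); apply: cauchy_schwarz. Qed.

Lemma cabs_phi a : cabs (phi a) <= nm a.
Proof. by rewrite -{1}[a]mul1r -[nm a]mul1r -nm1; apply: cabs_phi_mul. Qed.

Lemma sqr_nmD a b : nm (a + b) ^+ 2 = nm a ^+ 2 + 2 * Re (phi (star a * b)) + nm b ^+ 2.
Proof.
rewrite (sqr_nm (a + b)) sD mulrDl !mulrDr !phiD !cReD -!sqr_nm.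
have -> : phi (star b * a) = (phi (star a * b))^* by rewrite -phi_star sM sK.
rewrite cReJ; lra.
Qed.

Lemma nmD a b : nm (a + b) <= nm a + nm b.
Proof.
rewrite -(@ler_pXn2r _ 2) ?nnegrE ?addr_ge0 ?nm_ge0 // sqr_nmD sqrrD.
have := cauchy_schwarz a b; have := Re_le_cabs (phi (star a * b)).
rewrite ler_norml => /andP[_ h1] h2; rewrite -[_ *+ 2]mulr_natl; lra.
Qed.

Lemma nmB a b : nm (a - b) <= nm a + nm b.
Proof. by rewrite -(nmN b); apply: nmD. Qed.

Lemma nm_sum (I : Type) (s : seq I) (P : pred I) (F : I -> A) :
  nm (\sum_(i <- s | P i) F i) <= \sum_(i <- s | P i) nm (F i).
Proof.
elim/big_ind2 : _ => [||//]; first by rewrite nm0.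
by move=> a x b y ha hb; apply: le_trans (nmD _ _) (lerD ha hb).
Qed.

Lemma nm_mull a : exists2 M : R, 0 <= M & forall b, nm (a * b) <= M * nm b.
Proof.
have [M M0 hM] := tracial_bounded tA a; exists (Num.sqrt M); rewrite ?sqrtr_ge0 // => b.
rewrite -(@ler_pXn2r _ 2) ?nnegrE ?mulr_ge0 ?sqrtr_ge0 ?nm_ge0 //.
by have := hM b; rewrite !nmE -RCM RC_le exprMn (sqr_sqrtr M0).
Qed.

Lemma nm_mulr a : exists2 M : R, 0 <= M & forall b, nm (b * a) <= M * nm b.
Proof.
have [M M0 hM] := nm_mull (star a); exists M => // b.
by rewrite -nm_star sM -(nm_star b).
Qed.

(** Almost orthogonal increments: if every step is nearly orthogonal to the
    preceding partial sum and has small norm, the sum of [n] steps has norm of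
    order [n] in the correlation and [sqrt n] in the size of a step. *)
Lemma nm_sum_increments (n : nat) (Z : nat -> A) (al be : R) :
  0 <= al -> 0 <= be ->
  (forall j, (j < n)%N -> cabs (phi (star (\sum_(i < j) Z i) * Z j)) <=
     al * nm (\sum_(i < j) Z i)) ->
  (forall j, (j < n)%N -> nm (Z j) ^+ 2 <= be) ->
  nm (\sum_(i < n) Z i) <= 2 * al * n%:R + Num.sqrt (n%:R * be).
Proof.
move=> al0 be0 h1 h2.
set K := 2 * al * n%:R + Num.sqrt (n%:R * be).
have K0 : 0 <= K by rewrite addr_ge0 ?sqrtr_ge0 // !mulr_ge0.
(* [K] is chosen so that the bound of the induction below is at most [K ^+ 2]. *)
have hK : 2 * al * n%:R * K + n%:R * be <= K ^+ 2.
  rewrite expr2 [X in _ <= X]mulrDl lerD2l.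
  rewrite -[X in X <= _]sqr_sqrtr ?mulr_ge0 // expr2.
  by rewrite ler_wpM2l ?sqrtr_ge0 // lerDr !mulr_ge0.
have key : forall j, (j <= n)%N ->
   nm (\sum_(i < j) Z i) ^+ 2 <= j%:R * (2 * al * K + be).
  elim=> [|j IH] jn; first by rewrite big_ord0 nm0 expr0n mul0r.
  rewrite big_ord_recr /= sqr_nmD.
  have jK : nm (\sum_(i < j) Z i) <= K.
    rewrite -(@ler_pXn2r _ 2) ?nnegrE ?nm_ge0 //.
    apply: le_trans (IH (ltnW jn)) (le_trans _ hK).
    rewrite [X in _ <= X](_ : _ = n%:R * (2 * al * K + be)); last by ring.
    by rewrite ler_wpM2r ?addr_ge0 ?mulr_ge0 // ler_nat ltnW.
  have := Re_le_cabs (phi (star (\sum_(i < j) Z i) * Z j)).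
  rewrite ler_norml => /andP[_ e1].
  have e2 := h1 _ jn; have e3 := h2 _ jn; have e4 := IH (ltnW jn).
  have e5 : al * nm (\sum_(i < j) Z i) <= al * K by rewrite ler_wpM2l.
  rewrite -natr1 mulrDl mul1r; lra.
rewrite -(@ler_pXn2r _ 2) ?nnegrE ?nm_ge0 //; apply: le_trans (key _ (leqnn _)) _.
by apply: le_trans hK; rewrite le_eqVlt; apply/orP; left; apply/eqP; ring.
Qed.

End Tracial.

(** * Words in a free increment *)

Definition subalgebra (R : realType) (A : algType R[i]) (star : A -> A)
    (B : set A) : Prop :=
  [/\ B 1, forall a b, B a -> B b -> B (a + b), forall c a, B a -> B (c *: a),
      forall a b, B a -> B b -> B (a * b) & forall a, B a -> B (star a)].

Section Free.
Variables (R : realType) (A : algType R[i]) (phi : A -> R[i]).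

Definition polyv (p : {poly R[i]}) (a : A) : A := \sum_(i < size p) p`_i *: a ^+ i.

Definition powers (a : A) : set A := [set polyv p a | p in setT].

Lemma polyvE (p : {poly R[i]}) (a : A) : polyv p a = horner_alg a p.
Proof.
rewrite /polyv /horner_alg /horner_morph (horner_coef_wide _ (size_poly _ _)).
by apply: eq_bigr => i _; rewrite coef_map /= mulr_algl.
Qed.

Lemma powersD (a u v : A) : powers a u -> powers a v -> powers a (u + v).
Proof.
by case=> p _ <- [q _ <-]; exists (p + q) => //; rewrite !polyvE rmorphD.
Qed.

Lemma powersM (a u v : A) : powers a u -> powers a v -> powers a (u * v).
Proof.
by case=> p _ <- [q _ <-]; exists (p * q) => //; rewrite !polyvE rmorphM.
Qed.

Lemma powersX (a : A) c i : powers a (c *: a ^+ i).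
Proof.
exists (c *: 'X^i) => //; rewrite polyvE linearZ /= rmorphXn /=.
by rewrite horner_algX mulr_algl.
Qed.

Lemma powers_cst (a : A) (c : R[i]) : powers a c%:A.
Proof. by rewrite -(expr0 a); apply: powersX. Qed.

(** Products of centered elements taken alternately from two sets; the boolean
    tells which set the last factor is from. *)
Inductive alternating (B D : set A) : bool -> A -> Prop :=
| alternating1 b z : (if b then D z else B z) -> phi z = 0 -> alternating B D b z
| alternatingS b z w : alternating B D (~~ b) z -> (if b then D w else B w) ->
    phi w = 0 -> alternating B D b (z * w).

Definition free_pair (B D : set A) : Prop :=
  forall b z, alternating B D b z -> phi z = 0.
End Free.

(** The letters [x t] and [d t] form a family whose index [t] will run over the
    increments below a horizon; [d t] is an increment of length [h t], free from
    the past [B t] to which [x t] belongs.  All bounds are uniform in [t].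
    Freeness says that alternating centered products have trace zero; expanding
    a word into such products shows how many powers of [h] it is worth. *)
Section Words.
Variables (R : realType) (A : algType R[i]) (star : A -> A) (phi : {scalar A}).
Hypothesis tA : tracial star phi.
Variables (T : Type) (B : T -> set A) (x d : T -> A) (h : T -> R) (hmax : R).
Hypothesis hB : forall t, subalgebra star (B t).
Hypothesis hx : forall t, B t (x t).
Hypothesis hfree : forall t, free_pair phi (B t) (powers (d t)).
Hypothesis xs : forall t, star (x t) = x t.
Hypothesis ds : forall t, star (d t) = d t.
Hypothesis h0 : forall t, 0 <= h t.
Hypothesis hM : forall t, h t <= hmax.
Hypothesis mx : forall n, exists M, forall t, cabs (phi (x t ^+ n)) <= M.
Hypothesis md : forall n, (0 < n)%N ->
  exists M, forall t, cabs (phi (d t ^+ n)) <= M * h t.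

Local Notation C := R[i].
Implicit Types (c : T -> C) (g z w : T -> A).

Definition Oh e c := exists2 M, 0 <= M & forall t, cabs (c t) <= M * h t ^+ e.

Lemma OhM e e' c c' : Oh e c -> Oh e' c' -> Oh (e + e') (fun t => c t * c' t).
Proof.
move=> [M M0 hc] [M' M'0 hc']; exists (M * M'); first exact: mulr_ge0.
move=> t; rewrite cabsM exprD.
have -> : M * M' * (h t ^+ e * h t ^+ e') = (M * h t ^+ e) * (M' * h t ^+ e') by ring.
by apply: ler_pM => //; rewrite cabs_ge0.
Qed.

Lemma OhD e c c' : Oh e c -> Oh e c' -> Oh e (fun t => c t + c' t).
Proof.
move=> [M M0 hc] [M' M'0 hc']; exists (M + M'); first exact: addr_ge0.
by move=> t; rewrite mulrDl (le_trans (cabsD _ _)) // lerD.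
Qed.

Lemma OhN e c : Oh e c -> Oh e (fun t => - c t).
Proof. by move=> [M M0 hc]; exists M => // t; rewrite cabsN. Qed.

Lemma Oh_conj e c : Oh e c -> Oh e (fun t => (c t)^*).
Proof. by move=> [M M0 hc]; exists M => // t; rewrite cabsJ. Qed.

Lemma OhW e c : Oh e c -> Oh 0 c.
Proof.
move=> [M M0 hc]; exists (M * `|hmax| ^+ e); first by rewrite mulr_ge0 ?exprn_ge0.
move=> t; rewrite expr0 mulr1 (le_trans (hc t)) // ler_wpM2l //.
by apply: lerXn2r; rewrite ?nnegrE // (le_trans (hM t)) ?ler_norm.
Qed.

Lemma Oh_cst (c : C) : Oh 0 (fun _ => c).
Proof. by exists (cabs c); rewrite ?cabs_ge0 // => t; rewrite expr0 mulr1. Qed.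

Lemma Oh0E c : (exists M, forall t, cabs (c t) <= M) -> Oh 0 c.
Proof.
move=> [M hc]; exists `|M| => // t; rewrite expr0 mulr1.
by rewrite (le_trans (hc t)) ?ler_norm.
Qed.

Lemma Oh_d n : (0 < n)%N -> Oh 1 (fun t => phi (d t ^+ n)).
Proof.
move=> /md[M hc]; exists `|M| => // t; rewrite expr1 (le_trans (hc t)) //.
by rewrite ler_wpM2r ?ler_norm.
Qed.

(** Polynomials in [x t] with bounded coefficients. *)
Inductive polyx : (T -> A) -> Prop :=
| polyx_mon c i g : Oh 0 c -> (forall t, g t = c t *: x t ^+ i) -> polyx g
| polyx_add g1 g2 g : polyx g1 -> polyx g2 -> (forall t, g t = g1 t + g2 t) -> polyx g.

Lemma polyx_ext g g' : (forall t, g t = g' t) -> polyx g' -> polyx g.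
Proof. by move=> /funext ->. Qed.

Lemma polyxX i : polyx (fun t => x t ^+ i).
Proof. by apply: (@polyx_mon (fun _ => 1) i); [exact: Oh_cst|move=> t; rewrite scale1r]. Qed.

Lemma polyx1 : polyx (fun t => 1).
Proof. exact: polyx_ext (polyxX 0). Qed.

Lemma polyxZ c g : Oh 0 c -> polyx g -> polyx (fun t => c t *: g t).
Proof.
move=> hc; elim=> [c' i {}g hc' e|g1 g2 {}g _ IH1 _ IH2 e].
  apply: (@polyx_mon (fun t => c t * c' t) i); first exact: (OhM hc hc').
  by move=> t; rewrite e scalerA.
by apply: (polyx_add IH1 IH2) => t; rewrite e scalerDr.
Qed.

Lemma polyxM g g' : polyx g -> polyx g' -> polyx (fun t => g t * g' t).
Proof.
move=> hg hg'; elim: hg => [c i {}g hc e|g1 g2 {}g _ IH1 _ IH2 e]; last first.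
  by apply: (polyx_add IH1 IH2) => t; rewrite e mulrDl.
elim: hg' => [c' j {}g' hc' e'|g1 g2 {}g' _ IH1 _ IH2 e']; last first.
  by apply: (polyx_add IH1 IH2) => t; rewrite e' mulrDr.
apply: (@polyx_mon (fun t => c t * c' t) (i + j)); first exact: (OhM hc hc').
by move=> t; rewrite e e' -scalerAl -scalerAr scalerA exprD.
Qed.

Lemma polyx_star g : polyx g -> polyx (fun t => star (g t)).
Proof.
elim=> [c i {}g hc e|g1 g2 {}g _ IH1 _ IH2 e]; last first.
  by apply: (polyx_add IH1 IH2) => t; rewrite e (starD tA).
apply: (polyx_mon (i := i) (Oh_conj hc)) => t.
by rewrite e (starZ tA) (starX tA) xs.
Qed.

Lemma polyx_phi g : polyx g -> Oh 0 (fun t => phi (g t)).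
Proof.
elim=> [c i {}g hc e|g1 g2 {}g _ IH1 _ IH2 e]; last first.
  by have -> : (fun t => phi (g t)) = (fun t => phi (g1 t) + phi (g2 t));
    [apply/funext => t; rewrite e phiD | exact: OhD].
have -> : (fun t => phi (g t)) = (fun t => c t * phi (x t ^+ i)).
  by apply/funext => t; rewrite e phiZ.
by apply: (OhM hc); apply: Oh0E.
Qed.

Lemma polyx_nm g : polyx g -> exists2 M, 0 <= M & forall t, nm star phi (g t) <= M.
Proof.
move=> hg; have [M M0 h1] := polyx_phi (polyxM (polyx_star hg) hg).
exists (Num.sqrt M); rewrite ?sqrtr_ge0 // => t.
rewrite /nm ler_sqrt //; apply: le_trans (ler_norm _) (le_trans (Re_le_cabs _) _).
by rewrite (le_trans (h1 t)) // expr0 mulr1.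
Qed.

Lemma polyx_mem g t : polyx g -> B t (g t).
Proof.
have [b1 bD bZ bM _] := hB t.
elim=> [c i {}g hc ->|g1 g2 {}g _ IH1 _ IH2 ->]; last exact: bD.
by apply: (bZ); elim: i => [|i IH]; rewrite ?expr0 // exprS; apply: bM.
Qed.

Lemma polyx_center g : polyx g -> polyx (fun t => g t - (phi (g t))%:A).
Proof.
move=> hg; apply: (polyx_add hg (polyxZ (OhN (polyx_phi hg)) polyx1)) => t.
by rewrite scaleNr.
Qed.

Lemma phi_center a : phi (a - (phi a)%:A) = 0.
Proof. by rewrite phiB phiZ (tr1 tA) mulr1 subrr. Qed.

(** Polynomials in [d t] whose constant term, like every moment of [d t], is of
    order [h t]. *)
Inductive polyd : (T -> A) -> Prop :=
| polyd_mon c i g : Oh 0 c -> (0 < i)%N -> (forall t, g t = c t *: d t ^+ i) -> polyd g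
| polyd_cst c g : Oh 1 c -> (forall t, g t = (c t)%:A) -> polyd g
| polyd_add g1 g2 g : polyd g1 -> polyd g2 -> (forall t, g t = g1 t + g2 t) -> polyd g.

Lemma polydX i : (0 < i)%N -> polyd (fun t => d t ^+ i).
Proof. by move=> i0; apply: (polyd_mon (Oh_cst 1) i0) => t; rewrite scale1r. Qed.

Lemma polyd_phi g : polyd g -> Oh 1 (fun t => phi (g t)).
Proof.
elim=> [c i {}g hc i0 e|c {}g hc e|g1 g2 {}g _ IH1 _ IH2 e].
- have -> : (fun t => phi (g t)) = (fun t => c t * phi (d t ^+ i)).
    by apply/funext => t; rewrite e phiZ.
  exact: (OhM hc (Oh_d i0)).
- have -> : (fun t => phi (g t)) = (fun t => c t * 1).
    by apply/funext => t; rewrite e phiZ (tr1 tA).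
  exact: (OhM hc (Oh_cst 1)).
- have -> : (fun t => phi (g t)) = (fun t => phi (g1 t) + phi (g2 t)).
    by apply/funext => t; rewrite e phiD.
  exact: OhD.
Qed.

Lemma polyd_center g : polyd g -> polyd (fun t => g t - (phi (g t))%:A).
Proof.
move=> hg; apply: (polyd_add hg (polyd_cst (OhN (polyd_phi hg)) (fun t => erefl))) => t.
by rewrite scaleNr.
Qed.

Lemma polyd_mulX g m : polyd g -> (0 < m)%N -> polyd (fun t => g t * d t ^+ m).
Proof.
move=> hg m0; elim: hg => [c i {}g hc i0 e|c {}g hc e|g1 g2 {}g _ IH1 _ IH2 e].
- apply: (@polyd_mon c (i + m)) => //; first by rewrite addn_gt0 i0.
  by move=> t; rewrite e -scalerAl exprD.
- by apply: (polyd_mon (OhW hc) m0) => t; rewrite e -scalerAl mul1r.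
- by apply: (polyd_add IH1 IH2) => t; rewrite e mulrDl.
Qed.

Lemma polyd_mem g t : polyd g -> powers (d t) (g t).
Proof.
elim=> [c i {}g hc i0 ->|c {}g hc ->|g1 g2 {}g _ IH1 _ IH2 ->].
- exact: powersX.
- exact: powers_cst.
- exact: powersD.
Qed.

(** Alternating products of centered factors, beginning and ending with a
    polynomial in [d t]; they have zero conditional expectation on [B t]. *)
Inductive cword : (T -> A) -> Prop :=
| cword1 z : polyd z -> (forall t, phi (z t) = 0) -> cword z
| cwordS w s z w' : cword w -> polyx s -> (forall t, phi (s t) = 0) ->
    polyd z -> (forall t, phi (z t) = 0) -> (forall t, w' t = w t * s t * z t) ->
    cword w'.

Lemma cword_alternating w t a : cword w -> B t a -> phi a = 0 ->
  alternating phi (B t) (powers (d t)) true (w t) /\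
  alternating phi (B t) (powers (d t)) true (a * w t).
Proof.
move=> hw Ba a0; elim: hw => {w} [z hz z0|w s z w' hw [IH1 IH2] hs s0 hz z0 ->].
  split; first by apply: alternating1 => //; apply: polyd_mem.
  apply: alternatingS => //; last exact: polyd_mem.
  exact: alternating1.
have step y : alternating phi (B t) (powers (d t)) true y ->
    alternating phi (B t) (powers (d t)) true (y * s t * z t).
  move=> hy; apply: alternatingS => //; last exact: polyd_mem.
  by apply: alternatingS => //=; apply: polyx_mem.
by rewrite !mulrA; split; apply: step.
Qed.

Lemma phi_cword w t a : cword w -> B t a -> phi (a * w t) = 0.
Proof.
move=> hw Ba; have [b1 bD bZ bM _] := hB t.
have Bc : B t (a - (phi a)%:A) by rewrite -scaleNr; apply: (bD) => //; apply: bZ.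
have [h1 h2] := cword_alternating hw Bc (phi_center a).
have -> : a * w t = (a - (phi a)%:A) * w t + phi a *: w t.
  by rewrite mulrBl -scalerAl mul1r subrK.
by rewrite phiD phiZ (hfree h1) (hfree h2) mulr0 addr0.
Qed.

(** Terms of order [h ^ e] depending on [x] only, plus terms with zero
    conditional expectation on [B t]: paired with an element of the past, such a
    sum is of order [h ^ e]. *)
Inductive Vclass (e : nat) : (T -> A) -> Prop :=
| Vclass_x c g z : Oh e c -> polyx g -> (forall t, z t = c t *: g t) -> Vclass e z
| Vclass_c g w g' z : polyx g -> cword w -> polyx g' ->
    (forall t, z t = g t * w t * g' t) -> Vclass e z
| Vclass_add z1 z2 z : Vclass e z1 -> Vclass e z2 ->
    (forall t, z t = z1 t + z2 t) -> Vclass e z.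

Lemma Vclass_ext e z z' : (forall t, z t = z' t) -> Vclass e z' -> Vclass e z.
Proof. by move=> /funext ->. Qed.

(** What remains of [Vclass 0] after multiplication by a power of [d]. *)
Inductive Wclass : (T -> A) -> Prop :=
| Wclass_x c g z : Oh 1 c -> polyx g -> (forall t, z t = c t *: g t) -> Wclass z
| Wclass_c g w z : polyx g -> cword w -> (forall t, z t = g t * w t) -> Wclass z
| Wclass_h c g w g' z : Oh 1 c -> polyx g -> cword w -> polyx g' ->
    (forall t, z t = c t *: (g t * w t * g' t)) -> Wclass z
| Wclass_add z1 z2 z : Wclass z1 -> Wclass z2 ->
    (forall t, z t = z1 t + z2 t) -> Wclass z.

Lemma Wclass_mull g z : polyx g -> Wclass z -> Wclass (fun t => g t * z t).
Proof.
move=> hg; elim=> {z} [c g' z hc hg' e|g' w z hg' hw e|c g1 w g2 z hc h1 hw h2 e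
  |z1 z2 z _ IH1 _ IH2 e].
- by apply: (Wclass_x hc (polyxM hg hg')) => t; rewrite e scalerAr.
- by apply: (Wclass_c (polyxM hg hg') hw) => t; rewrite e mulrA.
- by apply: (Wclass_h hc (polyxM hg h1) hw h2) => t; rewrite e -scalerAr !mulrA.
- by apply: (Wclass_add IH1 IH2) => t; rewrite e mulrDr.
Qed.

Lemma Wclass_scale c z : Oh 0 c -> Wclass z -> Wclass (fun t => c t *: z t).
Proof.
move=> hc hz; have := Wclass_mull (polyxZ hc polyx1) hz.
by have -> // : (fun t => c t *: 1 * z t) = (fun t => c t *: z t);
  apply/funext => t; rewrite -scalerAl mul1r.
Qed.

Lemma center_split (a b c : A) : a * b * c =
  a * (b - (phi b)%:A) * c + phi b *: (a * c).
Proof. by rewrite mulrBr mulrBl -scalerAr mulr1 -scalerAl subrK. Qed.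

Lemma center_splitr (a b : A) : a * b = a * (b - (phi b)%:A) + phi b *: a.
Proof. by rewrite mulrBr -scalerAr mulr1 subrK. Qed.

Lemma cword_mulX w m : cword w -> (0 < m)%N -> Wclass (fun t => w t * d t ^+ m).
Proof.
move=> hw m0; case: hw => {w} [z hz z0|w s z w' hw hs s0 hz z0 e].
  have hp := polyd_mulX hz m0.
  apply: (Wclass_add (Wclass_c polyx1 (cword1 (polyd_center hp) _) (fun t => erefl))
     (Wclass_x (polyd_phi hp) polyx1 (fun t => erefl))) => t.
    by rewrite phi_center.
  by rewrite mul1r subrK.
have hp := polyd_mulX hz m0.
apply: (Wclass_add (Wclass_c polyx1 (cwordS hw hs s0 (polyd_center hp) _ (fun t => erefl))
    (fun t => erefl))
    (Wclass_h (polyd_phi hp) polyx1 hw hs (fun t => erefl))) => t.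
  by rewrite phi_center.
by rewrite !mul1r e -mulrA center_splitr.
Qed.

Lemma Vclass_mulX z m : Vclass 0 z -> (0 < m)%N -> Wclass (fun t => z t * d t ^+ m).
Proof.
move=> hz m0; have hd := polydX m0; have hd0 := polyd_center hd.
elim: hz => {z} [c g z hc hg e|g w g' z hg hw hg' e|z1 z2 z _ IH1 _ IH2 e].
- have hcg := polyxZ hc hg.
  apply: (Wclass_add (Wclass_c hcg (cword1 hd0 _) (fun t => erefl))
    (Wclass_x (Oh_d m0) hcg (fun t => erefl))) => t; first by rewrite phi_center.
  by rewrite e center_splitr.
- have hs := polyx_center hg'.
  have s0 t : phi (g' t - (phi (g' t))%:A) = 0 by rewrite phi_center.
  have d0 t : phi (d t ^+ m - (phi (d t ^+ m))%:A) = 0 by rewrite phi_center.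
  apply: (Wclass_add (Wclass_add
    (Wclass_c hg (cwordS hw hs s0 hd0 d0 (fun t => erefl)) (fun t => erefl))
    (Wclass_h (Oh_d m0) hg hw hs (fun t => erefl)) (fun t => erefl))
    (Wclass_scale (polyx_phi hg') (Wclass_mull hg (cword_mulX hw m0)))) => t /=.
  by rewrite e center_split !mulrA -center_splitr.
- by apply: (Wclass_add IH1 IH2) => t; rewrite e mulrDl.
Qed.

Lemma Vclass_mulx e z g : Vclass e z -> polyx g -> Vclass e (fun t => z t * g t).
Proof.
move=> hz hg; elim: hz => {z} [c g' z hc hg' e'|g1 w g2 z h1 hw h2 e'|z1 z2 z _ IH1 _ IH2 e'].
- by apply: (Vclass_x hc (polyxM hg' hg)) => t; rewrite e' scalerAl.
- by apply: (Vclass_c _ h1 hw (polyxM h2 hg)) => t; rewrite e' mulrA.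
- by apply: (Vclass_add IH1 IH2) => t; rewrite e' mulrDl.
Qed.

Lemma Wclass_mulx z g : Wclass z -> polyx g -> Vclass 1 (fun t => z t * g t).
Proof.
move=> hz hg; elim: hz => {z} [c g' z hc hg' e|g' w z hg' hw e|c g1 w g2 z hc h1 hw h2 e
  |z1 z2 z _ IH1 _ IH2 e].
- by apply: (Vclass_x hc (polyxM hg' hg)) => t; rewrite e scalerAl.
- by apply: (Vclass_c _ hg' hw hg) => t; rewrite e.
- apply: (Vclass_c _ (polyxZ (OhW hc) h1) hw (polyxM h2 hg)) => t.
  by rewrite e -!scalerAl mulrA.
- by apply: (Vclass_add IH1 IH2) => t; rewrite e mulrDl.
Qed.

Lemma Wclass_V z : Wclass z -> Vclass 1 z.
Proof. by move=> hz; apply: Vclass_ext (Wclass_mulx hz polyx1) => t; rewrite mulr1. Qed.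

Lemma VclassW e z : Vclass e z -> Vclass 0 z.
Proof.
elim=> {z} [c g z hc hg e'|g1 w g2 z h1 hw h2 e'|z1 z2 z _ IH1 _ IH2 e'].
- exact: (Vclass_x (OhW hc) hg e').
- exact: (Vclass_c _ h1 hw h2 e').
- exact: (Vclass_add IH1 IH2 e').
Qed.

Lemma Vclass_scale e e' c z : Vclass e z -> Oh e' c ->
  Vclass (e + e') (fun t => c t *: z t).
Proof.
move=> hz hc; elim: hz => {z} [c' g z hc' hg E|g1 w g2 z h1 hw h2 E|z1 z2 z _ IH1 _ IH2 E].
- by apply: (Vclass_x (OhM hc' hc) hg) => t; rewrite E scalerA mulrC.
- by apply: (Vclass_c _ (polyxZ (OhW hc) h1) hw h2) => t; rewrite E -!scalerAl.
- by apply: (Vclass_add IH1 IH2) => t; rewrite E scalerDr.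
Qed.

(** The second factor [h] in a word with two separated powers of [d]: when the
    factor between them is centered, the word is a product of alternating
    centered factors up to a term with [h ^ 2] in front. *)
Lemma Wclass_center z a m : Wclass z -> polyx a -> (forall t, phi (a t) = 0) ->
  (0 < m)%N -> Vclass 2 (fun t => z t * a t * d t ^+ m).
Proof.
move=> hz ha a0 m0; have hd := polydX m0; have hd0 := polyd_center hd.
have d0 t : phi (d t ^+ m - (phi (d t ^+ m))%:A) = 0 by rewrite phi_center.
elim: hz => {z} [c g z hc hg e|g w z hg hw e|c g1 w g2 z hc h1 hw h2 e
  |z1 z2 z _ IH1 _ IH2 e].
- have hga := polyxM (polyxZ (OhW hc) hg) ha.
  apply: (Vclass_add (Vclass_c _ hga (cword1 hd0 d0) polyx1 (fun t => erefl))
     (Vclass_x (OhM (Oh_d m0) hc) (polyxM hg ha) (fun t => erefl))) => t.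
  by rewrite mulr1 e center_splitr -[in X in _ + X]scalerAl scalerA.
- apply: (Vclass_add (Vclass_c _ hg (cwordS hw ha a0 hd0 d0 (fun t => erefl)) polyx1
      (fun t => erefl))
     (Vclass_c _ (polyxZ (OhW (Oh_d m0)) hg) hw ha (fun t => erefl))) => t.
  by rewrite mulr1 e center_splitr -!scalerAl !mulrA.
- have h3 := Vclass_c 0 h1 hw (polyxM h2 ha) (fun t => erefl).
  apply: Vclass_ext (Vclass_scale (Wclass_V (Vclass_mulX h3 m0)) hc) => t.
  by rewrite e -!scalerAl !mulrA.
- by apply: (Vclass_add IH1 IH2) => t; rewrite e !mulrDl.
Qed.

(** The algebra generated by [x] and [d], with bounded coefficients. *)
Inductive polyxd : (T -> A) -> Prop :=
| polyxd_x g : polyx g -> polyxd g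
| polyxd_d m z : (0 < m)%N -> (forall t, z t = d t ^+ m) -> polyxd z
| polyxd_add z1 z2 z : polyxd z1 -> polyxd z2 -> (forall t, z t = z1 t + z2 t) -> polyxd z
| polyxd_mul z1 z2 z : polyxd z1 -> polyxd z2 -> (forall t, z t = z1 t * z2 t) -> polyxd z.

Lemma polyxd_star z : polyxd z -> polyxd (fun t => star (z t)).
Proof.
elim=> {z} [g hg|m z m0 e|z1 z2 z _ IH1 _ IH2 e|z1 z2 z _ IH1 _ IH2 e].
- exact/polyxd_x/polyx_star.
- by apply: (polyxd_d m0) => t; rewrite e (starX tA) ds.
- by apply: (polyxd_add IH1 IH2) => t; rewrite e (starD tA).
- by apply: (polyxd_mul IH2 IH1) => t; rewrite e (starM tA).
Qed.

Lemma Vclass_mul e z p : (e <= 1)%N -> Vclass e z -> polyxd p ->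
  Vclass e (fun t => z t * p t).
Proof.
move=> e1 hz hp; elim: hp z hz => {p} [g hg|m p m0 E|p1 p2 p _ IH1 _ IH2 E
   |p1 p2 p _ IH1 _ IH2 E] z hz.
- exact: Vclass_mulx.
- have h1 := Wclass_V (Vclass_mulX (VclassW hz) m0).
  have h2 : Vclass 1 (fun t => z t * p t) by apply: Vclass_ext h1 => t; rewrite E.
  by case: e e1 {hz} => [|[|//]] _ //; apply: VclassW h2.
- by apply: (Vclass_add (IH1 _ hz) (IH2 _ hz)) => t; rewrite E mulrDr.
- by apply: Vclass_ext (IH2 _ (IH1 _ hz)) => t; rewrite E mulrA.
Qed.

Lemma polyxd_V z : polyxd z -> Vclass 0 z.
Proof.
have h1 : Vclass 0 (fun t => 1).
  by apply: (Vclass_x (Oh_cst 1) polyx1) => t; rewrite scale1r.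
by move=> hz; apply: Vclass_ext (Vclass_mul (leq0n 1) h1 hz) => t; rewrite mul1r.
Qed.

Lemma Vclass_bound e z : Vclass e z -> exists2 M, 0 <= M & forall t a, B t a ->
  cabs (phi (a * z t)) <= M * h t ^+ e * nm star phi a.
Proof.
elim=> {z} [c g z [M M0 hc] hg E|g1 w g2 z h1 hw h2 E
  |z1 z2 z _ [M1 M10 IH1] _ [M2 M20 IH2] E].
- have [N N0 hN] := polyx_nm hg; exists (M * N) => [|t a Ba]; first exact: mulr_ge0.
  rewrite E -scalerAr phiZ cabsM.
  have -> : M * N * h t ^+ e * nm star phi a = M * h t ^+ e * (nm star phi a * N) by ring.
  apply: ler_pM; rewrite ?cabs_ge0 // (le_trans (cabs_phi_mul tA _ _)) //.
  by rewrite ler_wpM2l ?nm_ge0.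
- exists 0 => // t a Ba; rewrite E mulrA (trC tA) !mulrA.
  have [_ _ _ bM _] := hB t.
  rewrite phi_cword ?cabs0 ?mul0r //.
  by apply: (bM); [apply: (bM) => //|]; apply: polyx_mem.
- exists (M1 + M2) => [|t a Ba]; first exact: addr_ge0.
  rewrite E mulrDr phiD (le_trans (cabsD _ _)) // !mulrDl.
  by rewrite lerD ?IH1 ?IH2.
Qed.

Lemma word_bound1 u v m : polyxd u -> polyxd v -> (0 < m)%N ->
  exists2 M, 0 <= M & forall t a, B t a ->
  cabs (phi (a * (u t * d t ^+ m * v t))) <= M * h t * nm star phi a.
Proof.
move=> hu hv m0.
have [M M0 hb] := Vclass_bound (Vclass_mul (leqnn 1) (Wclass_V (Vclass_mulX (polyxd_V hu) m0)) hv).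
by exists M.
Qed.

Lemma word_bound2 u a b m m' : polyxd u -> polyx a -> polyx b ->
  (0 < m)%N -> (0 < m')%N ->
  exists2 M, 0 <= M & forall t s, B t s ->
  cabs (phi (s * (u t * d t ^+ m * (a t - (phi (a t))%:A) * d t ^+ m' * b t))) <=
     M * h t ^+ 2 * nm star phi s.
Proof.
move=> hu ha hb m0 m'0.
have h1 := Vclass_mulX (polyxd_V hu) m0.
have h2 := Wclass_center h1 (polyx_center ha) (fun t => phi_center _) m'0.
exact: (Vclass_bound (Vclass_mulx h2 hb)).
Qed.

(** The square of the norm is a trace to which the previous bounds apply, with
    the adjoint of the word absorbed in [u]. *)
Lemma word_norm1 u v m : polyxd u -> polyxd v -> (0 < m)%N ->
  exists2 M, 0 <= M & forall t, nm star phi (u t * d t ^+ m * v t) ^+ 2 <= M * h t.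
Proof.
move=> hu hv m0.
have hz : polyxd (fun t => u t * d t ^+ m * v t).
  apply: (@polyxd_mul (fun t => u t * d t ^+ m) v) => //.
  exact: (polyxd_mul hu (polyxd_d m0 (fun t => erefl))).
have [M M0 hb] := word_bound1 (polyxd_mul (polyxd_star hz) hu (fun t => erefl)) hv m0.
exists M => // t; have [b1 _ _ _ _] := hB t.
have := hb t 1 b1; rewrite mul1r (nm1 tA) mulr1 (sqr_nm tA) !mulrA => e.
by apply: le_trans (ler_norm _) (le_trans (Re_le_cabs _) e).
Qed.

Lemma word_norm2 u a b m m' : polyxd u -> polyx a -> polyx b ->
  (0 < m)%N -> (0 < m')%N ->
  exists2 M, 0 <= M & forall t,
  nm star phi (u t * d t ^+ m * (a t - (phi (a t))%:A) * d t ^+ m' * b t) ^+ 2 <=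
     M * h t ^+ 2.
Proof.
move=> hu ha hb m0 m'0.
have hz : polyxd (fun t => u t * d t ^+ m * (a t - (phi (a t))%:A) * d t ^+ m' * b t).
  have hD m1 (m10 : (0 < m1)%N) : polyxd (fun t => d t ^+ m1).
    exact: (polyxd_d m10 (fun t => erefl)).
  have hac := polyxd_x (polyx_center ha).
  apply: (polyxd_mul _ (polyxd_x hb) (fun t => erefl)).
  apply: (polyxd_mul _ (hD _ m'0) (fun t => erefl)).
  apply: (polyxd_mul _ hac (fun t => erefl)).
  exact: (polyxd_mul hu (hD _ m0) (fun t => erefl)).
have [M M0 hb'] := word_bound2 (polyxd_mul (polyxd_star hz) hu (fun t => erefl)) ha hb m0 m'0.
exists M => // t; have [b1 _ _ _ _] := hB t.
have := hb' t 1 b1; rewrite mul1r (nm1 tA) mulr1 (sqr_nm tA) !mulrA => e.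
by apply: le_trans (ler_norm _) (le_trans (Re_le_cabs _) e).
Qed.

(** The elements of second order: both the conditional expectation on [B t] and
    the square of the norm are of order [h ^ 2]. *)
Definition order2 z := exists2 M, 0 <= M & forall t,
  (forall a, B t a -> cabs (phi (a * z t)) <= M * h t ^+ 2 * nm star phi a) /\
  nm star phi (z t) <= M * h t.

Lemma order2_ext z z' : (forall t, z t = z' t) -> order2 z' -> order2 z.
Proof. by move=> /funext ->. Qed.

Lemma order2_0 : order2 (fun=> 0).
Proof.
exists 0 => // t; rewrite nm0 !mul0r; split=> // a _.
by rewrite mulr0 phi0 cabs0 mul0r.
Qed.

Lemma order2_add z z' : order2 z -> order2 z' -> order2 (fun t => z t + z' t).
Proof.
move=> [M M0 hz] [M' M'0 hz']; exists (M + M'); first exact: addr_ge0.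
move=> t; have [h1 h2] := hz t; have [h3 h4] := hz' t; split=> [a Ba|].
  by rewrite mulrDr phiD (le_trans (cabsD _ _)) // !mulrDl lerD ?h1 ?h3.
by rewrite (le_trans (nmD tA _ _)) // mulrDl lerD.
Qed.

Lemma order2_scale c z : Oh 0 c -> order2 z -> order2 (fun t => c t *: z t).
Proof.
move=> [N N0 hc] [M M0 hz]; exists (N * M); first exact: mulr_ge0.
have hcN t : cabs (c t) <= N by rewrite -[N]mulr1 -(expr0 (h t)).
move=> t; have [h1 h2] := hz t; split=> [a Ba|].
  rewrite -scalerAr phiZ cabsM -!mulrA ler_pM ?cabs_ge0 //.
  by rewrite !mulrA; have := h1 a Ba; rewrite !mulrA.
by rewrite (nmZ tA) -mulrA ler_pM ?cabs_ge0 ?nm_ge0.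
Qed.

Lemma order2_word u a b m m' : polyxd u -> polyx a -> polyx b ->
  (0 < m)%N -> (0 < m')%N ->
  order2 (fun t => b t * d t ^+ m * (a t - (phi (a t))%:A) * d t ^+ m' * u t).
Proof.
move=> hu ha hb m0 m'0.
have [M M0 hM1] := word_bound2 (polyxd_star hu) (polyx_star ha) (polyx_star hb) m'0 m0.
have [M' M'0 hM2] := word_norm2 (polyxd_star hu) (polyx_star ha) (polyx_star hb) m'0 m0.
have E t : star (star (u t) * d t ^+ m' * (star (a t) - (phi (star (a t)))%:A) *
     d t ^+ m * star (b t)) =
   b t * d t ^+ m * (a t - (phi (a t))%:A) * d t ^+ m' * u t.
  rewrite !(starM tA) !(starK tA) !(starX tA) ds (starB tA) (starK tA) (starZ tA).
  by rewrite (star1 tA) (phi_star tA) conjCK !mulrA.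
have hMM : 0 <= M + Num.sqrt M' by rewrite addr_ge0 // sqrtr_ge0.
exists (M + Num.sqrt M') => // t; split=> [s Bs|].
  have [_ _ _ _ bS] := hB t.
  rewrite -E -[s](starK tA) -(starM tA) (phi_star tA) cabsJ (trC tA) (nm_star tA).
  apply: le_trans (hM1 t (star s) (bS _ Bs)) _.
  by rewrite ler_wpM2r ?nm_ge0 // ler_wpM2r ?sqr_ge0 // lerDl sqrtr_ge0.
rewrite -E (nm_star tA) -(@ler_pXn2r _ 2) ?nnegrE ?nm_ge0 ?mulr_ge0 //.
apply: le_trans (hM2 t) _; rewrite exprMn ler_wpM2r ?sqr_ge0 //.
rewrite -[X in X <= _](sqr_sqrtr M'0) ler_pXn2r ?nnegrE ?sqrtr_ge0 //.
by rewrite lerDr.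
Qed.

(** By induction on the word, from the left: centering the first inner power of
    [x] splits off a word that is of second order, and leaves its trace times a
    word with one inner power less. *)
Lemma order2_expand i m j (l : seq nat) : (0 < m)%N ->
  order2 (fun t => x t ^+ i * d t ^+ m * (x t ^+ j * \prod_(e <- l) (d t * x t ^+ e)) -
    (\prod_(e <- belast j l) phi (x t ^+ e)) *:
      (x t ^+ i * d t ^+ (m + size l) * x t ^+ last j l)).
Proof.
elim: l m j => [|e l IH] m j m0.
  by apply: order2_ext order2_0 => t; rewrite !big_nil mulr1 addn0 scale1r subrr.
have hw (l' : seq nat) : polyxd (fun t => \prod_(e' <- l') (d t * x t ^+ e')).
  elim: l' => [|e' l' IHl].
    by apply: (polyxd_x (polyx_ext _ polyx1)) => t; rewrite big_nil.
  have h1 := polyxd_mul (polyxd_d (ltn0Sn 0) (fun t => erefl)) (polyxd_x (polyxX e'))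
    (fun t => erefl).
  by apply: (polyxd_mul h1 IHl) => t; rewrite big_cons expr1.
have h1 := order2_word (polyxd_mul (polyxd_x (polyxX e)) (hw l) (fun t => erefl))
  (polyxX j) (polyxX i) m0 (ltn0Sn 0).
have h2 := order2_scale (polyx_phi (polyxX j)) (IH m.+1 e (ltn0Sn _)).
apply: order2_ext (order2_add h1 h2) => t /=.
rewrite !big_cons scalerBr scalerA addrA addnS addSn; congr (_ - _).
rewrite mulrBr !mulrBl -scalerAr mulr1 -!scalerAl expr1 !mulrA.
by rewrite exprSr !mulrA subrK.
Qed.

(** The two-sided ideal generated by [d]. *)
Inductive dideal : (T -> A) -> Prop :=
| dideal_word u v z : polyxd u -> polyxd v ->
    (forall t, z t = u t * d t * v t) -> dideal z
| dideal_add z1 z2 z : dideal z1 -> dideal z2 ->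
    (forall t, z t = z1 t + z2 t) -> dideal z.

Lemma dideal_norm z : dideal z ->
  exists2 M, 0 <= M & forall t, nm star phi (z t) <= M * Num.sqrt (h t).
Proof.
elim=> {z} [u v z hu hv e|z1 z2 z _ [M1 M10 IH1] _ [M2 M20 IH2] e].
  have [M M0 hM1] := word_norm1 hu hv (ltn0Sn 0).
  exists (Num.sqrt M); rewrite ?sqrtr_ge0 // => t; rewrite e -sqrtrM //.
  rewrite -[X in X <= _](ger0_norm (nm_ge0 _ _ _)) -sqrtr_sqr.
  by apply: ler_wsqrtr; have := hM1 t; rewrite expr1.
exists (M1 + M2) => [|t]; first exact: addr_ge0.
by rewrite e (le_trans (nmD tA _ _)) // mulrDl lerD.
Qed.

Lemma polyxd_xd n : polyxd (fun t => (x t + d t) ^+ n).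
Proof.
elim: n => [|n IH]; first exact: (polyxd_x (polyx_ext _ polyx1)).
have hd : polyxd d by apply: (polyxd_d (ltn0Sn 0)) => t; rewrite expr1.
have hxd := polyxd_add (polyxd_x (polyx_ext (fun t => esym (expr1 (x t))) (polyxX 1))) hd
  (fun t => erefl).
by apply: (polyxd_mul hxd IH) => t; rewrite exprS.
Qed.

Lemma dideal_diff n : (0 < n)%N -> dideal (fun t => (x t + d t) ^+ n - x t ^+ n).
Proof.
have h1 : polyxd (fun t => 1) by exact: (polyxd_x polyx1).
elim: n => [//|[|n] IH _].
  by apply: (dideal_word h1 h1) => t; rewrite !expr1 addrC addKr mul1r mulr1.
have hpx : polyxd x by apply: (polyxd_x (polyx_ext _ (polyxX 1))) => t; rewrite expr1.
have hl z : dideal z -> dideal (fun t => x t * z t).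
  elim=> {z} [u v z hu hv e|z1 z2 z _ IH1 _ IH2 e].
    by apply: (dideal_word (polyxd_mul hpx hu (fun t => erefl)) hv) => t; rewrite e !mulrA.
  by apply: (dideal_add IH1 IH2) => t; rewrite e mulrDr.
apply: (dideal_add (hl _ (IH isT)) (dideal_word h1 (polyxd_xd n.+1) (fun t => erefl))) => t.
by rewrite mul1r mulrBr -exprS [in LHS]exprS mulrDl addrAC.
Qed.

Lemma norm_diff_powers n :
  exists2 M, 0 <= M & forall t,
    nm star phi ((x t + d t) ^+ n - x t ^+ n) <= M * Num.sqrt (h t).
Proof.
case: n => [|n]; last exact: (dideal_norm (dideal_diff (ltn0Sn n))).
by exists 0 => // t; rewrite subrr nm0 mul0r.
Qed.

End Words.

(** * Free processes *)

(** The words in the expansion of [(x + d) ^+ n]: the pair [p] stands for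
    [x ^ i_0 d x ^ i_1 ... d x ^ i_k], where [i_0] is [p.1] and [p.2] lists
    [i_1, ..., i_k]. *)
Definition wordv (A : pzRingType) (x d : A) (p : nat * seq nat) : A :=
  x ^+ p.1 * \prod_(e <- p.2) (d * x ^+ e).

Fixpoint comps (n k : nat) : seq (nat * seq nat) :=
  if n is n'.+1 then
    [seq (p.1.+1, p.2) | p <- comps n' k] ++
    (if k is k'.+1 then [seq (0%N, p.1 :: p.2) | p <- comps n' k'] else [::])
  else if k is 0 then [:: (0%N, [::])] else [::].

Lemma comps_size n k p : p \in comps n k -> size p.2 = k.
Proof.
elim: n k p => [|n IH] [|k] p //=; rewrite ?mem_seq1 ?cats0.
- by move=> /eqP ->.
- by move=> /mapP[q /IH hq ->].
- by rewrite mem_cat => /orP[] /mapP[q /IH hq ->] //=; rewrite hq.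
Qed.

Lemma mem_comps n k p :
  (p \in comps n k) = (size p.2 == k) && (p.1 + sumn p.2 + k == n)%N.
Proof.
have inj1 : injective (fun p : nat * seq nat => (p.1.+1, p.2)).
  by move=> [a b] [c d] [-> ->].
have inj2 : injective (fun p : nat * seq nat => (0%N, p.1 :: p.2)).
  by move=> [a b] [c d] [-> ->].
elim: n k p => [|n IH] k [i l] /=.
  case: k => [|k]; rewrite ?mem_seq1 ?in_nil.
    case: l => [|j l] /=; first by rewrite !addn0 xpair_eqE andbT.
    by rewrite xpair_eqE andbF.
  by rewrite addnS andbF.
rewrite mem_cat; case: i => [|i].
  have -> : ((0%N, l) \in [seq (p.1.+1, p.2) | p <- comps n k]) = false.
    by apply/negbTE/mapP => -[q _ []].
  case: k => [|k] /=; first by case: l => //= j l.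
  case: l => [|j l].
    by rewrite /= [LHS](_ : _ = false) //; apply/negbTE/mapP => -[q _ []].
  by rewrite (mem_map inj2 _ (j, l)) IH /= eqSS add0n addnS eqSS.
rewrite (mem_map inj1 _ (i, l)) IH /= !addSn eqSS.
case: k => [|k]; first by rewrite orbF.
rewrite [X in _ || X](_ : _ = false) ?orbF //.
by apply/negbTE/mapP => -[q _ []].
Qed.

Lemma uniq_comps n k : uniq (comps n k).
Proof.
have inj1 : injective (fun p : nat * seq nat => (p.1.+1, p.2)).
  by move=> [a b] [c d] [-> ->].
have inj2 : injective (fun p : nat * seq nat => (0%N, p.1 :: p.2)).
  by move=> [a b] [c d] [-> ->].
elim: n k => [|n IH] [|k] //=; first by rewrite cats0 map_inj_uniq.
rewrite cat_uniq !map_inj_uniq // !IH andbT /=.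
by apply/hasPn => _ /mapP[q _ ->]; apply/mapP => -[q' _ []].
Qed.

Lemma comps_gt n k : (n < k)%N -> comps n k = [::].
Proof.
move=> nk; case E : (comps n k) => [//|p s].
have : p \in comps n k by rewrite E mem_head.
rewrite mem_comps => /andP[_ /eqP e].
by have := leq_addl (p.1 + sumn p.2)%N k; rewrite e leqNgt nk.
Qed.

Lemma comps_nn n : comps n n = [:: (0%N, nseq n 0%N)].
Proof.
elim: n => [//|n IH] /=.
by rewrite comps_gt //= IH.
Qed.

Lemma comps0 n : comps n 0 = [:: (n, [::])].
Proof. by elim: n => [//|n IH] /=; rewrite IH. Qed.

Lemma expr_words (A : pzRingType) (x d : A) n :
  (x + d) ^+ n = \sum_(k < n.+1) \sum_(p <- comps n k) wordv x d p.
Proof.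
elim: n => [|n IH]; first by rewrite big_ord1 big_seq1 /wordv big_nil mulr1.
rewrite exprS IH mulrDl mulr_sumr mulr_sumr.
have E1 : \sum_(k < n.+2) \sum_(p <- comps n k) wordv x d (p.1.+1, p.2) =
    \sum_(k < n.+1) x * \sum_(p <- comps n k) wordv x d p.
  rewrite big_ord_recr /= comps_gt // big_nil addr0; apply: eq_bigr => k _.
  by rewrite mulr_sumr; apply: eq_bigr => p _; rewrite /wordv exprS !mulrA.
rewrite -E1.
have E2 : \sum_(k < n.+1) d * \sum_(p <- comps n k) wordv x d p =
   \sum_(k < n.+1) \sum_(p <- comps n k) wordv x d (0%N, p.1 :: p.2).
  apply: eq_bigr => k _; rewrite mulr_sumr; apply: eq_bigr => p _.
  by rewrite /wordv big_cons /= mul1r !mulrA.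
rewrite E2 [in RHS]big_ord_recl /= cats0 big_map.
rewrite [in X in X + _ = _]big_ord_recl /= -addrA; congr (_ + _).
rewrite -big_split /=; apply: eq_bigr => k _.
by rewrite big_cat /= !big_map.
Qed.

(** The increments are described by their moments: [m n h] is the [n]-th moment
    of an increment of length [h] and [ka n] its derivative at [h = 0], which is
    the [n]-th free cumulant of the increments of length 1. *)
Record free_process (R : realType) (A : algType R[i]) (star : A -> A)
    (phi : {scalar A}) (F : R -> set A) (X : R -> R -> A) (m : nat -> R -> R)
    (ka : nat -> R) : Prop := {
  fp_sub : forall t, 0 <= t -> subalgebra star (F t);
  fp_incr : forall s t, 0 <= s -> s <= t -> F s `<=` F t;
  fp_mem : forall a b, 0 <= a -> a <= b -> F b (X a b);
  fp_star : forall a b, 0 <= a -> a <= b -> star (X a b) = X a b;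
  fp_add : forall a b c, 0 <= a -> a <= b -> b <= c -> X a b + X b c = X a c;
  fp_moment : forall a b n, 0 <= a -> a <= b ->
    phi (X a b ^+ n) = (m n (b - a))%:C%C;
  fp_small : forall n T, (0 < n)%N -> exists2 M, 0 <= M & forall h,
    0 <= h -> h <= T -> `|m n h - ka n * h| <= M * h ^+ 2;
  fp_free : forall t a b, 0 <= t -> t <= a -> a <= b ->
    free_pair phi (F t) (powers (X a b));
  fp_variance : m 2 1 - m 1 1 ^+ 2 = 1 }.

Section Process.
Variables (R : realType) (A : algType R[i]) (star : A -> A) (phi : {scalar A}).
Hypothesis tA : tracial star phi.
Variables (F : R -> set A) (X : R -> R -> A) (m : nat -> R -> R) (ka : nat -> R).
Hypothesis pX : free_process star phi F X m ka.
Local Notation C := R[i].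
Local Notation nm := (nm star phi).

Lemma moment_small n T : (0 < n)%N -> exists2 M, 0 <= M & forall h,
  0 <= h -> h <= T -> `|m n h| <= M * h.
Proof.
move=> n0; have [M M0 hM] := fp_small pX T n0.
exists (`|ka n| + M * `|T|) => [|h h0 hT]; first by rewrite addr_ge0 ?mulr_ge0.
have e := hM h h0 hT.
have e1 : h ^+ 2 <= `|T| * h.
  by rewrite expr2 ler_wpM2r // (le_trans hT) // ler_norm.
have e2 : M * h ^+ 2 <= M * (`|T| * h) by rewrite ler_wpM2l.
have : `|m n h| <= `|m n h - ka n * h| + `|ka n * h|.
  by rewrite -{1}[m n h](subrK (ka n * h)) ler_normD.
rewrite normrM (ger0_norm h0) => e3; rewrite mulrDl -mulrA; lra.
Qed.

Variable T : R.
Hypothesis T0 : 0 <= T.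

Definition window := {p : R * R | [&& 0 <= p.1, 0 <= p.2 & p.1 + p.2 <= T]}.
Implicit Types w : window.
Local Notation ws w := (sval w).1.
Local Notation wh w := (sval w).2.
Let x w := X 0 (ws w).
Let d w := X (ws w) (ws w + wh w).
Let h w := wh w.
Let B w := F (ws w).

Lemma ws0 w : 0 <= ws w. Proof. by case: w => p /= /and3P[]. Qed.
Lemma wh0 w : 0 <= wh w. Proof. by case: w => p /= /and3P[]. Qed.
Lemma whT w : wh w <= T.
Proof. by case: w => p /= /and3P[? ? ?]; lra. Qed.
Lemma wsT w : ws w <= T.
Proof. by case: w => p /= /and3P[? ? ?]; lra. Qed.
Lemma wsh w : ws w <= ws w + wh w. Proof. by rewrite lerDl wh0. Qed.

Let hB w : subalgebra star (B w). Proof. exact: (fp_sub pX (ws0 w)). Qed.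
Let hx w : B w (x w). Proof. exact: (fp_mem pX (lexx _) (ws0 w)). Qed.
Let hfree w : free_pair phi (B w) (powers (d w)).
Proof. exact: (fp_free pX (ws0 w) (lexx _) (wsh w)). Qed.
Let xs w : star (x w) = x w. Proof. exact: (fp_star pX (lexx _) (ws0 w)). Qed.
Let ds w : star (d w) = d w. Proof. exact: (fp_star pX (ws0 w) (wsh w)). Qed.

Let mx n : exists M, forall w, cabs (phi (x w ^+ n)) <= M.
Proof.
case: n => [|n].
  by exists 1 => w; rewrite expr0 (tr1 tA) ComplexField.Normc.normc1.
have [M M0 hM] := moment_small T (ltn0Sn n).
exists (M * T) => w; rewrite (fp_moment pX) ?ws0 // subr0 cabs_real.
rewrite (le_trans (hM _ (ws0 w) (wsT w))) // ler_wpM2l //; exact: wsT.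
Qed.

Let md n : (0 < n)%N -> exists M, forall w, cabs (phi (d w ^+ n)) <= M * h w.
Proof.
move=> n0; have [M M0 hM] := moment_small T n0; exists M => w.
rewrite (fp_moment pX) ?ws0 ?wsh // addrAC subrr add0r cabs_real.
by apply: hM; [exact: wh0|exact: whT].
Qed.

Lemma windowP s u : 0 <= s -> s <= u -> u <= T ->
  exists w, [/\ ws w = s, wh w = u - s & ws w + wh w = u].
Proof.
move=> s0 su uT.
have H : [&& 0 <= (s, u - s).1, 0 <= (s, u - s).2 & (s, u - s).1 + (s, u - s).2 <= T].
  by rewrite /= s0 subr_ge0 su addrC subrK.
by exists (exist _ (s, u - s) H); split=> //=; rewrite addrC subrK.
Qed.

Lemma X_moment_bounded n : exists2 M, 0 <= M & forall s, 0 <= s -> s <= T ->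
  cabs (phi (X 0 s ^+ n)) <= M.
Proof.
have [M hM] := mx n; exists `|M| => // s s0 sT.
have [w [<- _ _]] := windowP s0 (lexx s) sT.
by rewrite (le_trans (hM w)) ?ler_norm.
Qed.

Lemma X_norm_bounded n : exists2 M, 0 <= M & forall s, 0 <= s -> s <= T ->
  nm (X 0 s ^+ n) <= M.
Proof.
have [M M0 hM] := polyx_nm tA xs mx (polyxX x h n).
exists M => // s s0 sT.
by have [w [<- _ _]] := windowP s0 (lexx s) sT; apply: hM.
Qed.

Lemma X_hoelder n : exists2 M, 0 <= M & forall s u, 0 <= s -> s <= u -> u <= T ->
  nm (X 0 u ^+ n - X 0 s ^+ n) <= M * Num.sqrt (u - s).
Proof.
have [M M0 hM] := norm_diff_powers tA hB hx hfree xs ds wh0 whT mx md n.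
exists M => // s u s0 su uT; have [w [e1 e2 e3]] := windowP s0 su uT.
by have := hM w; rewrite /x /d /h e3 e1 e2 (fp_add pX).
Qed.

(** [order2_expand] for the family of all increments below the horizon [T]: this
    is what makes its constant uniform. *)
Lemma word_lead_order2 i j (l : seq nat) : exists2 M, 0 <= M & forall s u,
  0 <= s -> s <= u -> u <= T ->
  let z := wordv (X 0 s) (X s u) (i, j :: l) -
    (\prod_(e <- belast j l) phi (X 0 s ^+ e)) *:
     (X 0 s ^+ i * X s u ^+ (size l).+1 * X 0 s ^+ last j l) in
  (forall a, F s a -> cabs (phi (a * z)) <= M * (u - s) ^+ 2 * nm a) /\
  nm z <= M * (u - s).
Proof.
have [M M0 hM] := order2_expand tA hB hx hfree xs ds wh0 whT mx md i j l (ltn0Sn 0).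
exists M => // s u s0 su uT; have [w [e1 e2 e3]] := windowP s0 su uT.
have := hM w; rewrite /B /x /d /h e3 e1 e2 expr1.
by rewrite /wordv /= big_cons add1n !mulrA.
Qed.

End Process.

(** * Freeness from the past and uniform partitions *)

Section SubalgebraTheory.
Variables (R : realType) (A : algType R[i]) (star : A -> A) (B : set A).
Hypothesis hB : subalgebra star B.

Lemma subalgD a b : B a -> B b -> B (a + b).
Proof. by case: hB => _ + _ _ _; apply. Qed.
Lemma subalgZ c a : B a -> B (c *: a).
Proof. by case: hB => _ _ + _ _; apply. Qed.
Lemma subalgM a b : B a -> B b -> B (a * b).
Proof. by case: hB => _ _ _ + _; apply. Qed.
Lemma subalg_star a : B a -> B (star a).
Proof. by case: hB => _ _ _ _; apply. Qed.
Lemma subalg1 : B 1.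
Proof. by case: hB. Qed.
Lemma subalg0 : B 0.
Proof. by rewrite -(scale0r 1); apply/subalgZ/subalg1. Qed.
Lemma subalgN a : B a -> B (- a).
Proof. by rewrite -scaleN1r; apply: subalgZ. Qed.
Lemma subalgB a b : B a -> B b -> B (a - b).
Proof. by move=> Ba Bb; apply/subalgD/subalgN. Qed.
Lemma subalgA c : B c%:A.
Proof. exact/subalgZ/subalg1. Qed.
Lemma subalgX a n : B a -> B (a ^+ n).
Proof.
by move=> Ba; elim: n => [|n IH]; [exact: subalg1|rewrite exprS; apply: subalgM].
Qed.
Lemma subalg_sum (I : Type) (s : seq I) (P : pred I) (f : I -> A) :
  (forall i, P i -> B (f i)) -> B (\sum_(i <- s | P i) f i).
Proof. by move=> h; elim/big_ind : _ => //; [exact: subalg0|exact: subalgD]. Qed.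
End SubalgebraTheory.

Section FreePair.
Variables (R : realType) (A : algType R[i]) (star : A -> A) (phi : {scalar A}).
Hypothesis tA : tracial star phi.
Variables (B : set A) (x : A).
Hypothesis hB : subalgebra star B.
Hypothesis hf : free_pair phi B (powers x).
Implicit Types (y z u v : A).

Let alt1 z : powers x z -> phi z = 0 -> alternating phi B (powers x) true z.
Proof. by move=> h1 h2; apply: alternating1. Qed.
Let alt2 y z : B y -> phi y = 0 -> powers x z -> phi z = 0 ->
  alternating phi B (powers x) true (y * z).
Proof. by move=> By y0 h1 h2; apply: alternatingS => //; apply: alternating1. Qed.
Let centerB y : B y -> B (y - (phi y)%:A).
Proof. by move=> By; apply: (subalgB hB) => //; apply: (subalgA hB). Qed.

(** Since [u] is centered, only the centered part of [y] can contribute, and the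
    product of two free centered elements has trace zero. *)
Lemma phi_mul_free0 y u : B y -> powers x u -> phi u = 0 -> phi (y * u) = 0.
Proof.
move=> By xu u0.
rewrite -[y](subrK (phi y)%:A) mulrDl phiD -scalerAl mul1r phiZ u0 mulr0 addr0.
by apply: (hf (alt2 (centerB By) _ xu u0)); rewrite (phi_center tA).
Qed.

Lemma phi_mul_free y u : B y -> powers x u -> phi (y * u) = phi y * phi u.
Proof.
move=> By xu; rewrite (center_splitr phi y u) phiD phiZ phi_mul_free0 ?add0r 1?mulrC //.
  by rewrite -scaleNr; apply: powersD => //; apply: powers_cst.
by rewrite (phi_center tA).
Qed.

Lemma phi_mul_free2 y z u v : B y -> B z -> powers x u -> powers x v ->
  phi u = 0 -> phi v = 0 -> phi (y * u * z * v) = phi y * phi z * phi (u * v).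
Proof.
move=> By Bz xu xv u0 v0.
have alt4 y' z' : B y' -> B z' -> phi y' = 0 -> phi z' = 0 -> phi (y' * u * z' * v) = 0.
  move=> B1 B2 y0 z0; have h := alt2 B1 y0 xu u0.
  exact: (hf (alternatingS (b:=true) (alternatingS (b:=false) h B2 z0) xv v0)).
have alt3 z' : B z' -> phi z' = 0 -> phi (u * z' * v) = 0.
  move=> B2 z0; have h := alt1 xu u0.
  exact: (hf (alternatingS (b:=true) (alternatingS (b:=false) h B2 z0) xv v0)).
have Bzc := centerB Bz; have Byc := centerB By.
rewrite (center_split phi (y * u) z v) phiD phiZ -(mulrA y u v) (phi_mul_free By); last first.
  exact: powersM.
set z' := z - _ in Bzc *.
have -> : y * u * z' * v = (y - (phi y)%:A) * u * z' * v + phi y *: (u * z' * v).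
  by rewrite -!mulrA (mulrBl _ y) -scalerAl mul1r subrK.
by rewrite phiD phiZ alt4 ?alt3 ?(phi_center tA) // mulr0 !add0r mulrCA mulrA.
Qed.

(** Multiplication by elements free from [u] acts on [u] as on an orthonormal
    vector; this controls [a u b] by trace norms, although the trace norm is
    not multiplicative. *)
Lemma nm_mul_free a b u : B a -> B b -> powers x u -> star u = u -> phi u = 0 ->
  nm star phi (a * u * b) = nm star phi a * nm star phi b * nm star phi u.
Proof.
move=> Ba Bb xu us u0; apply: (@pexpIrn _ 2); rewrite ?nnegrE ?mulr_ge0 ?nm_ge0 //.
apply: (@complexI R); rewrite -(nmE tA).
have -> : ((nm star phi a * nm star phi b * nm star phi u) ^+ 2)%:C%C =
    phi (star a * a) * phi (b * star b) * phi (u * u) :> R[i].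
  have hb : phi (b * star b) = (nm star phi b ^+ 2)%:C%C.
    by rewrite -(nm_star tA b) -(nmE tA) (starK tA).
  have hu : phi (u * u) = (nm star phi u ^+ 2)%:C%C by rewrite -(nmE tA) us.
  by rewrite hb hu (nmE tA) !exprMn !RCM.
rewrite !(starM tA) us.
have -> : star b * (u * star a) * (a * u * b) = star b * (u * (star a * a) * u * b).
  by rewrite !mulrA.
have Bs := subalg_star hB.
rewrite mulrA (trC tA) !mulrA -[b * star b * u * star a * a]mulrA phi_mul_free2 //.
- ring.
- by apply: (subalgM hB) => //; apply: Bs.
- by apply: (subalgM hB) => //; apply: Bs.
Qed.
End FreePair.

Section Partition.
Variable R : realType.
Implicit Types (a b : R) (N i : nat).

Definition ptn a b N i : R := a + i%:R / N%:R * (b - a).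

Lemma ptn0 a b N : ptn a b N 0 = a.
Proof. by rewrite /ptn !mul0r addr0. Qed.

Lemma ptnn a b N : (0 < N)%N -> ptn a b N N = b.
Proof.
by move=> N0; rewrite /ptn divff ?pnatr_eq0 -?lt0n // mul1r addrC subrK.
Qed.

Lemma ptnB a b N i j : ptn a b N (i + j) - ptn a b N i = j%:R / N%:R * (b - a).
Proof. by rewrite /ptn natrD; ring. Qed.

Lemma ptn_step a b N i : ptn a b N i.+1 - ptn a b N i = (b - a) / N%:R.
Proof. by rewrite -addn1 ptnB mulrC mul1r. Qed.

Lemma ptn_le a b N i j : a <= b -> (i <= j)%N -> ptn a b N i <= ptn a b N j.
Proof.
by move=> ab /subnKC <-; rewrite -subr_ge0 ptnB mulr_ge0 ?subr_ge0.
Qed.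

Lemma ptn_ge a b N i : a <= b -> a <= ptn a b N i.
Proof. by move=> ab; rewrite -{1}(ptn0 a b N) ptn_le. Qed.

Lemma ptn_leb a b N i : a <= b -> (i <= N)%N -> (0 < N)%N -> ptn a b N i <= b.
Proof. by move=> ab iN N0; rewrite -{2}(ptnn a b N0) ptn_le. Qed.

Lemma ptn_refine a b N M i q : (0 < N)%N -> (0 < M)%N ->
  ptn (ptn a b N i) (ptn a b N i.+1) M q = ptn a b (N * M) (i * M + q).
Proof.
move=> N0 M0; rewrite {1}/ptn ptn_step /ptn natrD !natrM.
by field; rewrite !pnatr_eq0 -!lt0n N0 M0.
Qed.

Lemma sum_refine (V : zmodType) N M (f : nat -> V) :
  \sum_(r < N * M) f r = \sum_(i < N) \sum_(q < M) f (i * M + q)%N.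
Proof.
rewrite -(big_mkord xpredT f) big_nat_mul big_mkord.
apply: eq_bigr => i _; rewrite mulSn addnC -{1}[(i * M)%N]add0n big_addn addKn big_mkord.
by apply: eq_bigr => q _; rewrite addnC.
Qed.

Lemma sqrt_invn_le1 N : Num.sqrt (N%:R^-1 : R) <= 1.
Proof.
rewrite -[X in _ <= X]sqrtr1; apply: ler_wsqrtr.
case: N => [|N]; first by rewrite invr0.
by rewrite invf_le1 // ler1n.
Qed.

Lemma invn_le_sqrt N : (N%:R^-1 : R) <= Num.sqrt N%:R^-1.
Proof.
rewrite -{1}[N%:R^-1](@sqr_sqrtr R) ?invr_ge0 // expr2.
by rewrite -[X in _ <= X]mul1r ler_wpM2r ?sqrtr_ge0 // sqrt_invn_le1.
Qed.
End Partition.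

(** For [l] listing [i_1, ..., i_k], the exponents to be replaced by traces; the
    last one belongs to the right factor. *)
Definition inner (l : seq nat) : seq nat := if l is j :: l' then belast j l' else [::].

Section Ito.
Variables (R : realType) (A : algType R[i]) (star : A -> A) (phi : {scalar A}).
Hypothesis tA : tracial star phi.
Variables (F : R -> set A) (X : R -> R -> A) (m : nat -> R -> R) (ka : nat -> R).
Hypothesis pX : free_process star phi F X m ka.
Local Notation C := R[i].
Local Notation nm := (nm star phi).
Implicit Types (p : nat * seq nat).

Definition wcoef p (s : R) : C := \prod_(e <- inner p.2) phi (X 0 s ^+ e).

(** The biprocess attached to [p] at time [s], applied to [d]. *)
Definition wact p (s : R) (d : A) : A :=
  wcoef p s *: (X 0 s ^+ p.1 * d * X 0 s ^+ last 0%N p.2).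

Lemma wact_def p s d :
  wact p s d = wcoef p s *: (X 0 s ^+ p.1 * d * X 0 s ^+ last 0%N p.2).
Proof. by []. Qed.

Lemma wcoef_def p s : wcoef p s = \prod_(e <- inner p.2) phi (X 0 s ^+ e).
Proof. by []. Qed.

Let hF t : 0 <= t -> subalgebra star (F t). Proof. exact: (fp_sub pX). Qed.

Lemma XF s t : 0 <= s -> s <= t -> F t (X 0 s).
Proof.
move=> s0 st; apply: (fp_incr pX s0 st); exact: (fp_mem pX (lexx _) s0).
Qed.

Lemma XabF a b t : 0 <= a -> a <= b -> b <= t -> F t (X a b).
Proof.
move=> a0 ab bt; apply: (fp_incr pX (le_trans a0 ab) bt); exact: (fp_mem pX).
Qed.

Lemma wactF p s t d : 0 <= s -> s <= t -> F t d -> F t (wact p s d).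
Proof.
move=> s0 st Fd; have h := hF (le_trans s0 st); apply: (subalgZ h).
by apply: (subalgM h); [apply: (subalgM h) => //|]; apply: (subalgX h); apply: XF.
Qed.

Lemma wactD p s d d' : wact p s (d + d') = wact p s d + wact p s d'.
Proof. by rewrite /wact mulrDr mulrDl scalerDr. Qed.
Lemma wactB p s d d' : wact p s (d - d') = wact p s d - wact p s d'.
Proof. by rewrite /wact mulrBr mulrBl scalerBr. Qed.
Lemma wact_sum p s (I : Type) (r : seq I) (P : pred I) (f : I -> A) :
  wact p s (\sum_(i <- r | P i) f i) = \sum_(i <- r | P i) wact p s (f i).
Proof.
apply: (big_morph _ (wactD p s)).
by rewrite /wact mulr0 mul0r scaler0.
Qed.

(** The partial sums belong to the past of the next term, so that a bound on the
    pairings with the past makes the terms nearly orthogonal. *)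
Lemma nm_sum_adapted (tau : nat -> R) (n : nat) (Z : nat -> A) (al be : R) :
  0 <= al -> 0 <= be -> (forall j, 0 <= tau j) ->
  (forall j, (j < n)%N -> tau j <= tau j.+1) ->
  (forall j, (j < n)%N -> F (tau j.+1) (Z j)) ->
  (forall j a, (j < n)%N -> F (tau j) a -> cabs (phi (a * Z j)) <= al * nm a) ->
  (forall j, (j < n)%N -> nm (Z j) ^+ 2 <= be) ->
  nm (\sum_(i < n) Z i) <= 2 * al * n%:R + Num.sqrt (n%:R * be).
Proof.
move=> al0 be0 t0 ti FZ h1 h2; apply: (nm_sum_increments tA) => // j jn.
have FS k : (k <= n)%N -> F (tau k) (\sum_(i < k) Z i).
  elim: k => [|k IH] kn; first by rewrite big_ord0; apply: (subalg0 (hF (t0 _))).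
  rewrite big_ord_recr; apply: (subalgD (hF (t0 _))); last exact: FZ.
  exact: (fp_incr pX (t0 _) (ti _ kn)) (IH (ltnW kn)).
rewrite -[X in _ <= _ * X](nm_star tA) h1 //.
by apply: (subalg_star (hF (t0 _))); apply: FS; apply: ltnW.
Qed.

Variable T : R.
Hypothesis T0 : 0 <= T.

Lemma wcoef_bounded (l : seq nat) : exists2 M, 0 <= M & forall s, 0 <= s -> s <= T ->
  cabs (\prod_(e <- l) phi (X 0 s ^+ e)) <= M.
Proof.
elim: l => [|e l [M M0 hM]].
  by exists 1 => // s _ _; rewrite big_nil ComplexField.Normc.normc1.
have [M' M'0 hM'] := X_moment_bounded tA pX T e.
exists (M' * M) => [|s s0 sT]; first exact: mulr_ge0.
by rewrite big_cons cabsM ler_pM ?cabs_ge0 ?hM ?hM'.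
Qed.

Lemma wcoef_hoelder (l : seq nat) : exists2 M, 0 <= M & forall s u,
  0 <= s -> s <= u -> u <= T ->
  cabs (\prod_(e <- l) phi (X 0 u ^+ e) - \prod_(e <- l) phi (X 0 s ^+ e))
    <= M * Num.sqrt (u - s).
Proof.
elim: l => [|e l [M M0 hM]].
  by exists 0 => // s u _ _ _; rewrite !big_nil subrr cabs0 mul0r.
have [M1 M10 hM1] := X_moment_bounded tA pX T e.
have [M2 M20 hM2] := X_hoelder tA pX T e.
have [M3 M30 hM3] := wcoef_bounded l.
exists (M1 * M + M2 * M3) => [|s u s0 su uT]; first by rewrite addr_ge0 ?mulr_ge0.
rewrite !big_cons; set a := phi _; set b := \prod_(_ <- _) _.
set c := phi _; set d := \prod_(_ <- _) _.
have -> : a * b - c * d = a * (b - d) + (a - c) * d by ring.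
have -> : (M1 * M + M2 * M3) * Num.sqrt (u - s) =
  M1 * (M * Num.sqrt (u - s)) + (M2 * Num.sqrt (u - s)) * M3 by ring.
have u0 := le_trans s0 su; have sT := le_trans su uT.
rewrite (le_trans (cabsD _ _)) // !cabsM lerD // ler_pM ?cabs_ge0 ?hM1 ?hM ?hM3 //.
by rewrite -phiB (le_trans (cabs_phi tA _)) ?hM2.
Qed.

Definition Xl p (s : R) : A := wcoef p s *: X 0 s ^+ p.1.

Lemma wactE p s d : wact p s d = Xl p s * d * X 0 s ^+ last 0%N p.2.
Proof. by rewrite /wact /Xl -!scalerAl. Qed.

Lemma scaled_power_bounded (l : seq nat) n : exists2 M, 0 <= M & forall s,
  0 <= s -> s <= T -> nm ((\prod_(e <- l) phi (X 0 s ^+ e)) *: X 0 s ^+ n) <= M.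
Proof.
have [M1 M10 hM1] := wcoef_bounded l.
have [M2 M20 hM2] := X_norm_bounded tA pX T n.
exists (M1 * M2) => [|s s0 sT]; first exact: mulr_ge0.
by rewrite (nmZ tA) ler_pM ?cabs_ge0 ?nm_ge0 ?hM1 ?hM2.
Qed.

Lemma scaled_power_hoelder (l : seq nat) n : exists2 M, 0 <= M & forall s u,
  0 <= s -> s <= u -> u <= T ->
  nm ((\prod_(e <- l) phi (X 0 u ^+ e)) *: X 0 u ^+ n -
      (\prod_(e <- l) phi (X 0 s ^+ e)) *: X 0 s ^+ n) <= M * Num.sqrt (u - s).
Proof.
have [M1 M10 hM1] := wcoef_bounded l.
have [M2 M20 hM2] := X_hoelder tA pX T n.
have [M3 M30 hM3] := wcoef_hoelder l.
have [M4 M40 hM4] := X_norm_bounded tA pX T n.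
exists (M1 * M2 + M3 * M4) => [|s u s0 su uT]; first by rewrite addr_ge0 ?mulr_ge0.
set a := \prod_(_ <- _) _; set b := X 0 u ^+ n.
set c := \prod_(_ <- _) _; set d := X 0 s ^+ n.
have -> : a *: b - c *: d = a *: (b - d) + (a - c) *: d.
  by rewrite scalerBr scalerBl addrA subrK.
have -> : (M1 * M2 + M3 * M4) * Num.sqrt (u - s) =
  M1 * (M2 * Num.sqrt (u - s)) + (M3 * Num.sqrt (u - s)) * M4 by ring.
have u0 := le_trans s0 su; have sT := le_trans su uT.
by rewrite (le_trans (nmD tA _ _)) // !(nmZ tA) lerD // ler_pM ?cabs_ge0 ?nm_ge0
  ?hM1 ?hM2 ?hM3 ?hM4.
Qed.

(** On a cell of length [1 / N] a word differs from its leading part by an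
    element of second order, whose sum over [N] cells has a drift of order
    [N * N ^ (-2)] and a fluctuation of order [sqrt (N * N ^ (-2))]. *)
Lemma words_to_leading i j (l : seq nat) :
  exists2 K, 0 <= K & forall a b N, 0 <= a -> a <= b -> b <= T -> (0 < N)%N ->
  let t := ptn a b N in
  nm (\sum_(r < N) (wordv (X 0 (t r)) (X (t r) (t r.+1)) (i, j :: l) -
        wact (i, j :: l) (t r) (X (t r) (t r.+1) ^+ (size l).+1)))
    <= K * Num.sqrt N%:R^-1.
Proof.
have [M M0 hM] := word_lead_order2 tA pX T i j l.
exists (2 * M * T ^+ 2 + M * T) => [|a b N a0 ab bT N0 /=].
  by rewrite addr_ge0 ?mulr_ge0 ?sqr_ge0.
set t := ptn a b N.
have N0' : (0 : R) < N%:R by rewrite ltr0n.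
have hst r : t r.+1 - t r = (b - a) / N%:R by exact: ptn_step.
have t0 r : 0 <= t r by exact: le_trans a0 (ptn_ge N r ab).
have tm r : t r <= t r.+1 by exact: ptn_le.
have tT r : (r < N)%N -> t r.+1 <= T by move=> rN; apply: le_trans bT; apply: ptn_leb.
set h := (b - a) / N%:R in hst *.
have h0 : 0 <= h by rewrite divr_ge0 ?subr_ge0 // ltW.
have hb : nm (\sum_(r < N) (wordv (X 0 (t r)) (X (t r) (t r.+1)) (i, j :: l) -
        wact (i, j :: l) (t r) (X (t r) (t r.+1) ^+ (size l).+1))) <=
    2 * (M * h ^+ 2) * N%:R + Num.sqrt (N%:R * (M * h) ^+ 2).
  apply: (@nm_sum_adapted t N (fun r => wordv (X 0 (t r)) (X (t r) (t r.+1)) (i, j :: l) -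
        wact (i, j :: l) (t r) (X (t r) (t r.+1) ^+ (size l).+1))) => //.
  - by rewrite mulr_ge0 ?sqr_ge0.
  - exact: sqr_ge0.
  - move=> r rN; have hFt := hF (t0 r.+1).
    have FX : F (t r.+1) (X 0 (t r)) by exact: XF.
    have Fd : F (t r.+1) (X (t r) (t r.+1)) by exact: XabF.
    apply: (subalgB hFt); last by apply: wactF => //; apply: (subalgX hFt).
    rewrite /wordv; apply: (subalgM hFt); first exact: (subalgX hFt).
    elim/big_ind : _ => [||e _]; [exact: (subalg1 hFt)|exact: (subalgM hFt)|].
    by apply: (subalgM hFt) => //; apply: (subalgX hFt).
  - move=> r z rN Fz; have [h1 _] := hM _ _ (t0 r) (tm r) (tT r rN).
    by have := h1 _ Fz; rewrite hst.
  - move=> r rN; have [_ h1] := hM _ _ (t0 r) (tm r) (tT r rN).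
    rewrite ler_pXn2r ?nnegrE ?nm_ge0 ?(mulr_ge0 M0 h0) //.
    by move: h1; rewrite hst.
apply: (le_trans hb).
have e1 : 2 * (M * h ^+ 2) * N%:R = 2 * M * (b - a) ^+ 2 * N%:R^-1.
  by rewrite /h; field; rewrite gt_eqF.
have e2 : Num.sqrt (N%:R * (M * h) ^+ 2) = M * (b - a) * Num.sqrt N%:R^-1.
  have -> : N%:R * (M * h) ^+ 2 = (M * (b - a)) ^+ 2 * N%:R^-1.
    by rewrite /h; field; rewrite gt_eqF.
  by rewrite sqrtrM ?sqr_ge0 // sqrtr_sqr ger0_norm // mulr_ge0 // subr_ge0.
rewrite e1 e2 [X in _ <= X]mulrDl.
have baT : b - a <= T by lra.
have ba0 : 0 <= b - a by lra.
have bT2 : (b - a) ^+ 2 <= T ^+ 2 by rewrite ler_pXn2r ?nnegrE.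
apply: lerD.
  apply: ler_pM; rewrite ?mulr_ge0 ?sqr_ge0 ?invr_ge0 //; last exact: invn_le_sqrt.
  by rewrite ler_wpM2l // mulr_ge0.
by rewrite ler_wpM2r ?sqrtr_ge0 // ler_wpM2l.
Qed.

End Ito.

(** * Riemann sums against the diagonal measures *)

(** The limits are in trace norm, which is weaker than the operator norm. *)
Record diagonal_measures (R : realType) (A : algType R[i]) (star : A -> A)
    (phi : {scalar A}) (F : R -> set A) (X : R -> R -> A)
    (D : nat -> R -> R -> A) : Prop := {
  dg_mem : forall k a b, (0 < k)%N -> 0 <= a -> a <= b -> F b (D k a b);
  dg_lim : forall k a b, (0 < k)%N -> 0 <= a -> a <= b -> forall e, 0 < e ->
    exists N0, forall N, (N0 <= N)%N -> (0 < N)%N ->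
      nm star phi (\sum_(i < N) X (ptn a b N i) (ptn a b N i.+1) ^+ k - D k a b) <= e }.

Lemma small_eq0 (R : realType) (x C : R) : 0 <= x -> 0 <= C ->
  (forall e, 0 < e -> e <= 1 -> x <= C * e) -> x = 0.
Proof.
move=> x0 C0 h; apply/eqP; rewrite eq_le x0 andbT leNgt; apply/negP => xp.
have e0 : 0 < Num.min 1 (x / (2 * (C + 1))).
  by rewrite lt_min ltr01 divr_gt0 // mulr_gt0 // ltr_wpDl.
have := h _ e0; rewrite ge_min lexx => /(_ isT) h1.
have : C * Num.min 1 (x / (2 * (C + 1))) <= C * (x / (2 * (C + 1))).
  by rewrite ler_wpM2l // ge_min lexx orbT.
move=> /(le_trans h1); rewrite leNgt => /negP; apply.
have -> : C * (x / (2 * (C + 1))) = x * (C / (2 * (C + 1))) by ring.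
rewrite -[X in _ < X]mulr1 ltr_pM2l // ltr_pdivrMr ?mul1r; lra.
Qed.

Lemma act_telescope (K : pzRingType) (A : lalgType K) (a a' b b' d w w' : A) (c : K) :
  a * d * b + c *: w - (a' * d * b' + c *: w') =
  (a - a') * d * b + a' * d * (b - b') + c *: (w - w').
Proof.
rewrite scalerBr !mulrBr !mulrBl opprD addrACA; congr (_ + _).
by rewrite addrA subrK.
Qed.

Section Diagonal.
Variables (R : realType) (A : algType R[i]) (star : A -> A) (phi : {scalar A}).
Hypothesis tA : tracial star phi.
Variables (F : R -> set A) (X : R -> R -> A) (m : nat -> R -> R) (ka : nat -> R).
Hypothesis pX : free_process star phi F X m ka.
Variable D : nat -> R -> R -> A.
Hypothesis pD : diagonal_measures star phi F X D.
Local Notation C := R[i].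
Local Notation nm := (nm star phi).
Local Notation wact := (wact phi X).
Implicit Types (p : nat * seq nat).

Let hF t : 0 <= t -> subalgebra star (F t). Proof. exact: (fp_sub pX). Qed.

Lemma X_pow a b k : powers (X a b) (X a b ^+ k).
Proof. by rewrite -[X in powers _ X]scale1r; apply: powersX. Qed.

Lemma phi_X_pow a b k : 0 <= a -> a <= b -> phi (X a b ^+ k) = (m k (b - a))%:C%C.
Proof. exact: (fp_moment pX). Qed.

Lemma nm_center_sqr z : star z = z ->
  nm (z - (phi z)%:A) ^+ 2 = complex.Re (phi (z * z)) - complex.Re (phi z) ^+ 2.
Proof.
move=> zs.
have pr : phi z = (complex.Re (phi z))%:C%C.
  have := phi_star tA z; rewrite zs => /(congr1 (@complex.Im R)); rewrite cImJ => e.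
  by apply: complex_ext => //=; lra.
rewrite (sqr_nm tA) (starB tA) (starZ tA) (star1 tA) zs {1 2}pr conj_RC.
rewrite mulrBl !mulrBr -!scalerAl -!scalerAr !mul1r !mulr1 scalerA.
rewrite !(phiB, phiZ) (tr1 tA) pr !(cReD, cReN, cReM) /=; ring.
Qed.

Definition cpow k a b := X a b ^+ k - (phi (X a b ^+ k))%:A.

Lemma cpow_powers k a b : powers (X a b) (cpow k a b).
Proof. by rewrite /cpow -scaleNr; apply: powersD; [exact: X_pow|exact: powers_cst]. Qed.

Lemma phi_cpow k a b : phi (cpow k a b) = 0.
Proof. exact: (phi_center tA). Qed.

Lemma star_cpow k a b : 0 <= a -> a <= b -> star (cpow k a b) = cpow k a b.
Proof.
move=> a0 ab; rewrite (starB tA) (starX tA) (fp_star pX) // (starZ tA) (star1 tA).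
by rewrite phi_X_pow // conj_RC /cpow phi_X_pow.
Qed.

Lemma cpowF k a b t : 0 <= a -> a <= b -> b <= t -> F t (cpow k a b).
Proof.
move=> a0 ab bt; have h := hF (le_trans a0 (le_trans ab bt)).
by apply: (subalgB h); [apply/(subalgX h)/(XabF pX)|exact: (subalgA h)].
Qed.

Lemma nm_cpow_sqr k a b : 0 <= a -> a <= b ->
  nm (cpow k a b) ^+ 2 = m (k + k) (b - a) - m k (b - a) ^+ 2.
Proof.
move=> a0 ab; rewrite nm_center_sqr ?(starX tA) ?(fp_star pX) // -exprD.
by rewrite !phi_X_pow.
Qed.

Lemma phi_wact p s t a b d : 0 <= s -> s <= t -> t <= b -> F t a ->
  powers (X t b) d -> phi (a * wact p s d) = phi d * phi (a * wact p s 1).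
Proof.
move=> s0 st tb Fa xd; have t0 := le_trans s0 st; have h := hF t0.
rewrite !wactE mulr1 !mulrA (trC tA) !mulrA (phi_mul_free tA h _ _ xd); last 2 first.
- exact: (fp_free pX t0 (lexx t) tb).
- apply: (subalgM h); first apply: (subalgM h) => //.
    exact/(subalgX h)/(XF pX).
  exact/(subalgZ h)/(subalgX h)/(XF pX).
by rewrite mulrC; congr (_ * _); rewrite [RHS](trC tA) !mulrA.
Qed.

Lemma wactZ p s (c : C) d : wact p s (c *: d) = c *: wact p s d.
Proof. by rewrite !wactE -scalerAr -scalerAl. Qed.

Section Horizon.
Variable T : R.
Hypothesis T0 : 0 <= T.

Lemma nm_cpow k : (0 < k)%N -> exists2 M, 0 <= M & forall a b,
  0 <= a -> a <= b -> b <= T -> nm (cpow k a b) <= M * Num.sqrt (b - a).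
Proof.
move=> k0; have kk0 : (0 < k + k)%N by rewrite addn_gt0 k0.
have [M M0 hM] := moment_small pX T kk0.
exists (Num.sqrt M); rewrite ?sqrtr_ge0 // => a b a0 ab bT.
rewrite -sqrtrM // -[X in X <= _](ger0_norm (nm_ge0 _ _ _)) -sqrtr_sqr.
apply: ler_wsqrtr; rewrite nm_cpow_sqr //.
have h := hM (b - a) _ _; have := le_trans (ler_norm _) (h _ _).
have := sqr_ge0 (m k (b - a)); lra.
Qed.

Lemma wact1_hoelder p : exists2 M, 0 <= M & forall s t, 0 <= s -> s <= t -> t <= T ->
  nm (wact p t 1 - wact p s 1) <= M * Num.sqrt (t - s).
Proof.
have [M M0 hM] := scaled_power_hoelder tA pX T (inner p.2) (p.1 + last 0%N p.2).
exists M => // s t s0 st tT; have := hM s t s0 st tT.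
by rewrite !wact_def !wcoef_def !mulr1 !exprD.
Qed.

(** Moving the integrand from [s] to [t] costs the square root of [t - s], by
    the continuity of [X 0 s ^+ n] in [s]; the centered part of the integrator
    is free from the integrand, and its norm factors out. *)
Lemma wact_shift p k : (0 < k)%N -> exists2 K, 0 <= K & forall s t u,
  0 <= s -> s <= t -> t <= u -> u <= T ->
  let z := wact p t (X t u ^+ k) - wact p s (X t u ^+ k) in
  (forall a, F t a -> cabs (phi (a * z)) <= K * ((u - t) * Num.sqrt (t - s)) * nm a) /\
  nm z <= K * (Num.sqrt (u - t) * Num.sqrt (t - s)).
Proof.
move=> k0.
have [M1 M10 hM1] := moment_small pX T k0.
have [M2 M20 hM2] := wact1_hoelder p.
have [M3 M30 hM3] := nm_cpow k0.
have [M4 M40 hM4] := scaled_power_hoelder tA pX T (inner p.2) p.1.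
have [M5 M50 hM5] := scaled_power_bounded tA pX T (inner p.2) p.1.
have [M6 M60 hM6] := X_norm_bounded tA pX T (last 0%N p.2).
have [M7 M70 hM7] := X_hoelder tA pX T (last 0%N p.2).
exists (M1 * M2 + (M4 * M6 * M3 + M5 * M7 * M3) + M1 * Num.sqrt T * M2).
  by rewrite !addr_ge0 ?mulr_ge0 ?sqrtr_ge0.
move=> s t u s0 st tu uT; have t0 := le_trans s0 st; have tT := le_trans tu uT.
have sT := le_trans st tT.
have h := hF t0; have h0 : 0 <= u - t by lra.
have huT : u - t <= T by lra.
have hc : cabs (phi (X t u ^+ k)) <= M1 * (u - t).
  by rewrite phi_X_pow // cabs_real hM1.
have hw := hM2 _ _ s0 st tT.
set S1 := Num.sqrt (u - t); set S2 := Num.sqrt (t - s).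
have S10 : 0 <= S1 by exact: sqrtr_ge0.
have S20 : 0 <= S2 by exact: sqrtr_ge0.
split=> [a Fa|].
  have w1 := phi_wact p t0 (lexx t) tu Fa (X_pow t u k).
  have w2 := phi_wact p s0 st tu Fa (X_pow t u k).
  rewrite mulrBr phiB w1 w2.
  rewrite -mulrBr -phiB -mulrBr cabsM.
  have e1 : cabs (phi (a * (wact p t 1 - wact p s 1))) <= nm a * (M2 * S2).
    by rewrite (le_trans (cabs_phi_mul tA _ _)) // ler_wpM2l ?nm_ge0.
  apply: (@le_trans _ _ (M1 * (u - t) * (nm a * (M2 * S2)))).
    by rewrite ler_pM ?cabs_ge0.
  have -> : M1 * (u - t) * (nm a * (M2 * S2)) = (M1 * M2) * ((u - t) * S2) * nm a by ring.
  rewrite ler_wpM2r ?nm_ge0 // ler_wpM2r ?mulr_ge0 //.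
  have q1 : 0 <= M4 * M6 * M3 + M5 * M7 * M3 by rewrite addr_ge0 ?mulr_ge0.
  have q2 : 0 <= M1 * Num.sqrt T * M2 by rewrite !mulr_ge0 ?sqrtr_ge0.
  lra.
set c := phi (X t u ^+ k); set d := cpow k t u.
have -> : X t u ^+ k = d + c *: 1 by rewrite /d /cpow subrK.
rewrite !(wactD phi X p _ d) !wactZ.
rewrite !(wactE phi X p _ d) act_telescope.
have fr := fp_free pX t0 (lexx t) tu.
have dp := cpow_powers k t u.
have ds := star_cpow k t0 tu.
have FXt j : F t (X 0 t ^+ j) by apply: (subalgX h); apply: (XF pX).
have FXs j : F t (X 0 s ^+ j) by apply: (subalgX h); apply: (XF pX).
have hd : nm d <= M3 * S1 by exact: hM3.
have n1 : nm ((Xl phi X p t - Xl phi X p s) * d * X 0 t ^+ last 0%N p.2) <=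
    (M4 * S2) * M6 * (M3 * S1).
  rewrite (nm_mul_free tA h fr _ (FXt _) dp ds (phi_cpow _ _ _)); last first.
    by apply: (subalgB h); apply: (subalgZ h).
  by rewrite !ler_pM ?mulr_ge0 ?nm_ge0 // ?hM6 //; exact: hM4.
have n2 : nm (Xl phi X p s * d * (X 0 t ^+ last 0%N p.2 - X 0 s ^+ last 0%N p.2)) <=
    M5 * (M7 * S2) * (M3 * S1).
  rewrite (nm_mul_free tA h fr _ _ dp ds (phi_cpow _ _ _)); last 2 first.
  - exact: (subalgZ h).
  - exact: (subalgB h).
  by rewrite !ler_pM ?mulr_ge0 ?nm_ge0 // ?hM7 //; exact: hM5.
have n3 : nm (c *: (wact p t 1 - wact p s 1)) <= (M1 * (S1 * Num.sqrt T)) * (M2 * S2).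
  rewrite (nmZ tA) ler_pM ?cabs_ge0 ?nm_ge0 //.
  apply: le_trans hc _; rewrite ler_wpM2l // -[X in X <= _](sqr_sqrtr h0) expr2.
  by rewrite ler_wpM2l // ler_wsqrtr.
apply: le_trans (nmD tA _ _) _; apply: (@le_trans _ _
  ((M4 * S2) * M6 * (M3 * S1) + M5 * (M7 * S2) * (M3 * S1) +
   (M1 * (S1 * Num.sqrt T)) * (M2 * S2))).
  by apply: lerD n3; apply: le_trans (nmD tA _ _) (lerD n1 n2).
have -> : (M4 * S2) * M6 * (M3 * S1) + M5 * (M7 * S2) * (M3 * S1) +
   (M1 * (S1 * Num.sqrt T)) * (M2 * S2) =
   ((M4 * M6 * M3 + M5 * M7 * M3) + M1 * Num.sqrt T * M2) * (S1 * S2) by ring.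
rewrite ler_wpM2r ?mulr_ge0 //.
have := mulr_ge0 M10 M20; lra.
Qed.

(** Freezing moves the integrand by at most one cell of the coarse partition; the
    resulting differences have a small drift and nearly orthogonal fluctuations,
    whatever the finer partition on which one integrates. *)
Lemma frozen_sum p k : (0 < k)%N -> exists2 K, 0 <= K & forall a b N M,
  0 <= a -> a <= b -> b <= T -> (0 < N)%N -> (0 < M)%N ->
  let t := ptn a b (N * M) in
  nm (\sum_(r < N * M) (wact p (t r) (X (t r) (t r.+1) ^+ k) -
         wact p (ptn a b N (r %/ M)) (X (t r) (t r.+1) ^+ k))) <=
    K * Num.sqrt N%:R^-1.
Proof.
move=> k0; have [K K0 hK] := wact_shift p k0.
exists (2 * K * T * Num.sqrt T + K * T) => [|a b N M a0 ab bT N0 M0 /=].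
  by rewrite addr_ge0 ?mulr_ge0 ?sqrtr_ge0.
set t := ptn a b (N * M).
have NM0 : (0 < N * M)%N by rewrite muln_gt0 N0.
have N0' : (0 : R) < N%:R by rewrite ltr0n.
have M0' : (0 : R) < M%:R by rewrite ltr0n.
have hst r : t r.+1 - t r = (b - a) / (N * M)%:R by exact: ptn_step.
have t0 r : 0 <= t r by exact: le_trans a0 (ptn_ge _ r ab).
have tm r : t r <= t r.+1 by exact: ptn_le.
have tT r : (r < N * M)%N -> t r.+1 <= T.
  by move=> rN; apply: le_trans bT; apply: ptn_leb.
set s := fun r => ptn a b N (r %/ M).
have s0 r : 0 <= s r by exact: le_trans a0 (ptn_ge _ _ ab).
have sE r : s r = t (r %/ M * M)%N.
  by rewrite /s /t /ptn !natrM; field; rewrite !gt_eqF.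
have st r : s r <= t r by rewrite sE ptn_le // leq_divM.
have sth r : t r - s r <= (b - a) / N%:R.
  rewrite sE {1}(divn_eq r M) ptnB.
  have -> : (b - a) / N%:R = M%:R / (N * M)%:R * (b - a).
    by rewrite natrM; field; rewrite !gt_eqF.
  rewrite ler_wpM2r ?subr_ge0 // ler_wpM2r ?invr_ge0 // ler_nat.
  by rewrite ltnW // ltn_mod.
have ba0 : 0 <= b - a by lra.
set h' := (b - a) / (N * M)%:R in hst.
set h := (b - a) / N%:R in sth.
have h'0 : 0 <= h' by rewrite divr_ge0.
have h0 : 0 <= h by rewrite divr_ge0 // ltW.
have sq r : Num.sqrt (t r - s r) <= Num.sqrt h by rewrite ler_wsqrtr.
have hb : nm (\sum_(r < N * M) (wact p (t r) (X (t r) (t r.+1) ^+ k) -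
         wact p (s r) (X (t r) (t r.+1) ^+ k))) <=
    2 * (K * (h' * Num.sqrt h)) * (N * M)%:R +
     Num.sqrt ((N * M)%:R * (K ^+ 2 * (h' * h))).
  apply: (@nm_sum_adapted _ _ _ _ tA _ _ _ _ pX t (N * M) (fun r =>
     wact p (t r) (X (t r) (t r.+1) ^+ k) - wact p (s r) (X (t r) (t r.+1) ^+ k))) => //.
  - by rewrite !mulr_ge0 ?sqrtr_ge0.
  - by rewrite !mulr_ge0 ?sqr_ge0.
  - move=> r rN; have hFt := hF (t0 r.+1).
    have Fd : F (t r.+1) (X (t r) (t r.+1) ^+ k).
      by apply: (subalgX hFt); apply: (XabF pX).
    by apply: (subalgB hFt); apply: (wactF pX) => //; apply: le_trans (tm r).
  - move=> r z rN Fz; have [h1 _] := hK _ _ _ (s0 r) (st r) (tm r) (tT r rN).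
    apply: le_trans (h1 _ Fz) _; rewrite ler_wpM2r ?nm_ge0 // ler_wpM2l // hst.
    by rewrite ler_wpM2l.
  - move=> r rN; have [_ h1] := hK _ _ _ (s0 r) (st r) (tm r) (tT r rN).
    apply: (@le_trans _ _ ((K * (Num.sqrt h' * Num.sqrt h)) ^+ 2)).
      rewrite ler_pXn2r ?nnegrE ?nm_ge0 ?mulr_ge0 ?sqrtr_ge0 //.
      by apply: le_trans h1 _; rewrite ler_wpM2l // hst ler_wpM2l ?sqrtr_ge0.
    by rewrite !exprMn !sqr_sqrtr.
apply: (le_trans hb).
have hh : Num.sqrt h = Num.sqrt (b - a) * Num.sqrt N%:R^-1 by rewrite -sqrtrM.
have e1 : 2 * (K * (h' * Num.sqrt h)) * (N * M)%:R =
    2 * K * (b - a) * Num.sqrt (b - a) * Num.sqrt N%:R^-1.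
  by rewrite hh /h' natrM; field; rewrite !gt_eqF.
have e2 : Num.sqrt ((N * M)%:R * (K ^+ 2 * (h' * h))) = K * (b - a) * Num.sqrt N%:R^-1.
  have -> : (N * M)%:R * (K ^+ 2 * (h' * h)) = (K * (b - a)) ^+ 2 * N%:R^-1.
    by rewrite /h' /h natrM; field; rewrite !gt_eqF.
  by rewrite sqrtrM ?sqr_ge0 // sqrtr_sqr ger0_norm // mulr_ge0.
rewrite e1 e2 [X in _ <= X]mulrDl.
have baT : b - a <= T by lra.
apply: lerD; rewrite ler_wpM2r ?sqrtr_ge0 //.
  by rewrite ler_pM ?mulr_ge0 ?sqrtr_ge0 // ?ler_wsqrtr // ler_wpM2l // mulr_ge0.
by rewrite ler_wpM2l.
Qed.

Lemma wact_cts p s : exists2 K, 0 <= K & forall d, nm (wact p s d) <= K * nm d.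
Proof.
have [K1 K10 h1] := nm_mull tA (Xl phi X p s).
have [K2 K20 h2] := nm_mulr tA (X 0 s ^+ last 0%N p.2).
exists (K2 * K1) => [|d]; first exact: mulr_ge0.
by rewrite wactE (le_trans (h2 _)) // -mulrA ler_wpM2l.
Qed.

Definition riemann p k a b N : A :=
  \sum_(i < N) wact p (ptn a b N i) (D k (ptn a b N i) (ptn a b N i.+1)).

Lemma words_to_riemann p : (0 < size p.2)%N -> exists2 K, 0 <= K & forall a b N,
  0 <= a -> a <= b -> b <= T -> (0 < N)%N -> forall e, 0 < e ->
  exists M0, forall M, (M0 <= M)%N -> (0 < M)%N ->
  let t := ptn a b (N * M) in
  nm (\sum_(r < N * M) wordv (X 0 (t r)) (X (t r) (t r.+1)) p -
      riemann p (size p.2) a b N) <= K * Num.sqrt N%:R^-1 + e.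
Proof.
case: p => i [//|j l] _; set p := (i, j :: l); set k := size p.2.
have k0 : (0 < k)%N by [].
have [K1 K10 h1] := words_to_leading tA pX T0 i j l.
have [K2 K20 h2] := frozen_sum p k0.
exists (K1 + K2) => [|a b N a0 ab bT N0 e e0]; first exact: addr_ge0.
have t0 r : 0 <= ptn a b N r by exact: le_trans a0 (ptn_ge _ r ab).
have tm r : ptn a b N r <= ptn a b N r.+1 by exact: ptn_le.
have hcell (r : 'I_N) : exists M0, forall M, (M0 <= M)%N -> (0 < M)%N ->
   nm (wact p (ptn a b N r) (\sum_(q < M) X (ptn a b (N * M) (r * M + q))
       (ptn a b (N * M) (r * M + q).+1) ^+ k - D k (ptn a b N r) (ptn a b N r.+1)))
     <= e / N%:R.
  have [K K0 hK] := wact_cts p (ptn a b N r).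
  have e'0 : 0 < e / N%:R / (K + 1).
    by rewrite !divr_gt0 ?ltr0n // ltr_wpDl.
  have [M0 hM0] := dg_lim pD k0 (t0 r) (tm r) e'0.
  exists M0 => M M0M Mp; have := hM0 M M0M Mp.
  under eq_bigr do rewrite !ptn_refine // addnS.
  move=> h3; apply: le_trans (hK _) (le_trans (ler_wpM2l K0 h3) _).
  rewrite mulrA ler_pdivrMr ?ltr_wpDl // [X in X <= _]mulrC ler_wpM2l ?lerDl //.
  by rewrite divr_ge0 // ltW.
pose M0 (r : 'I_N) := projT1 (cid (hcell r)).
(* Refine until every one of the [N] cells has its diagonal measure within
   [e / N]. *)
exists (\max_(r < N) M0 r)%N => M hM Mp /=.
have NM0 : (0 < N * M)%N by rewrite muln_gt0 N0.
have e1 := h1 a b (N * M)%N a0 ab bT NM0.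
have e2 := h2 a b N M a0 ab bT N0 Mp.
rewrite /= !sumrB in e1 e2.
set P := \sum_(r < _) wordv _ _ _ in e1 *.
set L := \sum_(r < _) wact p _ _ in e1 e2.
set L' := \sum_(r < _) wact p _ _ in e2.
have e3 : nm (L' - riemann p k a b N) <= e.
  rewrite /L' (sum_refine _ _ (fun r => wact p (ptn a b N (r %/ M)) (X (ptn a b (N * M) r)
       (ptn a b (N * M) r.+1) ^+ k))) /riemann -sumrB.
  apply: le_trans (nm_sum tA _ _ _) _.
  have -> : e = \sum_(r < N) (e / N%:R).
    rewrite sumr_const card_ord -[RHS]mulr_natr mulfVK // pnatr_eq0; lia.
  apply: ler_sum => r _.
  have := projT2 (cid (hcell r)) M _ Mp; rewrite wactB wact_sum; move=> h3.
  under eq_bigr => q _ do rewrite divnMDl // divn_small // addn0.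
  by apply: h3; apply: leq_trans hM; apply: (leq_bigmax r).
have e4 : Num.sqrt (N * M)%:R^-1 <= Num.sqrt N%:R^-1 :> R.
  apply: ler_wsqrtr; rewrite lef_pV2 ?posrE ?ltr0n // ler_nat leq_pmulr //.
have -> : P - riemann p k a b N = (P - L) + (L - L') + (L' - riemann p k a b N).
  by rewrite !addrA !subrK.
apply: le_trans (nmD tA _ _) _; apply: lerD e3; apply: le_trans (nmD tA _ _) _.
rewrite mulrDl; apply: lerD e2; apply: le_trans e1 _.
by rewrite ler_wpM2l.
Qed.

Lemma words_to_riemann_seq (ps : seq (nat * seq nat)) :
  (forall p, p \in ps -> (0 < size p.2)%N) -> exists2 K, 0 <= K & forall a b N,
  0 <= a -> a <= b -> b <= T -> (0 < N)%N -> forall e, 0 < e ->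
  exists M0, forall M, (M0 <= M)%N -> (0 < M)%N ->
  let t := ptn a b (N * M) in
  nm (\sum_(p <- ps) \sum_(r < N * M) wordv (X 0 (t r)) (X (t r) (t r.+1)) p -
      \sum_(p <- ps) riemann p (size p.2) a b N) <= K * Num.sqrt N%:R^-1 + e.
Proof.
elim: ps => [|p ps IH] hps.
  exists 0 => // a b N _ _ _ _ e e0; exists 0%N => M _ _ /=.
  by rewrite !big_nil subrr nm0 mul0r add0r ltW.
have [|K1 K10 h1] := IH; first by move=> q qps; apply: hps; rewrite inE qps orbT.
have [|K2 K20 h2] := @words_to_riemann p; first by apply: hps; rewrite mem_head.
exists (K1 + K2) => [|a b N a0 ab bT N0 e e0]; first exact: addr_ge0.
have e20 : 0 < e / 2 by rewrite divr_gt0.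
have [M1 hM1] := h1 a b N a0 ab bT N0 _ e20.
have [M2 hM2] := h2 a b N a0 ab bT N0 _ e20.
exists (maxn M1 M2) => M; rewrite geq_max => /andP[le1 le2] Mp /=.
have := hM1 M le1 Mp; have := hM2 M le2 Mp; rewrite /= !big_cons.
set P := \sum_(r < _) _; set Q := riemann _ _ _ _ _.
set P' := \sum_(q <- _) _; set Q' := \sum_(q <- _) _ => e1 e2.
have -> : P + P' - (Q + Q') = (P - Q) + (P' - Q') by rewrite opprD addrACA.
by apply: le_trans (nmD tA _ _) _; rewrite mulrDl; lra.
Qed.

(** Telescope over a partition refined within each of [N] cells and expand each
    increment into words.  The error bound is uniform in the refinement, and on
    each cell the powers of the fine increments add up to the diagonal measure
    in the limit. *)
Lemma ito_monomial n : exists2 K, 0 <= K & forall a b N,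
  0 <= a -> a <= b -> b <= T -> (0 < N)%N ->
  nm (X 0 b ^+ n - X 0 a ^+ n -
    \sum_(k < n) \sum_(p <- comps n k.+1) riemann p k.+1 a b N) <=
  K * Num.sqrt N%:R^-1.
Proof.
pose ps := flatten [seq comps n (k : 'I_n).+1 | k <- index_enum 'I_n].
have hps p : p \in ps -> (0 < size p.2)%N.
  by move=> /flatten_mapP[k _ /comps_size ->].
have [K K0 hK] := words_to_riemann_seq hps.
exists K => // a b N a0 ab bT N0.
have -> : \sum_(k < n) \sum_(p <- comps n k.+1) riemann p k.+1 a b N =
    \sum_(p <- ps) riemann p (size p.2) a b N.
  rewrite big_flatten big_map; apply: eq_bigr => k _.
  by rewrite big_seq [RHS]big_seq; apply: eq_bigr => p /comps_size ->.
apply/ler_addgt0Pr => e e0; have [M0 hM0] := hK a b N a0 ab bT N0 e e0.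
have := hM0 M0.+1 (leqnSn _) isT; rewrite /=.
set t := ptn a b (N * M0.+1).
have NM0 : (0 < N * M0.+1)%N by rewrite muln_gt0 N0.
have -> // : \sum_(p <- ps) \sum_(r < N * M0.+1) wordv (X 0 (t r)) (X (t r) (t r.+1)) p =
   X 0 b ^+ n - X 0 a ^+ n.
have -> : X 0 b ^+ n - X 0 a ^+ n = X 0 (t (N * M0.+1)%N) ^+ n - X 0 (t 0%N) ^+ n.
  by rewrite /t ptn0 ptnn.
rewrite exchange_big /= -(telescope_sumr (fun r => X 0 (t r) ^+ n)) ?leq0n // big_mkord.
apply: eq_bigr => r _.
have t0 : 0 <= t r by exact: le_trans a0 (ptn_ge _ r ab).
have tm : t r <= t r.+1 by exact: ptn_le.
rewrite -(fp_add pX (lexx 0) t0 tm) expr_words big_ord_recl comps0 big_seq1.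
rewrite {2}/wordv big_nil mulr1 addrC addKr.
by rewrite big_flatten big_map.
Qed.

End Horizon.
End Diagonal.

(** * The isometry of the stochastic integral *)

Section DiagonalMeasure.
Variables (R : realType) (A : algType R[i]) (star : A -> A) (phi : {scalar A}).
Hypothesis tA : tracial star phi.
Variables (F : R -> set A) (X : R -> R -> A) (m : nat -> R -> R) (ka : nat -> R).
Hypothesis pX : free_process star phi F X m ka.
Variable D : nat -> R -> R -> A.
Hypothesis pD : diagonal_measures star phi F X D.
Local Notation C := R[i].
Local Notation nm := (nm star phi).

Let hF t : 0 <= t -> subalgebra star (F t). Proof. exact: (fp_sub pX). Qed.
Local Notation cpow := (cpow phi X).

(** The two moments that survive when a sum of [N] powers of small increments is
    centered: its mean and its variance. *)
Lemma moment_scaling k h e : (0 < k)%N -> 0 <= h -> 0 < e ->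
  exists N0, forall N, (N0 <= N)%N -> (0 < N)%N ->
  `|N%:R * m k (h / N%:R) - ka k * h| <= e /\
  `|N%:R * (m (k + k) (h / N%:R) - m k (h / N%:R) ^+ 2) - ka (k + k) * h| <= e.
Proof.
move=> k0 h0 e0; have kk0 : (0 < k + k)%N by rewrite addn_gt0 k0.
have [M1 M10 hM1] := fp_small pX h k0.
have [M2 M20 hM2] := fp_small pX h kk0.
have [M3 M30 hM3] := moment_small pX h k0.
pose K := (M1 + M2 + M3 ^+ 2) * h ^+ 2.
have K0 : 0 <= K by rewrite mulr_ge0 ?sqr_ge0 // !addr_ge0 ?sqr_ge0.
have Ke0 : 0 <= K / e by rewrite divr_ge0 // ltW.
exists (Num.Def.archi_bound (K / e)) => N hN Np.
have N0 : (0 : R) < N%:R by rewrite ltr0n.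
have hKN : K / N%:R <= e.
  rewrite ler_pdivrMr // mulrC -ler_pdivrMr //.
  apply: le_trans (ltW (archi_boundP Ke0)) _; by rewrite ler_nat.
have hN0 : 0 <= h / N%:R by rewrite divr_ge0 // ltW.
have hNh : h / N%:R <= h by rewrite ler_pdivrMr // ler_peMr // ler1n.
have e1 := hM1 _ hN0 hNh; have e2 := hM2 _ hN0 hNh; have e3 := hM3 _ hN0 hNh.
have bd (M y c : R) : 0 <= M -> `|y - c * (h / N%:R)| <= M * (h / N%:R) ^+ 2 ->
    `|N%:R * y - c * h| <= M * h ^+ 2 / N%:R.
  move=> M0 hy.
  have -> : N%:R * y - c * h = N%:R * (y - c * (h / N%:R)) by field; rewrite gt_eqF.
  rewrite normrM (ger0_norm (ltW N0)).
  have -> : M * h ^+ 2 / N%:R = N%:R * (M * (h / N%:R) ^+ 2) by field; rewrite gt_eqF.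
  by rewrite ler_wpM2l // ltW.
have l1 : M1 * h ^+ 2 / N%:R <= K / N%:R.
  rewrite ler_wpM2r ?invr_ge0 ?(ltW N0) // ler_wpM2r ?sqr_ge0 //.
  by have := sqr_ge0 M3; lra.
have l2 : (M2 + M3 ^+ 2) * h ^+ 2 / N%:R <= K / N%:R.
  by rewrite ler_wpM2r ?invr_ge0 ?(ltW N0) // ler_wpM2r ?sqr_ge0 //; lra.
split; first exact: le_trans (bd _ _ _ M10 e1) (le_trans l1 hKN).
apply: le_trans (le_trans l2 hKN); apply: bd; first by rewrite addr_ge0 ?sqr_ge0.
have -> : m (k + k) (h / N%:R) - m k (h / N%:R) ^+ 2 - ka (k + k) * (h / N%:R) =
  (m (k + k) (h / N%:R) - ka (k + k) * (h / N%:R)) - m k (h / N%:R) ^+ 2 by ring.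
rewrite mulrDl; apply: le_trans (ler_normB _ _) _; apply: lerD => //.
rewrite ger0_norm ?sqr_ge0 // -exprMn -real_normK ?num_real //.
by rewrite ler_pXn2r ?nnegrE ?mulr_ge0.
Qed.

Definition Dsum k a b N := \sum_(i < N) X (ptn a b N i) (ptn a b N i.+1) ^+ k.
Definition Dcsum k a b N := \sum_(i < N) cpow k (ptn a b N i) (ptn a b N i.+1).
Definition Dc k a b := D k a b - (ka k * (b - a))%:C%C%:A.

Lemma phi_cell k a b N i : 0 <= a -> a <= b ->
  phi (X (ptn a b N i) (ptn a b N i.+1) ^+ k) = (m k ((b - a) / N%:R))%:C%C.
Proof.
move=> a0 ab; rewrite (phi_X_pow pX) ?ptn_step //; last exact: ptn_le.
exact: le_trans (ptn_ge _ _ ab).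
Qed.

Lemma Dcsum_approx k a b e : (0 < k)%N -> 0 <= a -> a <= b -> 0 < e ->
  exists2 N, (0 < N)%N & [/\ nm (Dcsum k a b N - Dc k a b) <= e,
    nm (Dsum k a b N - D k a b) <= e,
    `|N%:R * m k ((b - a) / N%:R) - ka k * (b - a)| <= e &
    `|N%:R * (m (k + k) ((b - a) / N%:R) - m k ((b - a) / N%:R) ^+ 2) -
      ka (k + k) * (b - a)| <= e].
Proof.
move=> k0 a0 ab e0; have ba0 : 0 <= b - a by rewrite subr_ge0.
have e20 : 0 < e / 2 by rewrite divr_gt0.
have [N1 hN1] := dg_lim pD k0 a0 ab e20.
have [N2 hN2] := moment_scaling k0 ba0 e20.
have le1 : (N1 <= (maxn N1 N2).+1)%N by rewrite leqW // leq_maxl.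
have le2 : (N2 <= (maxn N1 N2).+1)%N by rewrite leqW // leq_maxr.
set N := (maxn N1 N2).+1 in le1 le2; exists N => //.
have h1 := hN1 N le1 isT; have [h2 h3] := hN2 N le2 isT.
have ee : e / 2 <= e by lra.
split; [|exact: le_trans h1 ee|exact: le_trans h2 ee|exact: le_trans h3 ee].
have -> : Dcsum k a b N - Dc k a b = (Dsum k a b N - D k a b) -
    (N%:R * m k ((b - a) / N%:R) - ka k * (b - a))%:C%C%:A.
  rewrite /Dcsum /Dc /cpow; under eq_bigr do rewrite phi_cell //.
  rewrite sumrB sumr_const card_ord RCD RCN scalerBl !opprB.
  rewrite -scaler_nat scalerA mulr_natl.
  have -> : (m k ((b - a) / N%:R))%:C%C *+ N = (N%:R * m k ((b - a) / N%:R))%:C%C :> C.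
    by rewrite mulr_natl raddfMn.
  by rewrite /Dsum [_%:A - D k a b]addrC addrACA; congr (_ + _); apply: addrC.
apply: le_trans (nmB tA _ _) _; rewrite (nmZ tA) (nm1 tA) mulr1 cabs_real.
by move: h1 h2; rewrite -/(Dsum k a b N); lra.
Qed.

Lemma cabs_small_eq (x y : C) (K : R) : 0 <= K ->
  (forall e, 0 < e -> e <= 1 -> cabs (x - y) <= K * e) -> x = y.
Proof.
move=> K0 h; apply/eqP; rewrite -subr_eq0; apply/eqP.
exact: ComplexField.Normc.eq0_normc (small_eq0 (cabs_ge0 _) K0 h).
Qed.

Lemma nm_small_eq (x y : A) (K : R) : 0 <= K ->
  (forall e, 0 < e -> e <= 1 -> nm (x - y) <= K * e) -> x = y.
Proof.
move=> K0 h; apply/eqP; rewrite -subr_eq0; apply/eqP.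
exact: (nm_eq0 tA) (small_eq0 (nm_ge0 _ _ _) K0 h).
Qed.

Lemma star_D k a b : (0 < k)%N -> 0 <= a -> a <= b -> star (D k a b) = D k a b.
Proof.
move=> k0 a0 ab; apply: (@nm_small_eq _ _ 2) => // e e0 e1.
have [N N0 [_ h _ _]] := Dcsum_approx k0 a0 ab e0.
have Ss : star (Dsum k a b N) = Dsum k a b N.
  rewrite (star_sum tA); apply: eq_bigr => i _; rewrite (starX tA) (fp_star pX) //.
    exact: le_trans (ptn_ge _ _ ab).
  exact: ptn_le.
have -> : star (D k a b) - D k a b = - (star (Dsum k a b N - D k a b) -
     (Dsum k a b N - D k a b)).
  have E (u v w : A) : u - v = - ((w - u) - (w - v)).
    by rewrite [RHS]opprB opprB [RHS]addrC addrA subrK.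
  by rewrite (starB tA) Ss; apply: E.
rewrite (nmN tA); apply: le_trans (nmB tA _ _) _; rewrite (nm_star tA); lra.
Qed.

Lemma star_Dc k a b : (0 < k)%N -> 0 <= a -> a <= b -> star (Dc k a b) = Dc k a b.
Proof.
by move=> k0 a0 ab; rewrite /Dc (starB tA) star_D // (starZ tA) (star1 tA) conj_RC.
Qed.

Lemma DcF k a b t : (0 < k)%N -> 0 <= a -> a <= b -> b <= t -> F t (Dc k a b).
Proof.
move=> k0 a0 ab bt; have b0 := le_trans a0 ab; have h := hF (le_trans b0 bt).
apply: (subalgB h); last exact: (subalgA h).
exact: (fp_incr pX b0 bt) (dg_mem pD k0 a0 ab).
Qed.

Lemma ptnF a b N i : 0 <= a -> a <= b -> F a `<=` F (ptn a b N i).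
Proof. by move=> a0 ab; apply: (fp_incr pX a0); apply: ptn_ge. Qed.

Section Cells.
Variables (a b : R) (k N : nat).
Hypotheses (a0 : 0 <= a) (ab : a <= b).
Let t0 i : 0 <= ptn a b N i. Proof. exact: le_trans (ptn_ge _ _ ab). Qed.
Let tm i : ptn a b N i <= ptn a b N i.+1. Proof. exact: ptn_le. Qed.
Let fr s i (st : s <= ptn a b N i) (s0 : 0 <= s) := fp_free pX s0 st (tm i).
Local Notation c i := (cpow k (ptn a b N i) (ptn a b N i.+1)).

Lemma phi_mul_Dcsum y : F a y -> phi (y * Dcsum k a b N) = 0.
Proof.
move=> Fy; rewrite mulr_sumr phi_sum big1 // => i _.
apply: (phi_mul_free0 tA (hF (t0 i)) (fr (lexx _) (t0 i)) (ptnF _ _ a0 ab Fy)).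
  exact: cpow_powers.
exact: (phi_cpow tA).
Qed.

Lemma phi_cells_lt y z (i j : nat) : (i < j)%N -> F a y -> F a z ->
  phi (y * c i * z * c j) = 0.
Proof.
move=> ij Fy Fz; have h := hF (t0 j).
apply: (phi_mul_free0 tA h (fr (lexx _) (t0 j)) _ (cpow_powers _ _ _ _ _)); last first.
  exact: (phi_cpow tA).
apply: (subalgM h); last exact: ptnF Fz.
apply: (subalgM h); first exact: ptnF Fy.
apply: (cpowF pX) => //; exact: ptn_le.
Qed.

Lemma phi_mul_Dcsum2 y z : F a y -> F a z ->
  phi (y * Dcsum k a b N * z * Dcsum k a b N) = phi y * phi z *
    (N%:R * (m (k + k) ((b - a) / N%:R) - m k ((b - a) / N%:R) ^+ 2))%:C%C.
Proof.
move=> Fy Fz; rewrite [X in y * X]/Dcsum (mulr_sumr _ _ _ y) !mulr_suml phi_sum.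
have E (i : 'I_N) : phi (y * c i * z * Dcsum k a b N) =
    phi y * phi z * (m (k + k) ((b - a) / N%:R) - m k ((b - a) / N%:R) ^+ 2)%:C%C.
  rewrite /Dcsum mulr_sumr phi_sum (bigD1 i) //= big1 ?addr0 => [|j ji].
    have cp := cpow_powers phi X k (ptn a b N i) (ptn a b N i.+1).
    have c0 := phi_cpow tA X k (ptn a b N i) (ptn a b N i.+1).
    rewrite (phi_mul_free2 tA (hF a0) (fr (ptn_ge N i ab) a0) Fy Fz cp cp c0 c0).
    congr (_ * _); rewrite -(ptn_step _ _ _ i) -(nm_cpow_sqr tA pX) // -(nmE tA).
    by rewrite (star_cpow tA pX).
  have [lt|lt|/val_inj e] := ltngtP i j; last by rewrite e eqxx in ji.
    exact: phi_cells_lt.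
  by rewrite -[y * c i * z * c j]mulrA (trC tA) !mulrA; apply: phi_cells_lt.
by rewrite (eq_bigr _ (fun i _ => E i)) sumr_const card_ord -mulrnAr -raddfMn mulr_natl.
Qed.
End Cells.

Lemma phi_mul_Dc k a b y : (0 < k)%N -> 0 <= a -> a <= b -> F a y ->
  phi (y * Dc k a b) = 0.
Proof.
move=> k0 a0 ab Fy; apply: (@cabs_small_eq _ _ (nm y)); first exact: nm_ge0.
move=> e e0 e1; have [N N0 [h _ _ _]] := Dcsum_approx k0 a0 ab e0.
rewrite -(phi_mul_Dcsum k N a0 ab Fy) -phiB -mulrBr.
apply: le_trans (cabs_phi_mul tA _ _) _; rewrite ler_wpM2l ?nm_ge0 //.
by rewrite (nmBC tA).
Qed.

Lemma phi_mul_Dc2 k a b y z : (0 < k)%N -> 0 <= a -> a <= b -> F a y -> F a z ->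
  phi (y * Dc k a b * z * Dc k a b) = phi y * phi z * (ka (k + k) * (b - a))%:C%C.
Proof.
move=> k0 a0 ab Fy Fz; set d := Dc k a b.
have [M1 M10 hM1] := nm_mull tA y; have [M2 M20 hM2] := nm_mulr tA z.
pose K := nm (z * d * y) + (nm (y * d * z) + M2 * M1) + cabs (phi y * phi z).
have K0 : 0 <= K by rewrite !addr_ge0 ?nm_ge0 ?mulr_ge0 ?cabs_ge0.
apply: (cabs_small_eq K0) => e e0 e1.
have [N N0 [h _ _ h3]] := Dcsum_approx k0 a0 ab e0.
have := phi_mul_Dcsum2 k N a0 ab Fy Fz; set s := Dcsum k a b N in h *.
set v := N%:R * _ in h3 *; set v' := ka (k + k) * (b - a) in h3 *.
move=> E.
have -> : phi (y * d * z * d) - phi y * phi z * v'%:C%C =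
   phi (z * d * y * (d - s)) + phi (y * s * z * (d - s)) +
    phi y * phi z * (v - v')%:C%C.
  have -> : phi (z * d * y * (d - s)) = phi (y * d * z * d) - phi (y * s * z * d).
    have sw u : phi (z * d * y * u) = phi (y * u * z * d).
      by rewrite -[z * d * y * u]mulrA (trC tA) !mulrA.
    by rewrite mulrBr phiB !sw.
  by rewrite (mulrBr (y * s * z) d s) phiB E RCD RCN; ring.
apply: le_trans (cabsD _ _) _; rewrite cabsM cabs_real [X in _ <= X]mulrDl.
apply: lerD; last by rewrite ler_wpM2l ?cabs_ge0.
apply: le_trans (cabsD _ _) _; rewrite [X in _ <= X]mulrDl.
have hds : nm (d - s) <= e by rewrite (nmBC tA).
apply: lerD.
  by apply: le_trans (cabs_phi_mul tA _ _) _; rewrite ler_wpM2l ?nm_ge0.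
apply: le_trans (cabs_phi_mul tA _ _) _; apply: ler_pM; rewrite ?nm_ge0 //.
have -> : y * s * z = y * d * z + y * (s - d) * z.
  by rewrite (mulrBr y s d) mulrBl [RHS]addrC subrK.
apply: le_trans (nmD tA _ _) _; rewrite lerD2l.
apply: le_trans (hM2 _) _; rewrite ler_wpM2l // (le_trans (hM1 _)) //.
by rewrite -[X in _ <= X]mulr1 ler_wpM2l // (le_trans h).
Qed.

(** Cells of a uniform partition are themselves uniformly partitioned by its
    refinements, so that the diagonal measure adds up over them. *)
Lemma D_ptn_sum k a b N : (0 < k)%N -> 0 <= a -> a <= b -> (0 < N)%N ->
  \sum_(i < N) D k (ptn a b N i) (ptn a b N i.+1) = D k a b.
Proof.
move=> k0 a0 ab N0; apply: (@nm_small_eq _ _ (N%:R + 1)); first by rewrite addr_ge0.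
move=> e e0 e1.
have t0 i : 0 <= ptn a b N i by exact: le_trans (ptn_ge _ _ ab).
have tm i : ptn a b N i <= ptn a b N i.+1 by exact: ptn_le.
have [M1 hM1] := dg_lim pD k0 a0 ab e0.
pose M2 (i : 'I_N) := projT1 (cid (dg_lim pD k0 (t0 i) (tm i) e0)).
pose M := maxn M1 (\max_i M2 i)%N.+1.
have Mp : (0 < M)%N by rewrite leq_max orbT.
have h1 := hM1 (N * M)%N (leq_trans (leq_maxl _ _) (leq_pmull _ N0)).
have {}h1 : nm (Dsum k a b (N * M) - D k a b) <= e by apply: h1; rewrite muln_gt0 N0.
have hi (i : 'I_N) : nm (D k (ptn a b N i) (ptn a b N i.+1) -
   \sum_(q < M) X (ptn a b (N * M) (i * M + q)) (ptn a b (N * M) (i * M + q).+1) ^+ k) <= e.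
  have := projT2 (cid (dg_lim pD k0 (t0 i) (tm i) e0)) M _ Mp.
  rewrite (nmBC tA); under eq_bigr do rewrite !ptn_refine // addnS.
  apply; apply: leq_trans (leq_maxr _ _); apply: leqW; exact: (leq_bigmax i).
have -> : \sum_(i < N) D k (ptn a b N i) (ptn a b N i.+1) - D k a b =
   \sum_(i < N) (D k (ptn a b N i) (ptn a b N i.+1) -
   \sum_(q < M) X (ptn a b (N * M) (i * M + q)) (ptn a b (N * M) (i * M + q).+1) ^+ k) +
   (Dsum k a b (N * M) - D k a b).
  rewrite sumrB /Dsum (sum_refine N M (fun r => X (ptn a b (N * M) r) (ptn a b (N * M) r.+1) ^+ k)).
  by rewrite addrA subrK.
apply: le_trans (nmD tA _ _) _; rewrite mulrDl mul1r lerD //.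
apply: le_trans (nm_sum tA _ _ _) _.
by apply: le_trans (ler_sum _ (fun i _ => hi i)) _; rewrite sumr_const card_ord mulr_natl.
Qed.

(** The length of the intersection of [[a, b[] and [[c, d[]. *)
Definition overlap (a b c d : R) : R := Num.max 0 (Num.min b d - Num.max a c).

(** Additivity of the diagonal measures is proved below from the integration
    theory itself, so that this theory has to take it as a hypothesis. *)
Definition additiveD k := forall a b, 0 <= a -> a <= b -> D k 0 b - D k 0 a = D k a b.

Section Isometry.
Variable k : nat.
Hypothesis k0 : (0 < k)%N.
Hypothesis hadd : additiveD k.

Lemma Dc_add a b c : 0 <= a -> a <= b -> b <= c -> Dc k a c = Dc k a b + Dc k b c.
Proof.
move=> a0 ab bc; have b0 := le_trans a0 ab; have ac := le_trans ab bc.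
rewrite /Dc -(hadd a0 ac) -(hadd a0 ab) -(hadd b0 bc) addrACA -opprD -scalerDl -RCD -mulrDr.
congr (_ - _); first by rewrite [RHS]addrC addrA subrK.
by congr (((_ * _)%:C%C)%:A); rewrite [RHS]addrC addrA subrK.
Qed.

Lemma phi_past_Dc a b y s t : 0 <= a -> a <= b -> F a y -> F a s -> F a t ->
  phi (y * (s * Dc k a b * t)) = 0.
Proof.
move=> a0 ab Fy Fs Ft; have h := hF a0.
rewrite !mulrA (trC tA) !mulrA phi_mul_Dc //.
by apply: (subalgM h) => //; apply: (subalgM h).
Qed.

Lemma term_F a b c s t : 0 <= a -> a <= b -> b <= c -> F a s -> F a t ->
  F c (s * Dc k a b * t).
Proof.
move=> a0 ab bc Fs Ft; have ac := le_trans ab bc.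
have h := hF (le_trans a0 ac); have i := fp_incr pX a0 ac.
apply: (subalgM h); last exact: i.
by apply: (subalgM h); [exact: i|exact: DcF].
Qed.

Lemma pair_same_start a b c s t s' t' : 0 <= a -> a <= b -> a <= c ->
  F a s -> F a t -> F a s' -> F a t' ->
  phi (star (s * Dc k a b * t) * (s' * Dc k a c * t')) =
  (ka (k + k) * (Num.min b c - a))%:C%C * (phi (star s * s') * phi (t' * star t)).
Proof.
wlog bc : b c s t s' t' / b <= c.
  move=> H a0 ab ac Fs Ft Fs' Ft'; have [bc|/ltW cb] := leP b c.
    by have := H b c s t s' t' bc a0 ab ac Fs Ft Fs' Ft'; rewrite (min_idPl bc).
  have := H c b s' t' s t cb a0 ac ab Fs' Ft' Fs Ft; rewrite (min_idPl cb) => E.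
  rewrite -[LHS]conjCK -(phi_star tA) (starM tA) (starK tA) E.
  rewrite !conjM conj_RC -!(phi_star tA) !(starM tA) !(starK tA).
  by rewrite (trC tA t').
move=> a0 ab ac Fs Ft Fs' Ft'; rewrite (min_idPl bc).
have h := hF a0; have b0 := le_trans a0 ab.
rewrite (Dc_add a0 ab bc) [s' * _]mulrDr mulrDl [_ * (_ + _)]mulrDr phiD.
have i := fp_incr pX a0 ab.
rewrite [X in _ + X]phi_past_Dc //; last 3 first.
- by apply: (subalg_star (hF b0)); apply: term_F.
- exact: i.
- exact: i.
rewrite addr0 !(starM tA) star_Dc //.
have -> : star t * (Dc k a b * star s) * (s' * Dc k a b * t') =
   star t * Dc k a b * (star s * s') * Dc k a b * t' by rewrite !mulrA.
rewrite (trC tA _ t') !(mulrA t').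
rewrite phi_mul_Dc2 //; first ring.
- by apply: (subalgM h) => //; apply: (subalg_star h).
- by apply: (subalgM h) => //; apply: (subalg_star h).
Qed.

(** Split the interval that starts first at the beginning of the other one: the
    earlier part belongs to its past and does not contribute, and two intervals
    with the same beginning share their first piece. *)
Lemma pair_formula a b c d s t s' t' : 0 <= a -> a <= b -> 0 <= c -> c <= d ->
  F a s -> F a t -> F c s' -> F c t' ->
  phi (star (s * Dc k a b * t) * (s' * Dc k c d * t')) =
  (ka (k + k) * overlap a b c d)%:C%C * (phi (star s * s') * phi (t' * star t)).
Proof.
wlog ac : a b c d s t s' t' / a <= c.
  move=> H a0 ab c0 cd Fs Ft Fs' Ft'; have [ac|/ltW ca] := leP a c; first exact: H.
  have := H c d a b s' t' s t ca c0 cd a0 ab Fs' Ft' Fs Ft => E.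
  rewrite -[LHS]conjCK -(phi_star tA) (starM tA) (starK tA) E.
  rewrite !conjM conj_RC -!(phi_star tA) !(starM tA) !(starK tA).
  by rewrite (trC tA t') /overlap (minC d) (maxC c).
move=> a0 ab c0 cd Fs Ft Fs' Ft'; rewrite /overlap (max_idPr ac).
have i := fp_incr pX a0 ac.
have [bc|/ltW cb] := leP b c.
  rewrite phi_past_Dc //; last by apply: (subalg_star (hF c0)); apply: term_F.
  have -> : Num.max 0 (Num.min b d - c) = 0.
    by apply/max_idPl; rewrite subr_le0 ge_min bc.
  by rewrite mulr0 mul0r.
have -> : Num.max 0 (Num.min b d - c) = Num.min b d - c.
  by apply/max_idPr; rewrite subr_ge0 le_min cb.
rewrite (Dc_add a0 ac cb) mulrDr mulrDl (starD tA) mulrDl phiD.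
rewrite phi_past_Dc ?add0r //; last first.
  by apply: (subalg_star (hF c0)); apply: term_F.
by apply: pair_same_start => //; exact: i.
Qed.

Section Family.
Variables (I : finType) (lo hi : I -> R) (s t : I -> A).
Hypothesis hlo : forall i, 0 <= lo i.
Hypothesis hhi : forall i, lo i <= hi i.
Hypothesis hs : forall i, F (lo i) (s i).
Hypothesis ht : forall i, F (lo i) (t i).

Definition integral_family := \sum_i s i * (D k 0 (hi i) - D k 0 (lo i)) * t i.

Definition energy := \sum_i \sum_j overlap (lo i) (hi i) (lo j) (hi j) *
  complex.Re (phi (star (s i) * s j) * phi (t j * star (t i))).

Definition drift := \sum_i (hi i - lo i)%:C%C *: (s i * t i).

(** The centered diagonal measure contributes the energy, by the covariance
    formula, and its mean contributes the drift. *)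
Lemma integral_bound :
  nm integral_family <= Num.sqrt (ka (k + k) * energy) + `|ka k| * nm drift.
Proof.
have -> : integral_family = \sum_i s i * Dc k (lo i) (hi i) * t i + (ka k)%:C%C *: drift.
  rewrite scaler_sumr -big_split /=; apply: eq_bigr => i _; rewrite hadd // /Dc.
  rewrite mulrBr mulrBl -scalerAr mulr1 -scalerAl scalerA -RCM subrK //.
apply: le_trans (nmD tA _ _) _; rewrite (nmZ tA) cabs_real lerD2r.
rewrite -[X in X <= _](ger0_norm (nm_ge0 _ _ _)) -sqrtr_sqr; apply: ler_wsqrtr.
rewrite (sqr_nm tA) (star_sum tA) mulr_suml phi_sum cRe_sum /energy mulr_sumr.
apply: ler_sum => i _; rewrite [X in phi X]mulr_sumr phi_sum cRe_sum mulr_sumr.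
apply: ler_sum => j _; rewrite pair_formula // cReM /= mul0r subr0.
by rewrite mulrA.
Qed.
End Family.
End Isometry.

(** The square of the norm of a formal tensor.  It is also that of
    the trace norm of an element of the algebra, obtained by inserting a free
    centered element of variance 1, such as an increment of length 1 of the process in the future;
    its positivity and the triangle inequality follow. *)
Definition tensor_normsq (u : seq (C * (A * A))) : R :=
  complex.Re (\sum_(v <- u) \sum_(w <- u) v.1 * (w.1)^* *
    (phi (star w.2.1 * v.2.1) * phi (v.2.2 * star w.2.2))).

Definition insert (y : A) (u : seq (C * (A * A))) : A :=
  \sum_(v <- u) v.1 *: (v.2.1 * y * v.2.2).

Lemma insert_cat y u w : insert y (u ++ w) = insert y u + insert y w.
Proof. exact: big_cat. Qed.

Lemma insert_scale y c u :
  insert y [seq (c * v.1, v.2) | v <- u] = c *: insert y u.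
Proof.
by rewrite /insert big_map scaler_sumr; apply: eq_bigr => v _; rewrite scalerA.
Qed.

Lemma tensor_normsqE t (u : seq (C * (A * A))) : 0 <= t ->
  (forall v, v \in u -> F t v.2.1 /\ F t v.2.2) ->
  tensor_normsq u = nm (insert (cpow 1 t (t + 1)) u) ^+ 2.
Proof.
move=> t0 hu; set y := cpow 1 t (t + 1).
have t1 : t <= t + 1 by lra.
have h := hF t0; have fr := fp_free pX t0 (lexx t) t1.
have ys : star y = y by exact: (star_cpow tA pX).
have yy : phi (y * y) = 1.
  rewrite -{1}ys (nmE tA) (nm_cpow_sqr tA pX) // addrAC subrr add0r.
  by rewrite (fp_variance pX).
rewrite (sqr_nm tA) (star_sum tA) mulr_suml phi_sum /tensor_normsq exchange_big /=.
congr complex.Re; rewrite big_seq [RHS]big_seq; apply: eq_bigr => w wu.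
rewrite mulr_sumr phi_sum big_seq [RHS]big_seq; apply: eq_bigr => v vu.
have [w1 w2] := hu _ wu; have [v1 v2] := hu _ vu.
have E (c c' : C) x z : star (c *: x) * (c' *: z) = (c' * c^*) *: (star x * z).
  by rewrite (starZ tA) -scalerAl -scalerAr scalerA mulrC.
rewrite E phiZ; congr (_ * _).
rewrite !(starM tA) ys.
have -> : star w.2.2 * (y * star w.2.1) * (v.2.1 * y * v.2.2) =
   star w.2.2 * y * (star w.2.1 * v.2.1) * y * v.2.2 by rewrite !mulrA.
rewrite (trC tA _ v.2.2) !(mulrA v.2.2).
rewrite (phi_mul_free2 tA h fr); [by rewrite yy mulr1 mulrC | | |exact: cpow_powers
  |exact: cpow_powers|exact: (phi_cpow tA)|exact: (phi_cpow tA)].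
- by apply: (subalgM h) => //; apply: (subalg_star h).
- by apply: (subalgM h) => //; apply: (subalg_star h).
Qed.
End DiagonalMeasure.

(** * Bounded operators and von Neumann algebras *)

Lemma complex_pos (R : realType) (e : R[i]) : 0 < e ->
  exists2 r : R, 0 < r & e = r%:C%C.
Proof.
move=> e0; have [E h] := ge0_Re (ltW e0); exists (complex.Re e) => //.
by move: e0; rewrite {1}E ltcR.
Qed.

Lemma small_vector (R : realType) (V : normedModType R[i]) (x : V) (K : R[i]) : 0 <= K ->
  (forall e : R[i], 0 < e -> `|x| <= K * e) -> x = 0.
Proof.
move=> K0 h; apply/eqP; rewrite -normr_eq0; apply/eqP/le_anti.
rewrite normr_ge0 andbT; apply/ler_addgt0Pr => e e0; rewrite add0r.
have K10 : 0 < K + 1 by rewrite ltr_wpDl.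
apply: le_trans (h (e / (K + 1)) _) _; first by rewrite divr_gt0.
by rewrite mulrCA ger_pMr // ler_pdivrMr // mul1r lerDl.
Qed.

Section Limits.
Variables (R : realType) (V : completeNormedModType R[i]).
Implicit Types (w : nat -> V) (l : V).

Lemma cvg_complexP w l : w @ \oo --> l <->
  forall e : R, 0 < e -> exists N, forall n, (N <= n)%N -> `|w n - l| <= e%:C%C.
Proof.
split=> [/cvgrPdist_le h e e0|h].
  have e0' : (0 : R[i]) < e%:C%C by rewrite ltcR.
  by have [N _ hN] := h _ e0'; exists N => n nN; rewrite distrC; apply: hN.
apply/cvgrPdist_le => e /complex_pos[r r0 ->].
by have [N hN] := h r r0; exists N => // n nN; rewrite distrC; apply: hN.
Qed.

Lemma cauchy_limit w :
  (forall e : R, 0 < e -> exists N, forall n m, (N <= n)%N -> (N <= m)%N ->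
     `|w n - w m| <= e%:C%C) -> exists l, w @ \oo --> l.
Proof.
move=> h; exists (lim (w @ \oo)); apply/cauchy_cvgP/cauchy_exP => e /complex_pos[r r0 ->].
have r20 : 0 < r / 2 by rewrite divr_gt0.
have [N hN] := h _ r20; exists (w N); exists N => // n /= nN.
rewrite -ball_normE /=; apply: le_lt_trans (hN N n (leqnn N) nN) _.
by rewrite ltcR; lra.
Qed.
End Limits.

Section Operators.
Variables (R : realType) (H : completeNormedModType R[i]).
Variable dot : {dot H for @Num.conj R[i]}.
Hypothesis hH : hilbert_norm dot.
Local Notation C := R[i].
Implicit Types (S T U : H -> H).

Lemma dot_sub (x y z : H) : dot (x - y) z = dot x z - dot y z.
Proof. exact: linearBl. Qed.
Lemma dotC (x y : H) : dot x y = (dot y x)^*.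
Proof. by rewrite hermC expr0 mul1r. Qed.
Lemma dotDl (x y z : H) : dot (x + y) z = dot x z + dot y z.
Proof. exact: linearDl. Qed.
Lemma dotZl c (x z : H) : dot (c *: x) z = c * dot x z.
Proof. exact: linearZl_LR. Qed.
Lemma dotDr (x y z : H) : dot z (x + y) = dot z x + dot z y.
Proof. exact: linearDr. Qed.
Lemma dotBr (x y z : H) : dot z (x - y) = dot z x - dot z y.
Proof. exact: linearBr. Qed.
Lemma dotZr c (x z : H) : dot z (c *: x) = c^* * dot z x.
Proof. exact: linearZr_LR. Qed.

Lemma dot_eq (x y : H) : (forall z, dot z x = dot z y) -> x = y.
Proof.
move=> e; apply/eqP; rewrite -subr_eq0 -normr_eq0 -sqrf_eq0 hH.
by rewrite dotBr e subrr.
Qed.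

Lemma is_adj_uniq S T T' : is_adj dot S T -> is_adj dot S T' -> T = T'.
Proof.
move=> h1 h2; apply/funext => y; apply: dot_eq => z.
by rewrite -h1 h2.
Qed.

Lemma adjP S T : is_adj dot S T -> adj dot S = T.
Proof.
move=> h; apply: is_adj_uniq (h).
by rewrite /adj; case: xgetP => [U -> //|/(_ T)]; rewrite /=.
Qed.

Lemma is_adj_sym S T : is_adj dot S T -> is_adj dot T S.
Proof. by move=> h x y; rewrite dotC -h -dotC. Qed.

Lemma lin_add S : linear S -> forall x y, S (x + y) = S x + S y.
Proof. by move=> h x y; have := h 1 x y; rewrite !scale1r. Qed.
Lemma lin0 S : linear S -> S 0 = 0.
Proof. by move=> h; apply: (@addrI _ (S 0)); rewrite -lin_add // !addr0. Qed.
Lemma lin_scale S : linear S -> forall c x, S (c *: x) = c *: S x.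
Proof. by move=> h c x; have := h c x 0; rewrite !addr0 lin0 // addr0. Qed.
Lemma lin_sub S : linear S -> forall x y, S (x - y) = S x - S y.
Proof. by move=> h x y; rewrite lin_add // -scaleN1r lin_scale // scaleN1r. Qed.

Lemma bounded_pos S : bounded_op S ->
  exists2 M : R, 0 < M & forall x, `|S x| <= M%:C%C * `|x|.
Proof.
move=> [_ [M hM]]; exists (cabs M + 1); first by rewrite ltr_wpDl ?cabs_ge0.
move=> x; apply: le_trans (hM x) _.
have x0 : 0 <= `|x| by [].
apply: (@le_trans _ _ (`|M| * `|x|)).
  have Mx : 0 <= M * `|x| by exact: le_trans (hM x).
  by rewrite -(ger0_norm Mx) normrM normr_id.
by rewrite ler_wpM2r // cabsE RC_le lerDl.
Qed.

Lemma bounded_add S T : bounded_op S -> bounded_op T -> bounded_op (S + T).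
Proof.
move=> bS bT; split.
  by move=> c x y; rewrite /= !fctE bS.1 bT.1 scalerDr addrACA.
have [M M0 hM] := bounded_pos bS; have [N N0 hN] := bounded_pos bT.
exists (M%:C%C + N%:C%C) => x; rewrite fctE (le_trans (ler_normD _ _)) //.
by rewrite mulrDl lerD.
Qed.

Lemma bounded_scale c S : bounded_op S -> bounded_op (c *: S).
Proof.
move=> bS; split.
  by move=> d x y; rewrite !fctE bS.1 scalerDr !scalerA mulrC.
have [M M0 hM] := bounded_pos bS.
exists (`|c| * M%:C%C) => x; rewrite fctE normrZ -mulrA.
by rewrite ler_wpM2l.
Qed.

Lemma bounded_comp S T : bounded_op S -> bounded_op T -> bounded_op (S \o T).
Proof.
move=> bS bT; split; first by move=> c x y /=; rewrite bT.1 bS.1.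
have [M M0 hM] := bounded_pos bS; have [N N0 hN] := bounded_pos bT.
exists (M%:C%C * N%:C%C) => x /=; apply: le_trans (hM _) _.
by rewrite -mulrA ler_wpM2l // ler0c ltW.
Qed.

Lemma bounded_id : bounded_op (id : H -> H).
Proof. by split=> //; exists 1 => x; rewrite mul1r. Qed.

Lemma bounded_zero : bounded_op (0 : H -> H).
Proof.
split; first by move=> c x y; rewrite /= scaler0 addr0.
by exists 0 => x; rewrite normr0 mul0r.
Qed.

Definition op_cvg (u : nat -> H -> H) S := forall e : C, 0 < e ->
  exists N0, forall N, (N0 <= N)%N -> forall x, `|u N x - S x| <= e * `|x|.

Lemma opnorm_cvgP (u : nat -> H -> H) S : opnorm_cvg u S -> op_cvg u S.
Proof.
by move=> h e e0; have [N0 _ hN] := h e e0; exists N0 => N NN; apply: hN.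
Qed.

Lemma op_cvg_linear (u : nat -> H -> H) S : op_cvg u S ->
  (forall n, linear (u n)) -> linear S.
Proof.
move=> h lu c x y; apply/eqP; rewrite -subr_eq0; apply/eqP.
apply: (@small_vector _ _ _ (`|c *: x + y| + (`|c| * `|x| + `|y|))).
  by rewrite !addr_ge0 // mulr_ge0.
move=> e e0; have [N hN] := h e e0.
have -> : S (c *: x + y) - (c *: S x + S y) =
  - (u N (c *: x + y) - S (c *: x + y)) + (c *: (u N x - S x) + (u N y - S y)).
    by rewrite lu opprB scalerBr [X in _ = _ + X]addrACA -opprD addrA subrK.
apply: le_trans (ler_normD _ _) _; rewrite normrN mulrDl.
apply: lerD; first by rewrite mulrC; apply: hN.
apply: le_trans (ler_normD _ _) _; rewrite mulrDl normrZ -mulrA ![_ * e]mulrC.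
by apply: lerD; [apply: ler_wpM2l => //|]; apply: hN.
Qed.

Lemma op_cvg_bounded (u : nat -> H -> H) S : op_cvg u S ->
  (forall n, bounded_op (u n)) -> bounded_op S.
Proof.
move=> h bu; split; first by apply: op_cvg_linear h _ => n; have [] := bu n.
have [N hN] := h 1 ltr01; have [M M0 hM] := bounded_pos (bu N).
exists (M%:C%C + 1) => x; rewrite -[S x](subKr (u N x)).
apply: le_trans (ler_normB _ _) _; rewrite mulrDl lerD //.
exact: hN.
Qed.

Lemma dot_cauchy_schwarz (x y : H) : `|dot x y| <= `|x| * `|y|.
Proof.
have [->|y0] := eqVneq y 0.
  by rewrite -(scale0r 0) dotZr rmorph0 mul0r scale0r !normr0 mulr0.
have b0 : `|y| ^+ 2 != 0 by rewrite expf_eq0 /= normr_eq0.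
rewrite -(@ler_pXn2r _ 2) ?nnegrE ?mulr_ge0 // exprMn.
set z := dot x y; set mu := z / `|y| ^+ 2.
have : 0 <= dot (x - mu *: y) (x - mu *: y) by rewrite -hH exprn_ge0.
rewrite dot_sub !dotBr !dotZl !dotZr -!hH -/z (dotC y x) -/z.
have -> : mu^* = z^* / `|y| ^+ 2.
  rewrite /mu; have [r ->] : exists r : R, `|y| ^+ 2 = r%:C%C.
    by exists (complex.Re (`|y| ^+ 2)); apply: (ge0_Re (exprn_ge0 2 (normr_ge0 y))).1.
  by rewrite -(fmorphV (real_complex R)) conjM conj_RC.
have -> : `|x| ^+ 2 - z^* / `|y| ^+ 2 * z - (mu * z^* - mu * (z^* / `|y| ^+ 2 * `|y| ^+ 2)) =
    `|x| ^+ 2 - z^* * z / `|y| ^+ 2 by rewrite /mu; set b := `|y| ^+ 2 in b0 *; field.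
rewrite subr_ge0 ler_pdivrMr; last by rewrite lt_def b0 exprn_ge0.
by rewrite cabs_conjM RCX -cabsE.
Qed.

Lemma op_cvg_adj (u : nat -> H -> H) S : op_cvg u S ->
  (forall n, is_adj dot (u n) (u n)) -> is_adj dot S S.
Proof.
move=> h au x y; apply/eqP; rewrite -subr_eq0 -normr_eq0; apply/eqP.
suff -> : dot (S x) y - dot x (S y) = 0 by rewrite normr0.
apply: (@small_vector _ R[i]^o _ (`|x| * `|y| + `|x| * `|y|)).
  by rewrite addr_ge0 ?mulr_ge0.
move=> e e0; have [N hN] := h e e0; have {}hN := hN N (leqnn N).
have -> : dot (S x) y - dot x (S y) = - dot (u N x - S x) y + dot x (u N y - S y).
  by rewrite dot_sub dotBr au opprB addrA subrK.
apply: le_trans (ler_normD _ _) _; rewrite normrN mulrDl; apply: lerD.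
  by apply: le_trans (dot_cauchy_schwarz _ _) _; rewrite mulrAC ler_wpM2r // mulrC hN.
by apply: le_trans (dot_cauchy_schwarz _ _) _; rewrite -mulrA ler_wpM2l // mulrC hN.
Qed.

Section VonNeumann.
Variable A : set (H -> H).
Hypothesis hA : von_neumann_algebra dot A.

Lemma vn_bounded S : A S -> bounded_op S.
Proof. by case: hA => h _ _; apply: h. Qed.

(** Being equal to its bicommutant, the algebra is described by commutation
    relations, which pass to sums, products and limits. *)
Lemma vnP S : A S <-> bounded_op S /\
  forall T, commutant A T -> forall x, T (S x) = S (T x).
Proof.
case: hA => _ _ e; split.
  rewrite -{1}e => -[bS hS]; split=> // T /hS h x.
  by have := congr1 (fun f => f x) h.
move=> [bS hS]; rewrite -e; split=> // T /hS h.
by apply/funext => x; rewrite /= h.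
Qed.

Lemma vn_add S T : A S -> A T -> A (S + T).
Proof.
move=> /vnP[bS hS] /vnP[bT hT]; apply/vnP; split; first exact: bounded_add.
by move=> U cU x; rewrite !fctE (lin_add cU.1.1) hS // hT.
Qed.

Lemma vn_scale c S : A S -> A (c *: S).
Proof.
move=> /vnP[bS hS]; apply/vnP; split; first exact: bounded_scale.
by move=> U cU x; rewrite !fctE (lin_scale cU.1.1) hS.
Qed.

Lemma vn_comp S T : A S -> A T -> A (S \o T).
Proof.
move=> /vnP[bS hS] /vnP[bT hT]; apply/vnP; split; first exact: bounded_comp.
by move=> U cU x; rewrite /= hS // hT.
Qed.

Lemma vn_id : A id.
Proof. by apply/vnP; split=> //; exact: bounded_id. Qed.

Lemma vn_zero : A 0.
Proof.
apply/vnP; split; first exact: bounded_zero.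
by move=> U cU x; rewrite /= (lin0 cU.1.1).
Qed.

Lemma vn_opp S : A S -> A (- S).
Proof. by rewrite -scaleN1r; apply: vn_scale. Qed.

Lemma vn_adj S : A S -> is_adj dot S (adj dot S) /\ A (adj dot S).
Proof.
by case: hA => _ h _ /h[T AT aT]; rewrite (adjP aT).
Qed.

Lemma vn_limit (u : nat -> H -> H) S : op_cvg u S -> (forall n, A (u n)) -> A S.
Proof.
move=> h Au; have bu n : bounded_op (u n) by exact: vn_bounded.
have bS := op_cvg_bounded h bu.
apply/vnP; split=> // T cT x; apply/eqP; rewrite -subr_eq0; apply/eqP.
have [M M0 hM] := bounded_pos cT.1.
apply: (@small_vector _ _ _ (M%:C%C * `|x| + M%:C%C * `|x|)).
  by rewrite addr_ge0 ?mulr_ge0 // ler0c ltW.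
move=> e e0; have [N hN] := h e e0; have {}hN := hN N (leqnn N).
have -> : T (S x) - S (T x) = - T (u N x - S x) + (u N (T x) - S (T x)).
  rewrite (lin_sub cT.1.1); have /vnP[_ hu] := Au N.
  by rewrite hu // opprB addrA subrK.
apply: le_trans (ler_normD _ _) _; rewrite normrN mulrDl; apply: lerD.
  apply: le_trans (hM _) _; rewrite -mulrA ler_wpM2l ?ler0c ?(ltW M0) // mulrC.
  exact: hN.
by apply: le_trans (hN _) _; rewrite mulrC ler_wpM2r ?(ltW e0).
Qed.

(** Square roots: when [x] is self-adjoint of norm at most 1/2, the iteration
    [y := (x + y^2) / 2] stays in the ball of radius 1/2, where it is a
    contraction; its limit satisfies [(1 - y)^2 = 1 - x]. *)
Fixpoint sqrt_iter (x : H -> H) (n : nat) : H -> H :=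
  if n is n'.+1 then 2^-1 *: (x + (sqrt_iter x n' \o sqrt_iter x n')) else 0.

Lemma sqrt_one_minus x : A x -> is_adj dot x x ->
  (forall v, `|x v| <= 2^-1 * `|v|) ->
  exists y, [/\ A y, is_adj dot y y & forall v, y (y v) = v - x v].
Proof.
move=> Ax ax hx; pose y := sqrt_iter x.
have Ay n : A (y n).
  elim: n => [|n IH]; first exact: vn_zero.
  by apply: vn_scale; apply: vn_add => //; apply: vn_comp.
have ly n : linear (y n) := (vn_bounded (Ay n)).1.
have yS n v : y n.+1 v = 2^-1 *: (x v + y n (y n v)) by rewrite /y /= !fctE.
have h20 : (0 : C) <= 2^-1 by rewrite invr_ge0.
have ay n : is_adj dot (y n) (y n).
  elim: n => [|n IH] v w; first by rewrite /y /= -(scale0r 0) dotZl dotZr rmorph0 !mul0r.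
  rewrite !yS dotZl dotZr dotDl dotDr !IH ax.
  by rewrite fmorphV /= rmorph_nat.
have by2 n v : `|y n v| <= 2^-1 * `|v|.
  elim: n v => [|n IH] v; first by rewrite normr0 mulr_ge0.
  rewrite yS normrZ ger0_norm // ler_wpM2l //.
  apply: le_trans (ler_normD _ _) _.
  have h1 : `|y n (y n v)| <= 2^-1 * `|v|.
    apply: le_trans (IH _) _; rewrite ler_wpM2l //.
    by apply: le_trans (IH _) _; rewrite ler_piMl // invf_le1 // ler1n.
  apply: le_trans (lerD (hx v) h1) _.
  by rewrite -mulrDl -[2^-1]mul1r -splitr mul1r.
have dy n v : `|y n.+1 v - y n v| <= 2^-1 ^+ n.+1 * `|v|.
  elim: n v => [|n IH] v.
    have y0 w : y 0%N w = 0 by [].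
    rewrite yS !y0 subr0 addr0 normrZ ger0_norm // expr1 ler_wpM2l //.
    by apply: le_trans (hx v) _; rewrite ler_piMl // invf_le1 // ler1n.
  rewrite [y n.+2 v]yS [X in _ - X]yS -scalerBr opprD addrACA subrr add0r.
  rewrite normrZ ger0_norm // exprS -mulrA ler_wpM2l //.
  have -> : y n.+1 (y n.+1 v) - y n (y n v) =
      y n.+1 (y n.+1 v - y n v) + (y n.+1 (y n v) - y n (y n v)).
    by rewrite (lin_sub (ly _)) addrA subrK.
  apply: le_trans (ler_normD _ _) _.
  apply: (@le_trans _ _ (2^-1 * (2^-1 ^+ n.+1 * `|v|) + 2^-1 ^+ n.+1 * (2^-1 * `|v|))).
    apply: lerD; first by apply: le_trans (by2 _ _) _; rewrite ler_wpM2l.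
    by apply: le_trans (IH _) _; rewrite ler_wpM2l ?exprn_ge0.
  by rewrite [X in _ + X]mulrCA -mulrDl -[2^-1]mul1r -splitr mul1r.
have cy n m v : (n <= m)%N -> `|y m v - y n v| <= (2^-1 ^+ n - 2^-1 ^+ m) * `|v|.
  move=> /subnKC <-; elim: (m - n)%N => [|d IH]; first by rewrite addn0 !subrr normr0 mul0r.
  rewrite addnS -[X in `|X - _|](subrK (y (n + d)%N v)) -addrA.
  apply: le_trans (ler_normD _ _) _; apply: le_trans (lerD (dy _ _) IH) _.
  rewrite -mulrDl ler_wpM2r // exprS.
  have -> : (2^-1 : C) ^+ (n + d) = 2^-1 * 2^-1 ^+ (n + d) + 2^-1 * 2^-1 ^+ (n + d).
    by set q := _ ^+ (n + d); field.
  by rewrite le_eqVlt; apply/orP; left; apply/eqP; set q := _ ^+ (n + d); set q' := _ ^+ n; field.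
have small (e : R) : 0 < e -> exists n, 2^-1 ^+ n <= e%:C%C :> C.
  move=> e0; pose n := Num.Def.archi_bound e^-1.
  have hn : e^-1 <= n%:R by apply/ltW/archi_boundP; rewrite invr_ge0 ltW.
  clearbody n; exists n.
  have -> : (2^-1 : C) = (2^-1)%:C%C by rewrite fmorphV rmorph_nat.
  rewrite -rmorphXn RC_le exprVn -[e]invrK lef_pV2 ?posrE ?invr_gt0 ?exprn_gt0 //.
  by apply: le_trans hn _; rewrite -natrX ler_nat ltnW // ltn_expl.
have lim v : exists l : H, (fun n => y n v) @ \oo --> l.
  apply: cauchy_limit => e e0.
  have e'0 : 0 < e / (complex.Re `|v| + 1).
    by rewrite divr_gt0 // ltr_wpDl //; exact: (ge0_Re (normr_ge0 v)).2.
  have [N hN] := small _ e'0; exists N.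
  have key n m : (N <= n)%N -> (n <= m)%N -> `|y m v - y n v| <= e%:C%C.
    move=> Nn nm; apply: le_trans (cy _ _ _ nm) _.
    apply: (@le_trans _ _ (2^-1 ^+ N * `|v|)).
      rewrite ler_wpM2r // lerBlDr; apply: ler_wpDr; first exact: exprn_ge0.
      by rewrite ler_wiXn2l // invf_le1 // ler1n.
    apply: le_trans (ler_wpM2r (normr_ge0 v) hN) _.
    rewrite [`|v|](ge0_Re (normr_ge0 v)).1 -RCM RC_le /=.
    have v0 := (ge0_Re (normr_ge0 v)).2.
    by rewrite mulrAC ler_pdivrMr ?ltr_wpDl // ler_wpM2l ?(ltW e0) // lerDl.
  move=> n m Nn Nm; have [nm|/ltnW mn] := leqP n m; last exact: key.
  by rewrite distrC; apply: key.
pose l v := projT1 (cid (lim v)).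
have hl v : (fun n => y n v) @ \oo --> l v := projT2 (cid (lim v)).
have yl n v : `|y n v - l v| <= 2^-1 ^+ n * `|v|.
  apply/ler_addgt0Pr => e /complex_pos[r r0 ->].
  have /cvg_complexP/(_ r r0)[N hN] := hl v.
  have := hN (maxn n N) (leq_maxr _ _); have := cy n (maxn n N) v (leq_maxl _ _).
  move=> h1 h2; rewrite -[y n v](subrK (y (maxn n N) v)) -addrA.
  apply: le_trans (ler_normD _ _) _; apply: lerD => //; rewrite distrC.
  apply: le_trans h1 _; rewrite ler_wpM2r // lerBlDr lerDl exprn_ge0 //.
have yc : op_cvg y l.
  move=> e /complex_pos[r r0 ->]; have [N hN] := small r r0; exists N => n Nn v.
  apply: le_trans (yl n v) _; rewrite ler_wpM2r //; apply: le_trans hN.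
  by rewrite ler_wiXn2l // invf_le1 // ler1n.
have Al := vn_limit yc Ay; have ll := (vn_bounded Al).1.
have al := op_cvg_adj yc ay.
have el v : l v = 2^-1 *: (x v + l (l v)).
  apply/eqP; rewrite -subr_eq0; apply/eqP.
  apply: (@small_vector _ _ _ (`|v| + (2^-1 * `|v| + `|l v|))) => [|e e0].
    by rewrite !addr_ge0 // mulr_ge0.
  have [N hN] := yc e e0; have h1 := hN N (leqnn N); have h2 := hN N.+1 (leqnSn N).
  have -> : l v - 2^-1 *: (x v + l (l v)) = - (y N.+1 v - l v) +
      2^-1 *: (y N (y N v - l v) + (y N (l v) - l (l v))).
    rewrite yS (lin_sub (ly _)) addrA subrK opprB -addrA; congr (_ + _).
    rewrite [RHS]addrC -scalerBr -scalerN; congr (_ *: _).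
    have E (a b c : H) : - (a + b) = c - b - (a + c).
      by rewrite [a + c]addrC [in RHS]opprD addrACA subrr add0r opprD addrC.
    exact: E.
  apply: le_trans (ler_normD _ _) _; rewrite normrN mulrDl; apply: lerD.
    by rewrite mulrC; apply: h2.
  rewrite normrZ ger0_norm // mulrDl; apply: (@le_trans _ _ (1 * (2^-1 * (e * `|v|) + e * `|l v|))).
    apply: ler_pM => //; first by rewrite invf_le1 // ler1n.
    apply: le_trans (ler_normD _ _) _; apply: lerD; last exact: h1.
    by apply: le_trans (by2 _ _) _; rewrite ler_wpM2l.
  by rewrite mul1r le_eqVlt; apply/orP; left; apply/eqP; ring.
have sc : is_adj dot (id - l) (id - l).
  by move=> v w; rewrite !fctE dot_sub dotBr al.
exists (id - l); split=> //; first by apply: vn_add; [exact: vn_id|exact: vn_opp].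
move=> v; rewrite !fctE (lin_sub ll) opprB.
have h3 : x v = l v + l v - l (l v).
  have := congr1 (fun z => 2 *: z) (el v); rewrite scalerA divff ?pnatr_eq0 // scale1r.
  by rewrite scaler_nat mulr2n => ->; rewrite addrK.
by rewrite h3 opprB opprD -[in LHS]addrA; congr (v + _); rewrite addrCA.
Qed.
End VonNeumann.
End Operators.

(** * The algebra of operators *)

Section OperatorAlgebra.
Variables (R : realType) (H : completeNormedModType R[i]).
Variable dot : {dot H for @Num.conj R[i]}.
Variable A : set (H -> H).
Variable phi : (H -> H) -> R[i].

(** The three hypotheses are parameters of the type, so that the instances of
    ring and algebra can be found from it. *)
Definition op_alg of hilbert_norm dot & von_neumann_algebra dot A &
  faithful_normal_trace_state dot A phi : Type := {S : H -> H | A S}.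

Variables (hH : hilbert_norm dot) (hA : von_neumann_algebra dot A)
  (hphi : faithful_normal_trace_state dot A phi).
Local Notation V := (op_alg hH hA hphi).

Definition op_val (a : V) : H -> H := sval a.
Lemma op_valP (a : V) : A (op_val a). Proof. exact: (svalP a). Qed.
Lemma op_val_inj : injective op_val.
Proof. by move=> [x Ax] [y Ay] /= e; apply: eq_exist. Qed.
Definition op_mk (S : H -> H) (AS : A S) : V := exist _ S AS.

HB.instance Definition _ := gen_eqMixin V.
HB.instance Definition _ := gen_choiceMixin V.

Let add (a b : V) : V := op_mk (vn_add hA (op_valP a) (op_valP b)).
Let opp (a : V) : V := op_mk (vn_opp hA (op_valP a)).
Let zero : V := op_mk (vn_zero hA).
Let one : V := op_mk (vn_id hA).
Let mul (a b : V) : V := op_mk (vn_comp hA (op_valP a) (op_valP b)).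
Let scale (c : R[i]) (a : V) : V := op_mk (vn_scale hA c (op_valP a)).

Let addA : associative add.
Proof. by move=> a b c; apply: op_val_inj; rewrite /= addrA. Qed.
Let addC : commutative add.
Proof. by move=> a b; apply: op_val_inj; rewrite /= addrC. Qed.
Let add0 : left_id zero add.
Proof. by move=> a; apply: op_val_inj; rewrite /= add0r. Qed.
Let addN : left_inverse zero opp add.
Proof. by move=> a; apply: op_val_inj; rewrite /= addNr. Qed.
HB.instance Definition _ := GRing.isZmodule.Build V addA addC add0 addN.

Let linV (a : V) : linear (op_val a).
Proof. by have [] := vn_bounded hA (op_valP a). Qed.
Let mulA : associative mul.
Proof. by move=> a b c; apply: op_val_inj. Qed.
Let mul1l : left_id one mul.
Proof. by move=> a; apply: op_val_inj. Qed.
Let mul1r' : right_id one mul.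
Proof. by move=> a; apply: op_val_inj. Qed.
Let mulDl : left_distributive mul add.
Proof. by move=> a b c; apply: op_val_inj. Qed.
Let mulDr : right_distributive mul add.
Proof.
move=> a b c; apply: op_val_inj; apply/funext => x /=.
by rewrite !fctE (lin_add (linV a)).
Qed.
Let one_neq0 : one != zero.
Proof.
apply/eqP => /(congr1 op_val) /= e; have := trace_unit hphi; rewrite e => e1.
have := trace_linear hphi 1 (vn_zero hA) (vn_zero hA).
rewrite scaler0 addr0 e1 mulr1 => /eqP; rewrite -subr_eq0 opprD addrA subrr sub0r.
by rewrite oppr_eq0 oner_eq0.
Qed.
HB.instance Definition _ :=
  GRing.Zmodule_isNzRing.Build V mulA mul1l mul1r' mulDl mulDr one_neq0.

Let scaleA c d (a : V) : scale c (scale d a) = scale (c * d) a.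
Proof. by apply: op_val_inj; rewrite /= scalerA. Qed.
Let scale1 : left_id 1 scale.
Proof. by move=> a; apply: op_val_inj; rewrite /= scale1r. Qed.
Let scaleDr : right_distributive scale +%R.
Proof. by move=> c a b; apply: op_val_inj; rewrite /= scalerDr. Qed.
Let scaleDl (a : V) : {morph scale^~ a : c d / c + d}.
Proof. by move=> c d; apply: op_val_inj; rewrite /= scalerDl. Qed.
HB.instance Definition _ :=
  GRing.Zmodule_isLmodule.Build R[i] V scaleA scale1 scaleDr scaleDl.

Let scaleAl (c : R[i]) (a b : V) : c *: (a * b) = (c *: a) * b.
Proof. by apply: op_val_inj. Qed.
HB.instance Definition _ := GRing.Lmodule_isLalgebra.Build R[i] V scaleAl.
Let scaleAr (c : R[i]) (a b : V) : c *: (a * b) = a * (c *: b).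
Proof.
apply: op_val_inj; apply/funext => x /=.
by rewrite !fctE (lin_scale (linV a)).
Qed.
HB.instance Definition _ := GRing.Lalgebra_isAlgebra.Build R[i] V scaleAr.

Lemma op_valD (a b : V) : op_val (a + b) = op_val a + op_val b. Proof. by []. Qed.
Lemma op_valB (a b : V) : op_val (a - b) = op_val a - op_val b. Proof. by []. Qed.
Lemma op_val0 : op_val 0 = 0. Proof. by []. Qed.
Lemma op_valM (a b : V) : op_val (a * b) = op_val a \o op_val b. Proof. by []. Qed.
Lemma op_valZ c (a : V) : op_val (c *: a) = c *: op_val a. Proof. by []. Qed.
Lemma op_valX (a : V) n : op_val (a ^+ n) = iter n (op_val a).
Proof.
elim: n => [//|n IH]; rewrite exprS op_valM IH.
by apply/funext.
Qed.
Lemma op_val_sum (I : Type) (s : seq I) (P : pred I) (f : I -> V) :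
  op_val (\sum_(i <- s | P i) f i) = \sum_(i <- s | P i) op_val (f i).
Proof. exact: (big_morph op_val op_valD op_val0). Qed.

Definition op_star (a : V) : V := op_mk (vn_adj hH hA (op_valP a)).2.
Lemma op_starP (a : V) : is_adj dot (op_val a) (op_val (op_star a)).
Proof. exact: (vn_adj hH hA (op_valP a)).1. Qed.
Lemma op_star_eq (a b : V) : is_adj dot (op_val a) (op_val b) -> op_star a = b.
Proof.
by move=> h; apply: op_val_inj; apply: (is_adj_uniq hH) (op_starP a) h.
Qed.

Definition op_tr (a : V) : R[i] := phi (op_val a).
Let op_tr_linear : scalar op_tr.
Proof. by move=> c a b; apply: (trace_linear hphi); apply: op_valP. Qed.
HB.instance Definition _ := GRing.isLinear.Build R[i] V R[i] *%R op_tr op_tr_linear.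

Lemma op_trZ c (a : V) : op_tr (c *: a) = c * op_tr a.
Proof. exact: linearZ. Qed.
Lemma op_trB (a b : V) : op_tr (a - b) = op_tr a - op_tr b.
Proof. exact: linearB. Qed.

Lemma op_tr_ge0 (a : V) : 0 <= op_tr (op_star a * a).
Proof.
have := trace_positive hphi (op_valP a).
by rewrite (adjP hH (op_starP a)).
Qed.

Lemma op_starM (u v : V) : op_star (u * v) = op_star v * op_star u.
Proof. by apply: op_star_eq => x y; rewrite /= (op_starP u) (op_starP v). Qed.

Lemma op_starK (u : V) : op_star (op_star u) = u.
Proof. exact/op_star_eq/is_adj_sym/op_starP. Qed.

(** [2M - s] has a square root when [s] is self-adjoint of norm at most [M]. *)
Lemma op_tr_conj_le (s : V) (M : R) : op_star s = s -> 0 < M ->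
  (forall x, `|op_val s x| <= M%:C%C * `|x|) -> forall b : V,
  op_tr (op_star b * s * b) <= (2 * M)%:C%C * op_tr (op_star b * b).
Proof.
move=> ss M0 hM b.
have hx : is_adj dot (op_val s) (op_val s) by have := op_starP s; rewrite ss.
have M20 : 0 < 2 * M by rewrite mulr_gt0.
pose z : V := (((2 * M)^-1)%:C%C) *: s.
have [|x|y [Ay ay hy]] := @sqrt_one_minus _ _ _ hH _ hA (op_val z) (op_valP z).
- by move=> x y; rewrite op_valZ !fctE dotZl dotZr hx conj_RC.
- rewrite op_valZ !fctE normrZ ger0_norm; last by rewrite ler0c invr_ge0 ltW.
  apply: le_trans (ler_wpM2l _ (hM x)) _; first by rewrite ler0c invr_ge0 ltW.
  rewrite mulrA -RCM ler_wpM2r // -(rmorph_nat (real_complex R)).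
  by rewrite -(fmorphV (real_complex R)) RC_le invfM mulfVK // gt_eqF.
pose q := op_mk Ay.
have qs : op_star q = q by apply: op_star_eq.
have qq : q * q = 1 - z by apply: op_val_inj; apply/funext => x /=; apply: hy.
have := op_tr_ge0 (q * b).
have -> : op_star (q * b) * (q * b) = op_star b * b - op_star b * z * b.
  by rewrite op_starM qs -mulrA (mulrA q) qq mulrBl mul1r mulrBr mulrA.
have -> : op_star b * z * b = ((2 * M)^-1)%:C%C *: (op_star b * s * b).
  by rewrite /z -scalerAr -scalerAl.
rewrite op_trB op_trZ subr_ge0 => h.
have M2 : 0 <= (2 * M)%:C%C :> R[i] by rewrite ler0c ltW.
by have := ler_wpM2l M2 h; rewrite [X in X <= _]mulrA -RCM divff ?gt_eqF // mul1r.
Qed.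

(** The trace of [star b * s * b] is positive in [s], and [s] is at most a multiple
    of the identity; without functional calculus this is seen from a square
    root of the difference. *)
Lemma op_bounded_trace (a : V) : exists2 M : R, 0 <= M & forall b : V,
  op_tr (op_star (a * b) * (a * b)) <= M%:C%C * op_tr (op_star b * b).
Proof.
have [M M0 hM] := bounded_pos (vn_bounded hA (op_valP (op_star a * a))).
exists (2 * M) => [|b]; first by rewrite mulr_ge0 // ltW.
have ss : op_star (op_star a * a) = op_star a * a by rewrite op_starM op_starK.
by have := op_tr_conj_le ss M0 hM b; rewrite op_starM !mulrA.
Qed.

Lemma op_alg_tracial : tracial op_star (op_tr : {scalar V}).
Proof.
split.
- move=> a b; apply: op_star_eq => x y; rewrite !op_valD !fctE dotDl dotDr.
  by rewrite (op_starP a) (op_starP b).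
- by move=> c a; apply: op_star_eq => x y; rewrite !op_valZ !fctE dotZl dotZr conjCK (op_starP a).
- exact: op_starM.
- exact: op_starK.
- exact: (trace_unit hphi).
- exact: op_tr_ge0.
- move=> a h; apply: op_val_inj; apply: (trace_faithful hphi); first exact: op_valP.
  by rewrite (adjP hH (op_starP a)).
- by move=> a b; apply: (trace_tracial hphi); apply: op_valP.
- exact: op_bounded_trace.
Qed.

(** The link between the operator norm and the trace norm: apply
    [op_tr_conj_le] to [a * a] at [b = 1]. *)
Lemma op_norm_nm (a : V) (e : R) : 0 < e -> op_star a = a ->
  (forall x, `|op_val a x| <= e%:C%C * `|x|) ->
  nm op_star (op_tr : {scalar V}) a <= 2 * e.
Proof.
move=> e0 sa ha.
have haa x : `|op_val (a * a) x| <= (e * e)%:C%C * `|x|.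
  apply: le_trans (ha _) _; rewrite RCM -mulrA ler_wpM2l //.
  by rewrite ler0c ltW.
have := op_tr_conj_le (_ : op_star (a * a) = a * a) (mulr_gt0 e0 e0) haa 1.
have s1 : op_star 1 = 1 by apply: op_star_eq.
rewrite op_starM sa s1 !mul1r !mulr1 (trace_unit hphi : op_tr 1 = 1) mulr1 => /(_ erefl).
rewrite lecE /= => /andP[_ h].
rewrite /nm sa -[X in _ <= X]ger0_norm ?mulr_ge0 ?(ltW e0) // -sqrtr_sqr.
apply: ler_wsqrtr; apply: le_trans h _.
by have := mulr_gt0 e0 e0; rewrite exprMn expr2; lra.
Qed.
End OperatorAlgebra.

(** * Moments and free cumulants *)

Section MeasureMoments.
Variables (R : realType) (mu : probability (measurableTypeR R) R).

Lemma moment_integrable n : compactly_supported mu ->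
  mu.-integrable [set: R] (EFin \o (fun x : R => x ^+ n)).
Proof.
move=> [K cK muK].
have mf (D : set R) : measurable_fun D (fun x : R => x ^+ n).
  by apply: measurable_funX; exact: measurable_id.
have mK : measurable (K : set (measurableTypeR R)) by exact: compact_measurable.
apply/(@negligible_integrable _ _ _ mu setT (~` K)) => //.
- exact: measurableC.
- exact/measurable_EFinP.
rewrite setDE setCK setTI; apply: measurable_bounded_integrable => //.
  by rewrite (le_lt_trans (probability_le1 mu mK)) // ltry.
have [M [Mr hM]] := compact_bounded cK.
exists ((`|M| + 1) ^+ n); split; first by rewrite num_real.
move=> x Mx y Ky /=; apply: le_trans (ltW Mx); rewrite normrX.
apply: lerXn2r; rewrite ?nnegrE ?addr_ge0 //.
apply: hM Ky; rewrite (le_lt_trans (ler_norm M)) // ltrDl //.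
Qed.

Lemma variance_moments : compactly_supported mu -> 'V_mu[@id R] = 1%E ->
  moment mu 2 - moment mu 1 ^+ 2 = 1.
Proof.
move=> cmu.
have i1 : (id : R -> R) \in Lfun mu 1.
  rewrite Lfun1_integrable; have := moment_integrable 1 cmu.
  by apply: eq_integrable => // x _ /=; rewrite expr1.
have i2 : ((id : R -> R) * id)%R \in Lfun mu 1.
  rewrite Lfun1_integrable; have := moment_integrable 2 cmu.
  by apply: eq_integrable => // x _ /=; rewrite expr2.
rewrite /variance covarianceE // => /(congr1 fine) /=.
rewrite fineB ?fineM ?fin_numM ?expectation_fin_num // => <-.
rewrite /moment /Rintegral unlock expr2; congr (fine _ - fine _ * fine _).
Qed.
End MeasureMoments.

Section Cumulants.
Variables (R : realType) (r : nat -> R).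
Variable mu_ : R -> probability (measurableTypeR R) R.
Hypothesis hmu_ : forall t, 0 <= t -> is_free_cumulants (mu_ t) (fun k => t * r k).

Let nc n (P : {set {set 'I_n}}) :=
  finset.partition P (finset.setTfor 'I_n) && noncrossing P.

(** The coefficient of [t] in the [n]-th moment; the only partition into one
    block contributes [r n]. *)
Definition kappa n : R := \sum_(P : {set {set 'I_n}} | nc P && (#|P| == 1)%N)
  \prod_(B in P) r #|B|.

Lemma momentE n t : 0 <= t -> moment (mu_ t) n =
  \sum_(P : {set {set 'I_n}} | nc P) t ^+ #|P| * \prod_(B in P) r #|B|.
Proof.
move=> t0; rewrite (hmu_ t0); apply: eq_bigr => P _.
by rewrite big_split /= prodr_const.
Qed.

(** In the moment-cumulant formula for [t r], a partition into [b] blocks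
    contributes [t ^ b]. *)
Lemma moment_kappa n T : (0 < n)%N -> exists2 M, 0 <= M & forall h,
  0 <= h -> h <= T -> `|moment (mu_ h) n - kappa n * h| <= M * h ^+ 2.
Proof.
move=> n0.
exists (\sum_(P : {set {set 'I_n}} | nc P) (1 + `|T|) ^+ #|P| * `|\prod_(B in P) r #|B| |).
  by apply: sumr_ge0 => P _; rewrite mulr_ge0 ?exprn_ge0 ?addr_ge0.
move=> h h0 hT; rewrite momentE // (bigID (fun P : {set {set 'I_n}} => #|P| == 1)%N) /=.
have -> : \sum_(P : {set {set 'I_n}} | nc P && (#|P| == 1)%N)
    h ^+ #|P| * \prod_(B in P) r #|B| = kappa n * h.
  rewrite mulr_suml; apply: eq_bigr => P /andP[_ /eqP ->].
  by rewrite expr1 mulrC.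
rewrite addrAC subrr add0r mulr_suml.
apply: le_trans (ler_norm_sum _ _ _) _.
rewrite [X in _ <= X](bigID (fun P : {set {set 'I_n}} => #|P| == 1)%N) /=.
rewrite -[X in X <= _]add0r; apply: lerD.
  by apply: sumr_ge0 => P _; rewrite mulr_ge0 ?sqr_ge0 // mulr_ge0 ?exprn_ge0 ?addr_ge0.
apply: ler_sum => P /andP[/andP[pP _] P1].
have P2 : (2 <= #|P|)%N.
  rewrite ltn_neqAle eq_sym P1 /= lt0n; apply/eqP => P0.
  have := finset.cover_partition pP; rewrite (cards0_eq P0) /finset.cover finset.big_set0.
  by move=> /finset.setP/(_ (Ordinal n0)); rewrite !inE.
rewrite normrM ger0_norm ?exprn_ge0 // mulrAC ler_wpM2r //.
rewrite -(subnK P2) !exprD ler_wpM2r ?sqr_ge0 //.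
have T1 : h <= 1 + `|T| by rewrite (le_trans hT) // (le_trans (ler_norm T)) // lerDr.
apply: (@le_trans _ _ ((1 + `|T|) ^+ (#|P| - 2))).
  by apply: lerXn2r; rewrite ?nnegrE ?addr_ge0.
by rewrite ler_peMr ?exprn_ege1 ?exprn_ge0 ?addr_ge0 // lerDl.
Qed.
End Cumulants.

(** The inductive description of alternating products and their description by
    sequences of letters. *)
Lemma alternating_seq (R : realType) (V : algType R[i]) (tr : {scalar V})
  (B D : set V) (b : bool) (z : V) : alternating tr B D b z ->
  exists n (i : nat -> bool) (c : nat -> V),
  [/\ forall j, (j <= n)%N -> (if i j then D (c j) else B (c j)) /\ tr (c j) = 0,
      forall j, (j < n)%N -> i j != i j.+1, i n = b & z = \prod_(j < n.+1) c j].
Proof.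
elim=> {b z} [b z Bz z0|b z w _ [n [i [c [h1 h2 h3 h4]]]] Bw w0].
  exists 0%N, (fun=> b), (fun=> z); split=> //.
  by rewrite big_ord1.
exists n.+1, (fun j => if (j <= n)%N then i j else b),
  (fun j => if (j <= n)%N then c j else w); split.
- move=> j; rewrite leq_eqVlt => /predU1P[->|]; first by rewrite ltnn.
  by rewrite ltnS => jn; rewrite jn; apply: h1.
- move=> j; rewrite ltnS => jn; rewrite jn; case: ltnP => [lt|ge]; first exact: h2.
  have -> : j = n by apply/eqP; rewrite eqn_leq jn.
  by rewrite h3; case: (b).
- by rewrite ltnn.
- rewrite h4 [RHS]big_ord_recr /= ltnn; congr (_ * _).
  by apply: eq_bigr => j _; rewrite -ltnS ltn_ord.
Qed.

(** * The stochastic measure in the algebra *)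

Section Instance.
Variables (R : realType) (H : completeNormedModType R[i]).
Variables (dot : {dot H for @Num.conj R[i]}) (hH : hilbert_norm dot).
Variables (A : set (H -> H)) (hA : von_neumann_algebra dot A).
Variables (phi : (H -> H) -> R[i]) (hphi : faithful_normal_trace_state dot A phi).
Variable A_ : R -> set (H -> H).
Hypothesis hA_ : forall t : R, 0 <= t -> von_neumann_algebra dot (A_ t) /\ A_ t `<=` A.
Hypothesis hA_incr : forall s t : R, 0 <= s -> s <= t -> A_ s `<=` A_ t.
Local Notation V := (op_alg hH hA hphi).
Local Notation star := (@op_star R H dot A phi hH hA hphi).
Local Notation tr := (@op_tr R H dot A phi hH hA hphi : {scalar V}).
Local Notation val := (@op_val R H dot A phi hH hA hphi).

Let tV := op_alg_tracial hH hA hphi.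

Definition op_lift (S : H -> H) : V :=
  match pselect (A S) with left h => op_mk hH hA hphi h | right _ => 0 end.

Lemma op_liftK S : A S -> val (op_lift S) = S.
Proof. by rewrite /op_lift; case: pselect. Qed.

Definition filt (t : R) : set V := [set a | A_ t (val a)].

Lemma filt_op_lift t S : 0 <= t -> A_ t S -> filt t (op_lift S).
Proof. by move=> t0 AS; rewrite /filt /= op_liftK //; apply: (hA_ t0).2. Qed.

Lemma filt_subalgebra t : 0 <= t -> subalgebra star (filt t).
Proof.
move=> t0; have [vA sA] := hA_ t0; split.
- exact: (vn_id vA).
- by move=> a b; apply: (vn_add vA).
- by move=> c a; apply: (vn_scale vA).
- by move=> a b; apply: (vn_comp vA).
- move=> a /= Aa; have [h1 h2] := vn_adj hH vA Aa.
  have e : adj dot (val a) = val (star a) by exact: (adjP hH (op_starP a)).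
  by change (A_ t (val (star a))); rewrite -e.
Qed.

Variable mu_ : R -> probability (measurableTypeR R) R.
Variable X : R -> R -> (H -> H).
Hypothesis hX : adapted_free_stochastic_measure dot A phi A_ mu_ X.

Definition XV a b : V := op_lift (X a b).

Lemma val_XV a b : 0 <= a -> a <= b -> val (XV a b) = X a b.
Proof. by move=> a0 ab; apply: op_liftK; apply: (fsm_mem hX); rewrite a0. Qed.

Lemma val_prod n (c : nat -> V) :
  val (\prod_(j < n) c j) = \big[(fun S T => S \o T)/id]_(j < n) val (c j).
Proof.
by apply: (big_morph val (fun a b => erefl)).
Qed.

Lemma powers_poly_alg (a z : V) : powers a z -> poly_alg (val a) (val z).
Proof.
case=> p _ <-; exists p => //; rewrite /polyop /polyv op_val_sum.
by apply: eq_bigr => i _; rewrite op_valZ op_valX.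
Qed.

Lemma filt_free t a b : 0 <= t -> t <= a -> a <= b ->
  free_pair tr (filt t) (powers (XV a b)).
Proof.
move=> t0 ta ab c z /alternating_seq[n [i [u [h1 h2 _ ->]]]].
have a0 := le_trans t0 ta.
have dis : `[a, b[%classic `&` `[0, t[%classic = set0.
  apply/seteqP; split=> // x [] /=; rewrite !in_itv /= => /andP[ax _] /andP[_ xt].
  by have := lt_le_trans xt (le_trans ta ax); rewrite ltxx.
have ab' : 0 <= a <= b by rewrite a0.
rewrite /= /op_tr val_prod.
have fr := fsm_free_past hX ab' t0 dis.
refine (fr n i (fun j => val (u j)) _ h2) => j jn.
have [Bj trj] := h1 j jn; split=> //.
case: (i j) Bj => // Bj; rewrite -(val_XV a0 ab); exact: powers_poly_alg.
Qed.

Variables (r : nat -> R).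
Hypothesis hmu_ : forall t, 0 <= t -> is_free_cumulants (mu_ t) (fun k => t * r k).
Hypothesis hvar : moment (mu_ 1) 2 - moment (mu_ 1) 1 ^+ 2 = 1.

Lemma XV_free_process :
  free_process star tr filt XV (fun n h => moment (mu_ h) n) (kappa r).
Proof.
split.
- exact: filt_subalgebra.
- by move=> s t s0 st a; apply: hA_incr.
- move=> a b a0 ab; have b0 := le_trans a0 ab; rewrite /filt /= val_XV //.
  apply: (fsm_adapted hX) => //; first by rewrite a0.
  move=> x /=; rewrite !in_itv /= => /andP[ax xb]; by rewrite (le_trans a0 ax).
- move=> a b a0 ab; apply: op_star_eq; rewrite val_XV //.
  by apply: (fsm_self_adjoint hX); rewrite a0.
- move=> a b c a0 ab bc; apply: op_val_inj; rewrite op_valD !val_XV ?(le_trans a0) //.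
    exact: (fsm_additive hX).
  exact: le_trans bc.
- move=> a b n a0 ab; rewrite /= /op_tr op_valX val_XV //.
  by apply: (fsm_distribution hX); rewrite a0.
- by move=> n T; apply: moment_kappa.
- exact: filt_free.
- exact: hvar.
Qed.

Variable Delta : nat -> R -> R -> (H -> H).
Hypothesis hDelta : forall k : nat, (0 < k)%N -> is_diagonal_measure X k (Delta k).

Definition DV k a b : V := op_lift (Delta k a b).

Lemma cells_val k a b N : (0 < N)%N -> 0 <= a -> a <= b ->
  val (\sum_(i < N) XV (ptn a b N i) (ptn a b N i.+1) ^+ k) =
  \sum_(1 <= i < N.+1)
     iter k (X (a + i.-1%:R / N%:R * (b - a)) (a + i%:R / N%:R * (b - a))).
Proof.
move=> N0 a0 ab; rewrite big_add1 /= big_mkord op_val_sum; apply: eq_bigr => i _.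
rewrite op_valX val_XV //; first exact: le_trans (ptn_ge _ _ ab).
exact: ptn_le.
Qed.

Definition cells k a b N : H -> H := \sum_(1 <= i < N.+1)
     iter k (X (a + i.-1%:R / N%:R * (b - a)) (a + i%:R / N%:R * (b - a))).

Lemma Delta_op_cvg k a b : (0 < k)%N -> 0 <= a -> a <= b ->
  op_cvg (fun N => cells k a b N.+1) (Delta k a b).
Proof.
move=> k0 a0 ab; have ab' : 0 <= a <= b by rewrite a0.
move=> e e0; have [N0 hN] := opnorm_cvgP (hDelta k0 ab') e0.
by exists N0 => N NN; apply: hN; rewrite leqW.
Qed.

Lemma Delta_mem k a b : (0 < k)%N -> 0 <= a -> a <= b -> A_ b (Delta k a b).
Proof.
move=> k0 a0 ab; have b0 := le_trans a0 ab; have [vA sA] := hA_ b0.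
refine (vn_limit vA (Delta_op_cvg k0 a0 ab) _) => N.
rewrite /cells -cells_val //.
have h := filt_subalgebra b0; have pX := XV_free_process.
apply: (subalg_sum h) => i _; apply/(subalgX h)/(XabF pX).
- exact: le_trans (ptn_ge _ _ ab).
- exact: ptn_le.
- by apply: ptn_leb.
Qed.

Lemma val_DV k a b : (0 < k)%N -> 0 <= a -> a <= b -> val (DV k a b) = Delta k a b.
Proof.
move=> k0 a0 ab; apply: op_liftK; apply: (hA_ (le_trans a0 ab)).2; exact: Delta_mem.
Qed.

(** Sums of powers of self-adjoint increments are self-adjoint, so that their
    convergence in operator norm is also one in trace norm. *)
Lemma DV_diagonal : diagonal_measures star tr filt XV DV.
Proof.
have pX := XV_free_process.
split=> k a b k0 a0 ab; first by apply: filt_op_lift; [exact: le_trans ab|exact: Delta_mem].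
move=> e e0; have ab' : 0 <= a <= b by rewrite a0.
have e20 : 0 < e / 2 by rewrite divr_gt0.
have e20' : 0 < (e / 2)%:C%C :> R[i] by rewrite ltcR.
have [N0 hN] := opnorm_cvgP (hDelta k0 ab') e20'.
exists N0 => N NN Np.
have sX i : is_adj dot (val (XV (ptn a b N i) (ptn a b N i.+1)))
   (val (XV (ptn a b N i) (ptn a b N i.+1))).
  have t0 : 0 <= ptn a b N i by exact: le_trans (ptn_ge _ _ ab).
  rewrite val_XV //; last exact: ptn_le.
  by apply: (fsm_self_adjoint hX); rewrite t0 ptn_le.
have sc M : (0 < M)%N -> star (\sum_(i < M) XV (ptn a b M i) (ptn a b M i.+1) ^+ k) =
    \sum_(i < M) XV (ptn a b M i) (ptn a b M i.+1) ^+ k.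
  move=> M0; rewrite (star_sum tV); apply: eq_bigr => i _.
  rewrite (starX tV) (fp_star pX) //; last exact: ptn_le.
  exact: le_trans (ptn_ge _ _ ab).
have sD : star (DV k a b) = DV k a b.
  apply: op_star_eq; rewrite val_DV //.
  apply: (op_cvg_adj hH (Delta_op_cvg k0 a0 ab)) => M.
  rewrite /cells -cells_val //; have := op_starP (\sum_(i < M.+1) XV (ptn a b M.+1 i)
     (ptn a b M.+1 i.+1) ^+ k).
  by rewrite sc.
rewrite [X in _ <= X](_ : e = 2 * (e / 2)); last by field.
apply: op_norm_nm => //; first by rewrite (starB tV) sc // sD.
by move=> x; rewrite op_valB cells_val // val_DV //; apply: hN.
Qed.

End Instance.

(** * Step processes *)

Section StepFunctions.
Variable R : realType.
Local Notation leb := (@lebesgue_measure R).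
Local Notation half := (@half_line R).
Implicit Types (f g : R -> R).

Lemma half_measurable : measurable half.
Proof. exact: measurable_itv. Qed.
Hint Resolve half_measurable : core.

Lemma integral_cell (a b : R) : 0 <= a -> a <= b ->
  leb.-integrable half (EFin \o \1_`[a, b[) /\
  \int[leb]_(x in half) \1_`[a, b[ x = b - a.
Proof.
move=> a0 ab; split.
  by apply: integrableS (integrable_indic_itv a b true true).
rewrite /Rintegral integral_indic //.
have -> : (`[a, b[ `&` half)%classic = `[a, b[%classic.
  apply/seteqP; split=> x /=; first by case.
  rewrite /half_line /= !in_itv /= andbT => /andP[ax xb]; split; first by rewrite ax.
  exact: le_trans ax.
have h := lebesgue_measure_itv `[a, b[; rewrite /= lte_fin in h.
transitivity (fine (if a < b then (b%:E - a%:E)%E else 0%E)); first exact: congr1 h.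
by have := ab; rewrite le_eqVlt => /predU1P[->|->] //=; rewrite ltxx subrr.
Qed.

Definition step_fun (J : finType) (lo hi c : J -> R) (x : R) : R :=
  \sum_(j | lo j <= x < hi j) c j.

Lemma step_funE (J : finType) (lo hi c : J -> R) x :
  step_fun lo hi c x = \sum_j c j * \1_`[lo j, hi j[ x.
Proof.
rewrite /step_fun big_mkcond; apply: eq_bigr => j _.
rewrite indicE; case: ifPn => h.
  by rewrite mem_set ?mulr1 //= in_itv.
rewrite memNset ?mulr0 //= in_itv /=; exact/negP.
Qed.

Lemma step_integral (J : finType) (lo hi c : J -> R) :
  (forall j, 0 <= lo j) -> (forall j, lo j <= hi j) ->
  leb.-integrable half (EFin \o step_fun lo hi c) /\
  \int[leb]_(x in half) step_fun lo hi c x = \sum_j c j * (hi j - lo j).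
Proof.
move=> l0 lh.
have ic j : leb.-integrable half (fun x => (c j)%:E * (\1_`[lo j, hi j[ x)%:E)%E.
  by apply: integrableZl => //; have [] := integral_cell (l0 j) (lh j).
have E : EFin \o step_fun lo hi c =
    fun x => (\sum_j (c j)%:E * (\1_`[lo j, hi j[ x)%:E)%E.
  by apply/funext => x /=; rewrite step_funE sumEFin.
split; first by rewrite E; apply: integrable_sum.
rewrite /Rintegral -[X in integral _ _ X]/(EFin \o step_fun lo hi c) E integral_sum //.
have h j : (\int[leb]_(x in half) ((c j)%:E * (\1_`[lo j, hi j[ x)%:E) = (c j * (hi j - lo j))%:E)%E.
  have [i1 i2] := integral_cell (l0 j) (lh j).
  rewrite integralZl // -i2 EFinM /Rintegral fineK //.
  exact: (integrable_fin_num half_measurable i1).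
by rewrite (eq_bigr _ (fun j _ => h j)) sumEFin.
Qed.

Lemma bounded_integrable f (T K : R) : 0 <= T -> 0 <= K -> measurable_fun half f ->
  (forall x, 0 <= x -> `|f x| <= if x < T then K else 0) ->
  leb.-integrable half (EFin \o f) /\ `|\int[leb]_(x in half) f x| <= K * T.
Proof.
move=> T0 K0 mf hf.
pose g x := K * \1_`[0, T[ x.
have [i1 i2] := integral_cell (lexx 0) T0.
have ig : leb.-integrable half (EFin \o g).
  have -> : EFin \o g = fun x => (K%:E * (\1_`[0, T[ x)%:E)%E by [].
  exact: integrableZl.
have fg x : half x -> `|f x| <= g x.
  rewrite /half_line /= in_itv /= andbT => x0; apply: le_trans (hf _ x0) _.
  rewrite /g indicE; case: ltP => xT.
    by rewrite mem_set ?mulr1 //= in_itv /= x0.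
  by rewrite mulr_ge0.
have iff : leb.-integrable half (EFin \o f).
  apply: (le_integrable half_measurable _ _ ig); first exact/measurable_EFinP.
  move=> x hx /=; rewrite lee_fin [X in _ <= X]ger0_norm; first exact: fg.
  exact: le_trans (fg _ hx).
split=> //; apply: le_trans (le_normr_Rintegral half_measurable iff) _.
have -> : K * T = \int[leb]_(x in half) g x by rewrite RintegralZl // i2 subr0.
apply: le_Rintegral => //; exact: (integrable_norm iff).
Qed.

Lemma step_bound (J : finType) (lo hi c : J -> R) (T K : R) : 0 <= T -> 0 <= K ->
  (forall j, 0 <= lo j) -> (forall j, lo j <= hi j) ->
  (forall x, 0 <= x -> `|step_fun lo hi c x| <= if x < T then K else 0) ->
  `|\sum_j c j * (hi j - lo j)| <= K * T.
Proof.
move=> T0 K0 l0 lh h; have [i <-] := step_integral c l0 lh.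
apply: (bounded_integrable T0 K0 _ h).2.
by apply/measurable_EFinP; exact: (measurable_int leb).
Qed.
End StepFunctions.

(** A simple biprocess with entries in an algebra, its terms being indexed by an
    arbitrary finite type. *)
Record step_process (R : realType) (A : Type) := StepProcess {
  sp_index : finType;
  sp_lo : sp_index -> R;
  sp_hi : sp_index -> R;
  sp_left : sp_index -> A;
  sp_right : sp_index -> A }.

Section StepProcesses.
Variables (R : realType) (A : algType R[i]) (star : A -> A) (phi : {scalar A}).
Hypothesis tA : tracial star phi.
Variables (F : R -> set A) (X : R -> R -> A) (m : nat -> R -> R) (ka : nat -> R).
Hypothesis pX : free_process star phi F X m ka.
Variable D : nat -> R -> R -> A.
Hypothesis pD : diagonal_measures star phi F X D.
Local Notation C := R[i].
Local Notation nm := (nm star phi).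
Local Notation leb := (@lebesgue_measure R).
Local Notation half := (@half_line R).
Implicit Types (U V : step_process R A).

Definition sp_adapted U := forall i : sp_index U,
  [/\ 0 <= sp_lo i, sp_lo i <= sp_hi i, F (sp_lo i) (sp_left i) & F (sp_lo i) (sp_right i)].

Definition sp_at U (x : R) : seq (C * (A * A)) :=
  [seq (1, (sp_left i, sp_right i))
     | i <- enum [pred i : sp_index U | sp_lo i <= x < sp_hi i]].

Definition sp_int k U : A :=
  \sum_(i : sp_index U) sp_left i * (D k 0 (sp_hi i) - D k 0 (sp_lo i)) * sp_right i.

Definition sp_drift U : A :=
  \sum_(i : sp_index U) (sp_hi i - sp_lo i)%:C%C *: (sp_left i * sp_right i).

Definition sp_energy U : R :=
  energy star phi (@sp_lo _ _ U) (@sp_hi _ _ U) (@sp_left _ _ U) (@sp_right _ _ U).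

Definition sp_within (T : R) U := forall z : sp_index U, sp_hi z <= T.

Definition sp_sub U V : step_process R A := @StepProcess R A (sp_index U + sp_index V)%type
  (fun z => match z with inl i => sp_lo i | inr j => sp_lo j end)
  (fun z => match z with inl i => sp_hi i | inr j => sp_hi j end)
  (fun z => match z with inl i => sp_left i | inr j => - sp_left j end)
  (fun z => match z with inl i => sp_right i | inr j => sp_right j end).

Lemma sp_sub_adapted U V : sp_adapted U -> sp_adapted V -> sp_adapted (sp_sub U V).
Proof.
move=> hU hV [i|j] /=; first exact: hU.
have [h1 h2 h3 h4] := hV j; split=> //.
by apply: (subalgN (fp_sub pX h1)).
Qed.

Lemma sp_int_sub k U V : sp_int k (sp_sub U V) = sp_int k U - sp_int k V.
Proof.
rewrite /sp_int big_sumType /= -sumrN; congr (_ + _); apply: eq_bigr => j _.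
by rewrite !mulNr.
Qed.

Lemma sp_drift_sub U V : sp_drift (sp_sub U V) = sp_drift U - sp_drift V.
Proof.
rewrite /sp_drift big_sumType /= -sumrN; congr (_ + _); apply: eq_bigr => j _.
by rewrite mulNr scalerN.
Qed.

Lemma insert_at y U x : insert y (sp_at U x) =
  \sum_(i : sp_index U | sp_lo i <= x < sp_hi i) sp_left i * y * sp_right i.
Proof.
rewrite /insert /sp_at big_map big_enum /=.
by apply: eq_bigr => i _; rewrite scale1r.
Qed.

Lemma insert_at_sub y U V x :
  insert y (sp_at (sp_sub U V) x) = insert y (sp_at U x) - insert y (sp_at V x).
Proof.
rewrite !insert_at big_sumType /= -sumrN; congr (_ + _); apply: eq_bigr => j _.
by rewrite !mulNr.
Qed.

Lemma sp_at_mem U x v : sp_adapted U -> v \in sp_at U x ->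
  0 <= x /\ F x v.2.1 /\ F x v.2.2.
Proof.
move=> hU; rewrite /sp_at => /mapP[z]; rewrite mem_enum inE => /andP[ix _] ->.
have [h1 h2 h3 h4] := hU z; split; first exact: le_trans ix.
by split; apply: (fp_incr pX h1 ix).
Qed.

(** The energy is the integral of the square of the norm: the product of the
    indicators of two intervals is the indicator of their intersection. *)
Lemma energy_integral U : sp_adapted U ->
  leb.-integrable half (EFin \o (fun x => tensor_normsq star phi (sp_at U x))) /\
  \int[leb]_(x in half) tensor_normsq star phi (sp_at U x) =
  sp_energy U.
Proof.
move=> hU.
pose lo (z : sp_index U * sp_index U) := Num.max (sp_lo z.1) (sp_lo z.2).
(* The maximum keeps [lo <= hi] when the two intervals are disjoint. *)
pose hi (z : sp_index U * sp_index U) :=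
  Num.max (lo z) (Num.min (sp_hi z.1) (sp_hi z.2)).
pose c (z : sp_index U * sp_index U) := complex.Re
  (phi (star (sp_left z.1) * sp_left z.2) * phi (sp_right z.2 * star (sp_right z.1))).
have lo0 z : 0 <= lo z by rewrite le_max; have [-> ] := hU z.1.
have lohi z : lo z <= hi z by rewrite le_max lexx.
have [i1 i2] := step_integral c lo0 lohi.
have E x : tensor_normsq star phi (sp_at U x) = step_fun lo hi c x.
  rewrite /tensor_normsq exchange_big /= /sp_at big_map big_enum /= cRe_sum.
  under eq_bigr => i _ do rewrite big_map big_enum /= cRe_sum.
  rewrite pair_big_dep /=; apply: eq_big => [[i j]|[i j] _] /=; last first.
    by rewrite rmorph1 !mul1r.
  rewrite /lo /hi !inE /= !lt_max !ge_max.
  case: (leP (sp_lo i) x) => //= hi1; case: (leP (sp_lo j) x) => //= hj1; last first.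
    by rewrite andbF.
  by rewrite lt_min.
have E' : (fun x => tensor_normsq star phi (sp_at U x)) = step_fun lo hi c.
  exact/funext.
rewrite E'; split=> //; rewrite i2 /sp_energy /energy pair_bigA /=; apply: eq_bigr => -[i j] _.
rewrite mulrC; congr (_ * _); rewrite /hi /lo /overlap /=.
by rewrite addr_maxl subrr.
Qed.

Local Notation cpow := (cpow phi X).

Lemma tensor_normsq_ge0 t (u : seq (C * (A * A))) : 0 <= t ->
  (forall v, v \in u -> F t v.2.1 /\ F t v.2.2) -> 0 <= tensor_normsq star phi u.
Proof. by move=> t0 hu; rewrite (tensor_normsqE tA pX t0 hu) sqr_ge0. Qed.

Lemma energy_le U T K : sp_adapted U -> 0 <= T -> 0 <= K ->
  sp_within T U ->
  (forall x, 0 <= x -> x < T -> nm (insert (cpow 1 T (T + 1)) (sp_at U x)) ^+ 2 <= K) ->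
  sp_energy U <= K * T.
Proof.
move=> hU T0 K0 hT hx; have [i1 i2] := energy_integral hU.
rewrite -i2; apply: le_trans (ler_norm _) _.
apply: (bounded_integrable T0 K0 _ _).2.
  by apply/measurable_EFinP; exact: (measurable_int leb).
move=> x x0; have hm v : v \in sp_at U x -> F x v.2.1 /\ F x v.2.2.
  by case/(sp_at_mem hU).
case: ltP => xT.
  rewrite ger0_norm; last exact: tensor_normsq_ge0 hm.
  rewrite (tensor_normsqE tA pX T0); first exact: hx.
  by move=> v /hm[v1 v2]; split; apply: (fp_incr pX x0 (ltW xT)).
rewrite (tensor_normsqE tA pX x0 hm) insert_at big_pred0 => [|z].
  by rewrite nm0 expr0n normr0.
by apply/negbTE; rewrite negb_and -leNgt -ltNge (le_trans (hT z)) ?orbT.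
Qed.

(** By duality, pairing the drift with itself, this is an inequality between
    integrals of real step functions. *)
Lemma drift_le U T K : sp_adapted U -> 0 <= T -> 0 <= K ->
  sp_within T U ->
  (forall x, 0 <= x -> x < T -> nm (insert 1 (sp_at U x)) <= K) ->
  nm (sp_drift U) <= K * T.
Proof.
move=> hU T0 K0 hT hx; set d := sp_drift U.
pose c (z : sp_index U) := complex.Re (phi (star d * (sp_left z * sp_right z))).
have lo0 z : 0 <= @sp_lo _ _ U z by have [] := hU z.
have lohi z : @sp_lo _ _ U z <= sp_hi z by have [] := hU z.
have E : nm d ^+ 2 = \sum_z c z * (sp_hi z - sp_lo z).
  rewrite (sqr_nm tA) {2}/d /sp_drift mulr_sumr phi_sum cRe_sum; apply: eq_bigr => z _.
  by rewrite -scalerAr phiZ cReM /= mul0r subr0 mulrC.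
have [/eqP -> |d0] := boolP (nm d == 0); first by rewrite mulr_ge0.
have {}d0 : 0 < nm d by rewrite lt_def d0 nm_ge0.
rewrite -(ler_pM2l d0) -expr2 E mulrA; apply: le_trans (ler_norm _) _.
apply: step_bound => //; first by rewrite mulr_ge0 // ltW.
move=> x x0; have -> : step_fun (@sp_lo _ _ U) (@sp_hi _ _ U) c x =
    complex.Re (phi (star d * insert 1 (sp_at U x))).
  rewrite insert_at mulr_sumr phi_sum cRe_sum; apply: eq_bigr => z _.
  by rewrite mulr1.
case: ltP => xT.
  apply: le_trans (Re_le_cabs _) _; apply: le_trans (cabs_phi_mul tA _ _) _.
  by rewrite (nm_star tA) ler_pM ?nm_ge0 ?hx.
rewrite insert_at big_pred0 ?mulr0 ?phi0 ?normr0 // => z.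
by apply/negbTE; rewrite negb_and -leNgt -ltNge (le_trans (hT z)) ?orbT.
Qed.

Lemma sp_int_bound k U : (0 < k)%N -> additiveD D k -> sp_adapted U ->
  nm (sp_int k U) <= Num.sqrt (ka (k + k) * sp_energy U) +
    `|ka k| * nm (sp_drift U).
Proof.
by move=> k0 hD hU; apply: (integral_bound tA pX pD k0 hD) => z; have [] := hU z.
Qed.

Lemma sp_int_le k U T K : (0 < k)%N -> additiveD D k -> sp_adapted U ->
  0 <= T -> 0 <= K -> sp_within T U ->
  (forall x, 0 <= x -> x < T -> nm (insert (cpow 1 T (T + 1)) (sp_at U x)) <= K) ->
  (forall x, 0 <= x -> x < T -> nm (insert 1 (sp_at U x)) <= K) ->
  nm (sp_int k U) <= K * (Num.sqrt (`|ka (k + k)| * T) + `|ka k| * T).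
Proof.
move=> k0 hD hU T0 K0 hT h1 h2; apply: le_trans (sp_int_bound k0 hD hU) _.
rewrite mulrDr; apply: lerD; last first.
  rewrite [X in _ <= X]mulrCA ler_wpM2l //; exact: drift_le.
rewrite -{1}(ger0_norm K0) -sqrtr_sqr -sqrtrM ?sqr_ge0 //.
have en : sp_energy U <= K ^+ 2 * T.
  apply: energy_le => //; first exact: sqr_ge0.
  by move=> x x0 xT; rewrite ler_pXn2r ?nnegrE ?nm_ge0 // h1.
have en0 : 0 <= sp_energy U.
  rewrite -(energy_integral hU).2; apply: Rintegral_ge0 => x.
  rewrite /half_line /= in_itv /= andbT => x0; apply: (tensor_normsq_ge0 x0) => v.
  by case/(sp_at_mem hU).
apply: ler_wsqrtr; rewrite [X in _ <= X]mulrCA; apply: le_trans (ler_norm _) _.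
by rewrite normrM ler_wpM2l // ger0_norm.
Qed.

End StepProcesses.

(** * Additivity of the diagonal measures *)

Record grid (R : realType) (T h : R) (I : finType) (lo hi : I -> R) : Prop := {
  grid_ge0 : forall z, 0 <= lo z;
  grid_le : forall z, lo z <= hi z;
  grid_hi : forall z, hi z <= T;
  grid_mesh : forall z, hi z - lo z <= h;
  grid_cover : forall x, 0 <= x -> x < T -> exists z0, forall z, (lo z <= x < hi z) = (z == z0) }.

Section Grids.
Variable R : realType.
Implicit Types (a b x h : R) (N : nat).

Lemma monotone_cell (t : nat -> R) N x : (forall n, t n <= t n.+1) ->
  t 0%N <= x -> x < t N ->
  exists z0 : 'I_N, forall z : 'I_N, (t z <= x < t z.+1) = (z == z0).
Proof.
move=> tS t0 tN.
have tm n n' : (n <= n')%N -> t n <= t n'.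
  by move=> /subnKC <-; elim: (n' - n)%N => [|d IH]; rewrite ?addn0 // addnS (le_trans IH).
have ex : exists n, t n <= x by exists 0%N.
have bd n : t n <= x -> (n <= N)%N.
  by move=> h; rewrite leqNgt; apply/negP => /ltnW/tm h'; have := lt_le_trans tN (le_trans h' h); rewrite ltxx.
have [n0 h1 h2] := ex_maxnP ex bd.
have n0N : (n0 < N)%N.
  rewrite ltn_neqAle bd // andbT; apply/eqP => e; by move: h1; rewrite e leNgt tN.
exists (Ordinal n0N) => z; apply/idP/eqP => [/andP[zx xz]|->].
  apply/val_inj/anti_leq; rewrite /= h2 //= leqNgt; apply/negP => zn.
  by have := lt_le_trans xz (tm _ _ zn); rewrite ltNge h1.
by rewrite /= h1 ltNge; apply/negP => /h2; rewrite ltnn.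
Qed.

Lemma ptn_grid b N : 0 <= b -> (0 < N)%N ->
  @grid R b (b / N%:R) 'I_N (fun r => ptn 0 b N r) (fun r => ptn 0 b N r.+1).
Proof.
move=> b0 N0; split=> [z|z|z|z|x x0 xb].
- exact: ptn_ge.
- exact: ptn_le.
- by apply: ptn_leb.
- by rewrite ptn_step subr0.
- by apply: monotone_cell; rewrite ?ptn0 ?ptnn // => n; apply: ptn_le.
Qed.

(** The endpoints of the uniform partitions of [[0, a[] and [[a, b[], taken
    together; [g] selects the lower or the upper ones. *)
Definition ptn2 a b N (g : nat -> nat) (z : 'I_N + 'I_N) : R :=
  match z with inl r => ptn 0 a N (g r) | inr r => ptn a b N (g r) end.

Lemma ptn2_grid a b N : 0 <= a -> a <= b -> (0 < N)%N ->
  @grid R b (b / N%:R) ('I_N + 'I_N)%type (ptn2 a b id) (ptn2 a b S).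
Proof.
move=> a0 ab N0; have b0 := le_trans a0 ab.
have N0' : (0 : R) < N%:R by rewrite ltr0n.
split=> [[z|z]|[z|z]|[z|z]|[z|z]|x x0 xb] /=.
- exact: ptn_ge.
- exact: le_trans (ptn_ge _ _ ab).
- exact: ptn_le.
- exact: ptn_le.
- by apply: le_trans ab; apply: ptn_leb.
- by apply: ptn_leb.
- by rewrite ptn_step subr0 ler_pM2r ?invr_gt0.
- by rewrite ptn_step ler_pM2r ?invr_gt0 // lerBlDr lerDl.
have [xa|ax] := ltP x a.
  have [|||z0 hz] := @monotone_cell (ptn 0 a N) N x.
  - by move=> n; apply: ptn_le.
  - by rewrite ptn0.
  - by rewrite ptnn.
  exists (inl z0) => -[z|z] /=; first exact: hz.
  by apply/negbTE; rewrite negb_and -ltNge (lt_le_trans xa) // ptn_ge.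
have [|||z0 hz] := @monotone_cell (ptn a b N) N x.
- by move=> n; apply: ptn_le.
- by rewrite ptn0.
- by rewrite ptnn.
exists (inr z0) => -[z|z] /=; last exact: hz.
have za : ptn 0 a N z.+1 <= a by apply: ptn_leb.
by apply/negbTE; rewrite negb_and -!leNgt (le_trans za ax) orbT.
Qed.
End Grids.

Section Frozen.
Variables (R : realType) (A : algType R[i]) (star : A -> A) (phi : {scalar A}).
Hypothesis tA : tracial star phi.
Variables (F : R -> set A) (X : R -> R -> A) (m : nat -> R -> R) (ka : nat -> R).
Hypothesis pX : free_process star phi F X m ka.
Variable D : nat -> R -> R -> A.
Hypothesis pD : diagonal_measures star phi F X D.
Local Notation C := R[i].
Local Notation nm := (nm star phi).
Local Notation cpow := (cpow phi X).
Local Notation wact := (wact phi X).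
Local Notation wcoef := (wcoef phi X).
Local Notation riemann := (riemann phi X D).
Local Notation additive := (additiveD D).
Implicit Types (L : seq (C * (nat * seq nat))) (I J : finType) (T h : R).

Definition lact L s d : A := \sum_(q <- L) q.1 *: wact q.2 s d.

Definition frozen L I (lo hi : I -> R) : step_process R A :=
  @StepProcess R A (I * 'I_(size L))%type (fun z => lo z.1) (fun z => hi z.1)
    (fun z => let q := tnth (in_tuple L) z.2 in
       (q.1 * wcoef q.2 (lo z.1)) *: X 0 (lo z.1) ^+ q.2.1)
    (fun z => X 0 (lo z.1) ^+ last 0%N (tnth (in_tuple L) z.2).2.2).

Lemma frozen_adapted L T h I (lo hi : I -> R) : grid T h lo hi ->
  sp_adapted F (frozen L lo hi).
Proof.
move=> g [z r] /=; have z0 := grid_ge0 g z.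
have sF := fp_sub pX z0; have FX := XF pX z0 (lexx _).
split=> //; [exact: (grid_le g)| |exact: (subalgX sF)].
by apply: (subalgZ sF); apply: (subalgX sF).
Qed.

Lemma frozen_within L T h I (lo hi : I -> R) : grid T h lo hi ->
  sp_within T (frozen L lo hi).
Proof. by move=> g [z r]; apply: (grid_hi g). Qed.

Lemma lact_tnth L s d : lact L s d = \sum_(r < size L)
  (((tnth (in_tuple L) r).1 * wcoef (tnth (in_tuple L) r).2 s) *:
     X 0 s ^+ (tnth (in_tuple L) r).2.1) * d * X 0 s ^+ last 0%N (tnth (in_tuple L) r).2.2.
Proof.
rewrite /lact big_tnth; apply: eq_bigr => r _.
by rewrite wactE /Xl -scalerA -!scalerAl.
Qed.

Lemma insert_frozen L I (lo hi : I -> R) y x :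
  insert y (sp_at (frozen L lo hi) x) = \sum_(z | lo z <= x < hi z) lact L (lo z) y.
Proof.
rewrite insert_at; under [RHS]eq_bigr do rewrite lact_tnth.
by rewrite pair_big_dep /=; apply: eq_bigl => -[z r] /=; rewrite andbT.
Qed.

Lemma sp_int_frozen L k I (lo hi : I -> R) :
  sp_int D k (frozen L lo hi) = \sum_z lact L (lo z) (D k 0 (hi z) - D k 0 (lo z)).
Proof.
rewrite /sp_int; under [RHS]eq_bigr do rewrite lact_tnth.
by rewrite pair_big_dep /=; apply: eq_bigl => -[z r].
Qed.

Lemma insert_frozen_grid L T h I (lo hi : I -> R) x : grid T h lo hi ->
  0 <= x -> x < T -> exists s, [/\ 0 <= s, s <= x, x - s <= h &
    forall y, insert y (sp_at (frozen L lo hi) x) = lact L s y].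
Proof.
move=> g x0 xT; have [z0 hz] := grid_cover g x0 xT.
have /andP[h1 h2] : lo z0 <= x < hi z0 by rewrite hz.
exists (lo z0); split=> //; first exact: (grid_ge0 g).
  by have := grid_mesh g z0; lra.
by move=> y; rewrite insert_frozen (eq_bigl _ _ hz) big_pred1_eq.
Qed.

Section Horizon.
Variable T : R.
Hypothesis T0 : 0 <= T.
Let y := cpow 1 T (T + 1).
Let T1 : T <= T + 1. Proof. lra. Qed.

Lemma nm_cpow1 : nm y = 1.
Proof.
apply: (@pexpIrn _ 2); rewrite ?nnegrE ?nm_ge0 // expr1n.
by rewrite (nm_cpow_sqr tA pX) // addrAC subrr add0r (fp_variance pX).
Qed.

Lemma wact_hoelder p : exists2 K, 0 <= K & forall s t, 0 <= s -> s <= t -> t <= T ->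
  nm (wact p t 1 - wact p s 1) <= K * Num.sqrt (t - s) /\
  nm (wact p t y - wact p s y) <= K * Num.sqrt (t - s).
Proof.
have [M2 M20 hM2] := wact1_hoelder tA pX T p.
have [M4 M40 hM4] := scaled_power_hoelder tA pX T (inner p.2) p.1.
have [M5 M50 hM5] := scaled_power_bounded tA pX T (inner p.2) p.1.
have [M6 M60 hM6] := X_norm_bounded tA pX T (last 0%N p.2).
have [M7 M70 hM7] := X_hoelder tA pX T (last 0%N p.2).
exists (M2 + (M4 * M6 + M5 * M7)) => [|s t s0 st tT]; first by rewrite !addr_ge0 ?mulr_ge0.
have t0 := le_trans s0 st; have sT := le_trans st tT.
have S0 := sqrtr_ge0 (t - s).
have q : 0 <= M4 * M6 + M5 * M7 by rewrite addr_ge0 ?mulr_ge0.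
split.
  by apply: le_trans (hM2 _ _ s0 st tT) _; rewrite ler_wpM2r // lerDl.
have FT := fp_sub pX T0; have fr := fp_free pX T0 (lexx T) T1.
have yp : powers (X T (T + 1)) y by exact: cpow_powers.
have ys : star y = y by exact: (star_cpow tA pX).
have y0 : phi y = 0 by exact: (phi_cpow tA).
have FXt j : F T (X 0 t ^+ j) by apply: (subalgX FT); apply: (XF pX).
have FXs j : F T (X 0 s ^+ j) by apply: (subalgX FT); apply: (XF pX).
have -> : wact p t y - wact p s y =
   (Xl phi X p t - Xl phi X p s) * y * X 0 t ^+ last 0%N p.2 +
   Xl phi X p s * y * (X 0 t ^+ last 0%N p.2 - X 0 s ^+ last 0%N p.2).
  have tele (a a' b b' d : A) : a * d * b - a' * d * b' =
      (a - a') * d * b + a' * d * (b - b').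
    by rewrite !mulrBl mulrBr addrA subrK.
  by rewrite !wactE tele.
apply: le_trans (nmD tA _ _) _; rewrite !(nm_mul_free tA FT fr _ _ yp ys y0) ?nm_cpow1.
- rewrite !mulr1; apply: (@le_trans _ _ ((M4 * Num.sqrt (t - s)) * M6 +
     M5 * (M7 * Num.sqrt (t - s)))).
    by apply: lerD; rewrite ler_pM ?nm_ge0 ?hM6 ?hM5 ?hM7 // hM4.
  have -> : M4 * Num.sqrt (t - s) * M6 + M5 * (M7 * Num.sqrt (t - s)) =
     (M4 * M6 + M5 * M7) * Num.sqrt (t - s) by ring.
  by rewrite ler_wpM2r // lerDr.
- exact: (subalgZ FT).
- exact: (subalgB FT).
- by apply: (subalgB FT); apply: (subalgZ FT).
- exact: FXt.
Qed.

Lemma lact_hoelder L : exists2 K, 0 <= K & forall s t, 0 <= s -> s <= t -> t <= T ->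
  nm (lact L t 1 - lact L s 1) <= K * Num.sqrt (t - s) /\
  nm (lact L t y - lact L s y) <= K * Num.sqrt (t - s).
Proof.
elim: L => [|q L [K K0 hK]].
  by exists 0 => // s t _ _ _; rewrite /lact !big_nil subrr nm0 mul0r.
have [K' K'0 hK'] := wact_hoelder q.2.
exists (cabs q.1 * K' + K) => [|s t s0 st tT]; first by rewrite addr_ge0 ?mulr_ge0 ?cabs_ge0.
have [h1 h2] := hK s t s0 st tT; have [h3 h4] := hK' s t s0 st tT.
have E d : nm (wact q.2 t d - wact q.2 s d) <= K' * Num.sqrt (t - s) ->
    nm (lact L t d - lact L s d) <= K * Num.sqrt (t - s) ->
    nm (lact (q :: L) t d - lact (q :: L) s d) <= (cabs q.1 * K' + K) * Num.sqrt (t - s).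
  move=> e1 e2; rewrite /lact !big_cons opprD addrACA -scalerBr.
  apply: le_trans (nmD tA _ _) _; rewrite (nmZ tA) mulrDl -mulrA; apply: lerD => //.
  by rewrite ler_wpM2l ?cabs_ge0.
by split; apply: E.
Qed.

(** All the times [s] and [s'] at which two partitions freeze the integrand are
    within a mesh of the current time [x]. *)
Lemma lact_near L : exists2 K, 0 <= K & forall s s' x h, 0 <= s -> 0 <= s' ->
  s <= x -> s' <= x -> x <= T -> x - s <= h -> x - s' <= h ->
  nm (lact L s 1 - lact L s' 1) <= K * Num.sqrt h /\
  nm (lact L s y - lact L s' y) <= K * Num.sqrt h.
Proof.
have [K K0 hK] := lact_hoelder L; exists (K + K) => [|s s' x h]; first exact: addr_ge0.
move=> s0 s'0 sx s'x xT e e'.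
have [h1 h2] := hK s x s0 sx xT; have [h3 h4] := hK s' x s'0 s'x xT.
have S1 := ler_wpM2l K0 (ler_wsqrtr e); have S2 := ler_wpM2l K0 (ler_wsqrtr e').
have E d : lact L s d - lact L s' d = (lact L x d - lact L s' d) - (lact L x d - lact L s d).
  by rewrite opprB [RHS]addrC addrA subrK.
split; rewrite E; apply: le_trans (nmB tA _ _) _; rewrite mulrDl; apply: lerD;
  by [apply: le_trans S2|apply: le_trans S1].
Qed.

(** At each time both frozen biprocesses are close to the unfrozen one, hence to
    each other, and the bound on integrals applies to their difference. *)
Lemma frozen_close L k : (0 < k)%N -> additive k -> exists2 K, 0 <= K &
  forall I J (lo hi : I -> R) (lo' hi' : J -> R) h, grid T h lo hi -> grid T h lo' hi' ->
  nm (sp_int D k (frozen L lo hi) - sp_int D k (frozen L lo' hi')) <= K * Num.sqrt h.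
Proof.
move=> k0 hD; have [K K0 hK] := lact_near L.
exists (K * (Num.sqrt (`|ka (k + k)| * T) + `|ka k| * T)).
  by rewrite mulr_ge0 // addr_ge0 ?sqrtr_ge0 // mulr_ge0.
move=> I J lo hi lo' hi' h g g'; rewrite -sp_int_sub mulrAC.
have aU := frozen_adapted (L:=L) g; have aV := frozen_adapted (L:=L) g'.
apply: (sp_int_le tA pX pD k0 hD) => //.
- exact: (sp_sub_adapted pX).
- by rewrite mulr_ge0 ?sqrtr_ge0.
- by move=> [z|z]; [apply: (frozen_within (L:=L) g)|apply: (frozen_within (L:=L) g')].
- move=> x x0 xT; rewrite insert_at_sub.
  have [s [s0 sx xs ->]] := insert_frozen_grid L g x0 xT.
  have [s' [s'0 s'x xs' ->]] := insert_frozen_grid L g' x0 xT.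
  exact: (hK s s' x h s0 s'0 sx s'x (ltW xT) xs xs').2.
- move=> x x0 xT; rewrite insert_at_sub.
  have [s [s0 sx xs ->]] := insert_frozen_grid L g x0 xT.
  have [s' [s'0 s'x xs' ->]] := insert_frozen_grid L g' x0 xT.
  exact: (hK s s' x h s0 s'0 sx s'x (ltW xT) xs xs').1.
Qed.
End Horizon.

Lemma sp_int_ptn p k a b N : additive k -> 0 <= a -> a <= b ->
  \sum_(r < N) lact [:: (1, p)] (ptn a b N r) (D k 0 (ptn a b N r.+1) - D k 0 (ptn a b N r)) =
  riemann p k a b N.
Proof.
move=> hD a0 ab; apply: eq_bigr => r _; rewrite /lact big_seq1 scale1r hD //.
  exact: le_trans (ptn_ge _ _ ab).
exact: ptn_le.
Qed.

Lemma riemann_concat p k a b : (0 < k)%N -> additive k -> 0 <= a -> a <= b ->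
  exists2 K, 0 <= K & forall N, (0 < N)%N ->
  nm (riemann p k 0 b N - (riemann p k 0 a N + riemann p k a b N)) <= K * Num.sqrt N%:R^-1.
Proof.
move=> k0 hD a0 ab; have b0 := le_trans a0 ab.
have [K K0 hK] := frozen_close b0 [:: (1, p)] k0 hD.
exists (K * Num.sqrt b) => [|N N0]; first by rewrite mulr_ge0 ?sqrtr_ge0.
have := hK _ _ _ _ _ _ _ (ptn_grid b0 N0) (ptn2_grid a0 ab N0).
rewrite !sp_int_frozen big_sumType /= !sp_int_ptn //.
by rewrite sqrtrM // mulrA.
Qed.

Lemma riemann_top k a b N : (0 < k)%N -> 0 <= a -> a <= b -> (0 < N)%N ->
  \sum_(p <- comps k k) riemann p k a b N = D k a b.
Proof.
move=> k0 a0 ab N0; rewrite comps_nn big_seq1 -(D_ptn_sum tA pD k0 a0 ab N0).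
apply: eq_bigr => r _; rewrite wact_def /= expr0 mul1r.
have -> : last 0%N (nseq k 0%N) = 0%N by elim: (k) => //= n; case: n.
rewrite expr0 mulr1 wcoef_def big1_seq ?scale1r // => e /=.
suff h : e \in inner (nseq k 0%N) -> e = 0%N by move/h ->; rewrite expr0 (tr1 tA).
  case: k k0 {a0 ab} => //= n _ /mem_belast; rewrite -[_ :: _]/(nseq n.+1 0%N) mem_nseq.
  by case/andP=> _ /eqP.
Qed.

Lemma rate_sum (J : eqType) (s : seq J) (f : J -> nat -> A) (rho : nat -> R) :
  (forall j, j \in s -> exists2 K, 0 <= K & forall N, (0 < N)%N -> nm (f j N) <= K * rho N) ->
  exists2 K, 0 <= K & forall N, (0 < N)%N -> nm (\sum_(j <- s) f j N) <= K * rho N.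
Proof.
elim: s => [|j s IH] hf; first by exists 0 => // N _; rewrite big_nil nm0 mul0r.
have [|K K0 hK] := IH; first by move=> j' j's; apply: hf; rewrite inE j's orbT.
have [K' K'0 hK'] := hf j (mem_head _ _).
exists (K' + K) => [|N N0]; first exact: addr_ge0.
by rewrite big_cons mulrDl; apply: le_trans (nmD tA _ _) _; apply: lerD; auto.
Qed.

(** The diagonal measures are interval functions: in the expansion of
    [X ^ k] over [[0, a[], [[a, b[] and [[0, b[], the terms of order less than
    [k] add up, hence so does the last one, which is the diagonal measure. *)
Lemma D_additive k : (0 < k)%N -> additive k.
Proof.
elim/ltn_ind: k => -[//|k] IH _ a b a0 ab; have b0 := le_trans a0 ab.
pose def p j N := riemann p j 0 b N - (riemann p j 0 a N + riemann p j a b N).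
have [K1 K10 h1] : exists2 K, 0 <= K & forall N, (0 < N)%N ->
    nm (\sum_(j <- index_enum 'I_k) \sum_(p <- comps k.+1 j.+1) def p j.+1 N) <=
      K * Num.sqrt N%:R^-1.
  apply: rate_sum => j _; apply: rate_sum => p _.
  have hD : additive j.+1 by apply: IH => //; rewrite ltnS.
  exact: (riemann_concat p (ltn0Sn j) hD a0 ab).
have [K0 K00 h0] := ito_monomial tA pX pD b0 k.+1.
have E : D k.+1 0 b = D k.+1 0 a + D k.+1 a b.
  have K0' : 0 <= K0 + (K0 + K0) + K1 by rewrite !addr_ge0.
  apply: (nm_small_eq tA K0') => e e0 e1.
  pose N := (Num.Def.archi_bound (e ^- 2)).+1.
  have N0 : (0 < N)%N by [].
  have NE : Num.sqrt N%:R^-1 <= e.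
    rewrite -[e]ger0_norm ?(ltW e0) // -sqrtr_sqr.
    apply: ler_wsqrtr; rewrite -[e ^+ 2]invrK lef_pV2 ?posrE ?invr_gt0 ?exprn_gt0 ?ltr0n //.
    have := archi_boundP (ltW (_ : 0 < e ^- 2)); rewrite invr_gt0 exprn_gt0 // => /(_ isT).
    by move=> h; apply: le_trans (ltW h) _; rewrite ler_nat leqnSn.
  have q1 := h0 0 b N (lexx _) b0 (lexx _) N0.
  have q2 := h0 0 a N (lexx _) a0 ab N0.
  have q3 := h0 a b N a0 ab (lexx _) N0.
  have q4 := h1 N N0.
  (* The summand of order [k.+1] is the diagonal measure itself. *)
  have topE c d : 0 <= c -> c <= d -> \sum_(j < k.+1) \sum_(p <- comps k.+1 j.+1)
      riemann p j.+1 c d N = \sum_(j < k) \sum_(p <- comps k.+1 j.+1)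
      riemann p j.+1 c d N + D k.+1 c d.
    by move=> c0 cd; rewrite big_ord_recr; congr (_ + _); apply: riemann_top.
  rewrite !topE // in q1 q2 q3.
  set S1 := \sum_(j < k) _ in q1; set S2 := \sum_(j < k) _ in q2.
  set S3 := \sum_(j < k) _ in q3; set S4 := \sum_(j <- _) _ in q4.
  have S4E : S4 = S1 - (S2 + S3).
    rewrite /S4 /S1 /S2 /S3 -big_split -sumrB; apply: eq_bigr => j _.
    by rewrite -big_split -sumrB.
  apply: le_trans (ler_wpM2l K0' NE).
  set u := X 0 b ^+ k.+1 in q1 q3; set v := X 0 a ^+ k.+1 in q2 q3.
  set w := X 0 0 ^+ k.+1 in q1 q2.
  have -> : D k.+1 0 b - (D k.+1 0 a + D k.+1 a b) =
      (v - w - (S2 + D k.+1 0 a)) + (u - v - (S3 + D k.+1 a b)) -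
      (u - w - (S1 + D k.+1 0 b)) - S4.
    rewrite S4E.
    move: (D k.+1 0 b) (D k.+1 0 a) (D k.+1 a b) => x y z.
    have -> : v - w - (S2 + y) + (u - v - (S3 + z)) = (u - w) - ((S2 + S3) + (y + z)).
      by rewrite addrACA -opprD [v - w + _]addrC addrA subrK addrACA.
    have -> : u - w - (S2 + S3 + (y + z)) - (u - w - (S1 + x)) =
        S1 + x - (S2 + S3 + (y + z)).
      by rewrite opprB addrC addrA subrK.
    rewrite opprB [S2 + S3 - S1]addrC addrACA [S1 + x]addrC addrK.
    by congr (_ + _); rewrite [in RHS]opprD addrAC addNr add0r.
  rewrite !mulrDl; apply: le_trans (nmB tA _ _) _; apply: lerD => //.
  apply: le_trans (nmB tA _ _) _; rewrite [X in _ <= X]addrC; apply: lerD => //.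
  by apply: le_trans (nmD tA _ _) _; apply: lerD.
by rewrite E addrC addKr.
Qed.
End Frozen.

(** * Integrals in the completion *)

Lemma le_small (R : realType) (x y K : R) : 0 <= K ->
  (forall e, 0 < e -> e <= 1 -> x <= y + K * e) -> x <= y.
Proof.
move=> K0 h; rewrite leNgt; apply/negP => yx.
have d0 : 0 < x - y by rewrite subr_gt0.
have K1 : 0 < K + 1 by rewrite ltr_wpDl.
pose e := Num.min 1 ((x - y) / (2 * (K + 1))).
have e0 : 0 < e by rewrite lt_min ltr01 divr_gt0 // mulr_gt0.
have e1 : e <= 1 by rewrite ge_min lexx.
have e2 : e * (2 * (K + 1)) <= x - y.
  by rewrite -ler_pdivlMr ?mulr_gt0 // ge_min lexx orbT.
have := h e e0 e1; nra.
Qed.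

Section RealNorm.
Variables (R : realType) (L : normedModType R[i]).
Implicit Types (u v : L).

Definition nr v : R := complex.Re `|v|.

Lemma nrE v : `|v| = (nr v)%:C%C.
Proof. exact: (ge0_Re (normr_ge0 v)).1. Qed.
Lemma nr_ge0 v : 0 <= nr v.
Proof. exact: (ge0_Re (normr_ge0 v)).2. Qed.
Lemma nrD u v : nr (u + v) <= nr u + nr v.
Proof. by rewrite -RC_le RCD -!nrE ler_normD. Qed.
Lemma nrN v : nr (- v) = nr v.
Proof. by rewrite /nr normrN. Qed.
Lemma nrB u v : nr (u - v) <= nr u + nr v.
Proof. by rewrite -(nrN v) nrD. Qed.
Lemma nrBC u v : nr (u - v) = nr (v - u).
Proof. by rewrite /nr distrC. Qed.
Lemma nrZ (c : R[i]) v : nr (c *: v) = cabs c * nr v.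
Proof. by apply: (@complexI R); rewrite RCM -!nrE normrZ cabsE. Qed.
Lemma nr_le v (e : R) : (`|v| <= e%:C%C) = (nr v <= e).
Proof. by rewrite nrE RC_le. Qed.
Lemma nr_eq0 v : nr v = 0 -> v = 0.
Proof. by move=> h; apply/eqP; rewrite -normr_eq0 nrE h. Qed.
Lemma nr_dist u v : `|nr u - nr v| <= nr (u - v).
Proof.
have h1 := nrD (u - v) v; have h2 := nrD (v - u) u.
rewrite subrK in h1; rewrite subrK nrBC in h2.
by rewrite ler_norml; apply/andP; split; lra.
Qed.
End RealNorm.

Section Completion.
Variables (R : realType) (A : algType R[i]) (star : A -> A) (phi : {scalar A}).
Hypothesis tA : tracial star phi.
Local Notation C := R[i].
Local Notation nm := (nm star phi).
Variables (L2 : completeNormedModType R[i]) (E : A -> L2).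
Hypothesis EL : forall c a b, E (c *: a + b) = c *: E a + E b.
Hypothesis En : forall a, nr (E a) = nm a.
Hypothesis Ed : forall v (e : R), 0 < e -> exists a, nr (v - E a) <= e.
Implicit Types (a b : A) (u v w : L2).

Lemma ED a b : E (a + b) = E a + E b.
Proof. by have := EL 1 a b; rewrite !scale1r. Qed.
Lemma E0 : E 0 = 0.
Proof. by apply: nr_eq0; rewrite En nm0. Qed.
Lemma EZ c a : E (c *: a) = c *: E a.
Proof. by have := EL c a 0; rewrite E0 !addr0. Qed.
Lemma EN a : E (- a) = - E a.
Proof. by rewrite -scaleN1r EZ scaleN1r. Qed.
Lemma EB a b : E (a - b) = E a - E b.
Proof. by rewrite ED EN. Qed.
Lemma E_sum (K : Type) (r : seq K) (P : pred K) (f : K -> A) :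
  E (\sum_(z <- r | P z) f z) = \sum_(z <- r | P z) E (f z).
Proof. exact: (big_morph E ED E0). Qed.

(** The inner product with [E a], recovered from the norm by polarization. *)
Definition repair a v : R := (nr (v + E a) ^+ 2 - nr (v - E a) ^+ 2) / 4.
Definition pairing a v : C := Complex (repair a v) (- repair a ('i%C *: v)).

Lemma repairE a b : repair a (E b) = complex.Re (phi (star a * b)).
Proof.
rewrite /repair -ED -EB !En !(sqr_nmD tA) (nmN tA) mulrN phiN cReN.
have -> : star a * b = star (star b * a) by rewrite (starM tA) (starK tA).
by rewrite (phi_star tA) cReJ; field.
Qed.

Lemma pairingE a b : pairing a (E b) = phi (star a * b).
Proof.
rewrite /pairing -EZ !repairE -scalerAr phiZ cReM /= mul0r mul1r sub0r opprK.
by case: (phi _).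
Qed.

Lemma repair_lip a u v : `|repair a u - repair a v| <= nr (u - v) * (nr u + nr v + 2 * nm a).
Proof.
have sq w : `|nr (u + w) ^+ 2 - nr (v + w) ^+ 2| <= nr (u - v) * (nr u + nr v + 2 * nr w).
  rewrite subr_sqr normrM; apply: ler_pM => //.
    by apply: le_trans (nr_dist _ _) _; rewrite opprD addrACA subrr addr0.
  rewrite ger0_norm ?addr_ge0 ?nr_ge0 //.
  have := nrD u w; have := nrD v w; lra.
have h1 := sq (E a); have h2 := sq (- E a); rewrite nrN En in h1 h2 *.
have -> : repair a u - repair a v = ((nr (u + E a) ^+ 2 - nr (v + E a) ^+ 2) -
   (nr (u - E a) ^+ 2 - nr (v - E a) ^+ 2)) / 4 by rewrite /repair; field.
rewrite normrM [`|4^-1|]ger0_norm // ler_pdivrMr //.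
apply: le_trans (ler_normB _ _) _.
have := mulr_ge0 (nr_ge0 (u - v)) (addr_ge0 (addr_ge0 (nr_ge0 u) (nr_ge0 v))
  (mulr_ge0 (ler0n R 2) (nm_ge0 star phi a))).
move: h1 h2; lra.
Qed.

(** The formula for [pairing] on the dense subspace and its continuity; together
    they give linearity, which polarization does not show. *)
Lemma pairing_near a b v e : nr (v - E b) <= e ->
  cabs (pairing a v - phi (star a * b)) <= 2 * e * (2 * nr v + e + 2 * nm a).
Proof.
move=> h; have e0 := le_trans (nr_ge0 _) h; rewrite -pairingE.
have hb : nr (E b) <= nr v + e.
  by have := nrB v (v - E b); rewrite opprB addrC subrK; lra.
have n0 := nm_ge0 star phi a.
have le1 (x y : C) (M : R) : `|complex.Re (x - y)| <= M -> `|complex.Im (x - y)| <= M ->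
    cabs (x - y) <= 2 * M.
  move: (x - y) => z hr hi.
  have -> : z = (complex.Re z)%:C%C + 'i%C * (complex.Im z)%:C%C by exact: complexE.
  apply: le_trans (cabsD _ _) _; rewrite cabsM !cabs_real.
  have -> : cabs ('i%C : C) = 1 by rewrite /= expr0n expr1n add0r sqrtr1.
  by rewrite mul1r mulr2n mulrDl mul1r; apply: lerD.
have nr_i w : nr ('i%C *: w) = nr w.
  by rewrite nrZ /= expr0n expr1n add0r sqrtr1 mul1r.
rewrite -mulrA; apply: le1; rewrite !(cReD, cImD, cReN, cImN) /=.
  apply: le_trans (repair_lip _ _ _) _; apply: ler_pM => //.
  - exact: nr_ge0.
  - by rewrite !addr_ge0 ?mulr_ge0 ?nr_ge0.
  - lra.
rewrite -opprD normrN; apply: le_trans (repair_lip _ _ _) _.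
rewrite -scalerBr !nr_i; apply: ler_pM => //.
- exact: nr_ge0.
- by rewrite !addr_ge0 ?mulr_ge0 ?nr_ge0.
- lra.
Qed.

Lemma pairing_linear a : scalar (pairing a).
Proof.
move=> c u v /=; set w := c *: u + v.
have n0 := nm_ge0 star phi a; have c0 := cabs_ge0 c.
have w0 := nr_ge0 w; have u0 := nr_ge0 u; have v0 := nr_ge0 v.
pose c1 := cabs c + 1.
have c10 : 0 <= c1 by rewrite addr_ge0.
pose Kw := 2 * c1 * (2 * nr w + c1 + 2 * nm a).
pose Ku := 2 * (2 * nr u + 1 + 2 * nm a).
pose Kv := 2 * (2 * nr v + 1 + 2 * nm a).
have Kw0 : 0 <= Kw by rewrite !mulr_ge0 // !addr_ge0 ?mulr_ge0.
have Ku0 : 0 <= Ku by rewrite !mulr_ge0 // !addr_ge0 ?mulr_ge0.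
have Kv0 : 0 <= Kv by rewrite !mulr_ge0 // !addr_ge0 ?mulr_ge0.
have K0 : 0 <= Kw + (cabs c * Ku + Kv).
  by apply: addr_ge0 => //; apply: addr_ge0 => //; apply: mulr_ge0.
apply: (cabs_small_eq K0) => e e0 e1.
have [b hb] := Ed u e0; have [d hd] := Ed v e0.
have hw : nr (w - E (c *: b + d)) <= c1 * e.
  rewrite EL /w opprD addrACA -scalerBr; apply: le_trans (nrD _ _) _.
  by rewrite nrZ /c1 mulrDl mul1r; apply: lerD => //; rewrite ler_wpM2l.
have h1 := pairing_near a hw; have h2 := pairing_near a hb; have h3 := pairing_near a hd.
have -> : pairing a w - (c * pairing a u + pairing a v) =
   (pairing a w - phi (star a * (c *: b + d))) -
   (c * (pairing a u - phi (star a * b)) + (pairing a v - phi (star a * d))).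
  rewrite mulrDr -scalerAr phiD phiZ; ring.
apply: le_trans (cabsD _ _) _; rewrite cabsN mulrDl; apply: lerD.
  apply: le_trans h1 _; rewrite /Kw.
  have -> : 2 * (c1 * e) * (2 * nr w + c1 * e + 2 * nm a) =
     2 * c1 * (2 * nr w + c1 * e + 2 * nm a) * e by ring.
  rewrite ler_wpM2r ?(ltW e0) // ler_wpM2l ?mulr_ge0 // lerD2r lerD2l.
  by rewrite -[X in _ <= X]mulr1 ler_wpM2l.
apply: le_trans (cabsD _ _) _; rewrite cabsM mulrDl -mulrA; apply: lerD.
  rewrite ler_wpM2l //; apply: le_trans h2 _; rewrite /Ku.
  rewrite mulrAC ler_wpM2r ?(ltW e0) // ler_wpM2l // lerD2r lerD2l //.
apply: le_trans h3 _; rewrite /Kv.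
by rewrite mulrAC ler_wpM2r ?(ltW e0) // ler_wpM2l // lerD2r lerD2l.
Qed.
HB.instance Definition _ a :=
  GRing.isLinear.Build R[i] L2 R[i] *%R (pairing a) (pairing_linear a).

Lemma pairing_bounded a v : cabs (pairing a v) <= nm a * nr v.
Proof.
have n0 := nm_ge0 star phi a; have v0 := nr_ge0 v.
pose K := nm a + 2 * (2 * nr v + 1 + 2 * nm a).
have K0 : 0 <= K by rewrite /K !addr_ge0 ?mulr_ge0 ?addr_ge0 ?mulr_ge0.
apply: (le_small K0) => e e0 e1; have [b hb] := Ed v e0.
have h := pairing_near a hb.
have hn : nm b <= nr v + e.
  by rewrite -En; have := nrB v (v - E b); rewrite opprB addrC subrK; lra.
rewrite -[pairing a v](subrK (phi (star a * b))); apply: le_trans (cabsD _ _) _.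
have h2 : cabs (phi (star a * b)) <= nm a * (nr v + e).
  by apply: le_trans (cauchy_schwarz tA _ _) _; rewrite ler_wpM2l.
have h3 : 2 * e * (2 * nr v + e + 2 * nm a) <= 2 * (2 * nr v + 1 + 2 * nm a) * e.
  by rewrite mulrAC ler_wpM2r ?(ltW e0) // ler_wpM2l // lerD2r lerD2l.
by move: h h2 h3; rewrite /K !mulrDl !mulrDr; lra.
Qed.

(** If all functionals vanish at [v], then so does the pairing with an element
    close to [v], whose norm must therefore be small. *)
Lemma separation v : (forall f : {scalar L2},
  (exists M : C, forall w, `|f w| <= M * `|w|) -> f v = 0) -> v = 0.
Proof.
move=> h; apply: nr_eq0; apply/le_anti; rewrite nr_ge0 andbT.
apply: (@le_small _ _ _ 2) => // e e0 e1; rewrite add0r.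
have [b hb] := Ed v e0.
have pv : pairing b v = 0.
  apply: h; exists (nm b)%:C%C => w; rewrite [`|w|]nrE -RCM.
  by rewrite -[X in X <= _]/((cabs (pairing b w))%:C%C) RC_le; apply: pairing_bounded.
have : nm b ^+ 2 <= nm b * e.
  have -> : nm b ^+ 2 = cabs (pairing b (E b - v)).
    have -> : pairing b (E b - v) = pairing b (E b) - pairing b v by exact: linearB.
    rewrite pv subr0 pairingE (nmE tA) cabs_real ger0_norm //.
    exact: sqr_ge0.
  apply: le_trans (pairing_bounded _ _) _.
  by rewrite ler_wpM2l ?nm_ge0 // nrBC.
have [/eqP b0|b0] := boolP (nm b == 0).
  move=> _; have := nrD (v - E b) (E b); rewrite subrK En b0; lra.
rewrite expr2 ler_pM2l ?lt_def ?b0 ?nm_ge0 // => hbe.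
by have := nrD (v - E b) (E b); rewrite subrK En; lra.
Qed.
Local Notation leb := (@lebesgue_measure R).
Local Notation half := (@half_line R).
Implicit Types (g : R -> L2) (U : step_process R A).

Lemma vector_integral_unique g u v :
  is_vector_integral g u -> is_vector_integral g v -> u = v.
Proof.
move=> hu hv; apply/subr0_eq/separation => f bf.
have [_ _ u1 u2] := hu f bf; have [_ _ v1 v2] := hv f bf.
rewrite linearB; apply/eqP; rewrite subr_eq0; apply/eqP/complex_ext.
  by rewrite u1 v1.
by rewrite u2 v2.
Qed.

Lemma vector_integral_sub g g' u v : is_vector_integral g u -> is_vector_integral g' v ->
  is_vector_integral (fun x => g x - g' x) (u - v).
Proof.
move=> hu hv f bf; have [u1 u2 u3 u4] := hu f bf; have [v1 v2 v3 v4] := hv f bf.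
have mh := @half_measurable R.
have eR : (fun x => complex.Re (f (g x - g' x))) =
    (fun x => complex.Re (f (g x)) - complex.Re (f (g' x))).
  by apply/funext => x; rewrite linearB cReD cReN.
have eI : (fun x => complex.Im (f (g x - g' x))) =
    (fun x => complex.Im (f (g x)) - complex.Im (f (g' x))).
  by apply/funext => x; rewrite linearB cImD cImN.
split.
- rewrite -[X in _.-integrable _ X]/(EFin \o (fun x => complex.Re (f (g x - g' x)))) eR.
  exact: (integrableB mh u1 v1).
- rewrite -[X in _.-integrable _ X]/(EFin \o (fun x => complex.Im (f (g x - g' x)))) eI.
  exact: (integrableB mh u2 v2).
- by rewrite linearB cReD cReN u3 v3 eR RintegralB.
- by rewrite linearB cImD cImN u4 v4 eI RintegralB.
Qed.

Lemma vector_integral_step U :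
  (forall z : sp_index U, 0 <= sp_lo z) -> (forall z : sp_index U, sp_lo z <= sp_hi z) ->
  is_vector_integral (fun x => E (insert 1 (sp_at U x))) (E (sp_drift U)).
Proof.
move=> lo0 lohi f bf.
pose c (z : sp_index U) := f (E (sp_left z * sp_right z)).
have fE x : f (E (insert 1 (sp_at U x))) = \sum_(z : sp_index U | sp_lo z <= x < sp_hi z) c z.
  rewrite insert_at E_sum linear_sum; apply: eq_bigr => z _.
  by rewrite mulr1.
have dE : f (E (sp_drift U)) = \sum_z (sp_hi z - sp_lo z)%:C%C * c z.
  by rewrite E_sum linear_sum; apply: eq_bigr => z _; rewrite EZ linearZ.
have [i1 i2] := step_integral (fun z => complex.Re (c z)) lo0 lohi.
have [i3 i4] := step_integral (fun z => complex.Im (c z)) lo0 lohi.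
have eR : (fun x => complex.Re (f (E (insert 1 (sp_at U x))))) =
    step_fun (@sp_lo _ _ U) (@sp_hi _ _ U) (fun z => complex.Re (c z)).
  by apply/funext => x; rewrite fE cRe_sum.
have eI : (fun x => complex.Im (f (E (insert 1 (sp_at U x))))) =
    step_fun (@sp_lo _ _ U) (@sp_hi _ _ U) (fun z => complex.Im (c z)).
  by apply/funext => x; rewrite fE cIm_sum.
split.
- by rewrite -[X in _.-integrable _ X]/(EFin \o (fun x => complex.Re (f (E (insert 1 (sp_at U x)))))) eR.
- by rewrite -[X in _.-integrable _ X]/(EFin \o (fun x => complex.Im (f (E (insert 1 (sp_at U x)))))) eI.
- rewrite eR i2 dE cRe_sum; apply: eq_bigr => z _.
  by rewrite cReM /= mul0r subr0 mulrC.
- rewrite eI i4 dE cIm_sum; apply: eq_bigr => z _.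
  by rewrite cImM /= mul0r addr0 mulrC.
Qed.

Lemma real_limit (T : R) (psi_ : nat -> R -> R) (psi : R -> R) (a_ d_ : nat -> R) (a : R) :
  0 <= T -> (forall n, 0 <= d_ n) ->
  (forall n, leb.-integrable half (EFin \o psi_ n)) ->
  (forall n, \int[leb]_(x in half) psi_ n x = a_ n) ->
  (forall n x, 0 <= x -> `|psi_ n x - psi x| <= if x < T then d_ n else 0) ->
  (forall e, 0 < e -> exists N, forall n, (N <= n)%N -> d_ n <= e /\ `|a_ n - a| <= e) ->
  leb.-integrable half (EFin \o psi) /\ a = \int[leb]_(x in half) psi x.
Proof.
move=> T0 d0 ip ia hp he; have mh := @half_measurable R.
have mp n : measurable_fun half (psi_ n).
  by apply/measurable_EFinP; exact: (measurable_int leb).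
have mpsi : measurable_fun half psi.
  apply: (measurable_fun_cvg (h := psi_)) => // x.
  rewrite /half_line /= in_itv /= andbT => x0; apply/cvgrPdist_le => e e0.
  have [N hN] := he e e0; exists N => // n nN; rewrite distrC.
  apply: le_trans (hp n x x0) _; case: ifP => _; last exact: ltW.
  exact: (hN n nN).1.
have hb n : leb.-integrable half (EFin \o (fun x => psi_ n x - psi x)) /\
   `|\int[leb]_(x in half) (psi_ n x - psi x)| <= d_ n * T.
  apply: bounded_integrable => //; first exact: measurable_funB.
  by move=> x; apply: hp.
have ipsi : leb.-integrable half (EFin \o psi).
  have := integrableB mh (ip 0%N) (hb 0%N).1.
  apply: eq_integrable => // x _ /=; rewrite -EFinB; congr EFin.
  by rewrite opprB addrC subrK.
split=> //; apply/eqP; rewrite -subr_eq0 -normr_le0.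
have K0 : 0 <= 1 + T by rewrite addr_ge0.
apply: (le_small K0) => e e0 e1; rewrite add0r.
have [N /(_ N (leqnn N))[h1 h2]] := he e e0.
have := (hb N).2; rewrite RintegralB // ia => h3.
have -> : a - \int[leb]_(x in half) psi x = (a_ N - \int[leb]_(x in half) psi x) - (a_ N - a).
  by rewrite opprB [RHS]addrC addrA subrK.
apply: le_trans (ler_normB _ _) _; have := ler_wpM2r T0 h1; lra.
Qed.

(** Each functional reduces to the case of real functions.  As all the functions
    are carried by a bounded interval, uniform closeness controls the integrals. *)
Lemma vector_integral_limit (T : R) (g_ : nat -> R -> L2) g (u_ : nat -> L2) u
    (d_ : nat -> R) : 0 <= T -> (forall n, 0 <= d_ n) ->
  (forall n, is_vector_integral (g_ n) (u_ n)) ->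
  (forall n x, 0 <= x -> nr (g_ n x - g x) <= if x < T then d_ n else 0) ->
  (forall e, 0 < e -> exists N, forall n, (N <= n)%N -> d_ n <= e /\ nr (u_ n - u) <= e) ->
  is_vector_integral g u.
Proof.
move=> T0 d0 hg hd he f bf; have [M hM] := bf.
have K0 := cabs_ge0 M; have fb v : cabs (f v) <= cabs M * nr v.
  rewrite -RC_le RCM -nrE -[(cabs (f v))%:C%C]/(`|f v|) -[(cabs M)%:C%C]/(`|M|).
  rewrite -[X in _ * X]normr_id -normrM ger0_norm //.
  exact: le_trans (normr_ge0 _) (hM v).
have key (h : R[i] -> R) : (forall z w : R[i], h (z - w) = h z - h w) ->
    (forall z : R[i], `|h z| <= cabs z) ->
    (forall n, leb.-integrable half (EFin \o (fun x => h (f (g_ n x))))) ->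
    (forall n, h (f (u_ n)) = \int[leb]_(x in half) h (f (g_ n x))) ->
    leb.-integrable half (EFin \o (fun x => h (f (g x)))) /\
    h (f u) = \int[leb]_(x in half) h (f (g x)).
  move=> hB hle hi he'.
  have hf v w e : nr (v - w) <= e -> `|h (f v) - h (f w)| <= cabs M * e.
    move=> vw; rewrite -hB -linearB; apply: le_trans (hle _) _.
    by apply: le_trans (fb _) _; rewrite ler_wpM2l.
  apply: (@real_limit T (fun n x => h (f (g_ n x))) _ (fun n => h (f (u_ n)))
     (fun n => cabs M * d_ n)) => //.
  - by move=> n; rewrite mulr_ge0.
  - move=> n x x0; have := hf _ _ _ (hd n x x0).
    by case: ifP => // _; rewrite mulr0.
  - move=> e e0; have e'0 : 0 < e / (cabs M + 1) by rewrite divr_gt0 // ltr_wpDl.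
    have [N hN] := he _ e'0; exists N => n nN; have [h1 h2] := hN n nN.
    have q : cabs M * (e / (cabs M + 1)) <= e.
      by rewrite mulrCA -[X in _ <= X]mulr1 ler_pM2l // ler_pdivrMr ?mul1r ?lerDl // ltr_wpDl.
    split; last by apply: le_trans (hf _ _ _ h2) q.
    by apply: le_trans q; rewrite ler_wpM2l.
have [r1 r2] : leb.-integrable half (EFin \o (fun x => complex.Re (f (g x)))) /\
    complex.Re (f u) = \int[leb]_(x in half) complex.Re (f (g x)).
  apply: key => [z w|z|n|n]; first by rewrite cReD cReN.
  - exact: Re_le_cabs.
  - by have [] := hg n f bf.
  - by have [] := hg n f bf.
have [i1 i2] : leb.-integrable half (EFin \o (fun x => complex.Im (f (g x)))) /\
    complex.Im (f u) = \int[leb]_(x in half) complex.Im (f (g x)).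
  apply: key => [z w|z|n|n]; first by rewrite cImD cImN.
  - exact: Im_le_cabs.
  - by have [] := hg n f bf.
  - by have [] := hg n f bf.
by split.
Qed.

End Completion.

(** * Approximation on uniform partitions *)

Section Approximation.
Variables (R : realType) (A : algType R[i]) (star : A -> A) (phi : {scalar A}).
Hypothesis tA : tracial star phi.
Variables (F : R -> set A) (X : R -> R -> A) (m : nat -> R -> R) (ka : nat -> R).
Hypothesis pX : free_process star phi F X m ka.
Variable D : nat -> R -> R -> A.
Hypothesis pD : diagonal_measures star phi F X D.
Variables (L2 : completeNormedModType R[i]) (E : A -> L2).
Hypothesis EL : forall c a b, E (c *: a + b) = c *: E a + E b.
Hypothesis En : forall a, nr (E a) = nm star phi a.
Hypothesis Ed : forall v (e : R), 0 < e -> exists a, nr (v - E a) <= e.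
Local Notation C := R[i].
Local Notation nm := (nm star phi).
Local Notation cpow := (cpow phi X).
Local Notation lact := (lact phi X).
Local Notation normsq := (tensor_normsq star phi).
Local Notation leb := (@lebesgue_measure R).
Local Notation half := (@half_line R).
Implicit Types (U : step_process R A).

(** The integrand [w] is carried by [[0, t[], where it acts as the combination
    [L] of words; [w] itself may be any list of tensors with this action. *)
Variables (t : R) (L : seq (C * (nat * seq nat))) (w : R -> seq (C * (A * A))).
Hypothesis t0 : 0 <= t.
Hypothesis wF : forall x, 0 <= x -> forall v, v \in w x -> F x v.2.1 /\ F x v.2.2.
Hypothesis w_in : forall x, 0 <= x -> x < t -> forall y, insert y (w x) = lact L x y.
Hypothesis w_out : forall x, t <= x -> w x = [::].

Definition tsub (u v : seq (C * (A * A))) : seq (C * (A * A)) :=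
  u ++ [seq (-1 * z.1, z.2) | z <- v].

Definition sp_dist U x : R := normsq (tsub (sp_at U x) (w x)).

Definition sp_approximates (U_ : nat -> step_process R A) : Prop :=
  [/\ forall n, sp_adapted F (U_ n),
      forall n, measurable_fun half (sp_dist (U_ n)),
      (fun n => \int[leb]_(x in half) (sp_dist (U_ n) x)%:E)%E @ \oo --> 0%E &
      exists Y : nat -> L2,
        (forall n, is_vector_integral
           (fun x => E (insert 1 (tsub (sp_at (U_ n) x) (w x)))) (Y n)) /\
        Y @ \oo --> 0].

Lemma insert_tsub y u v : insert y (tsub u v) = insert y u - insert y v.
Proof. by rewrite /tsub insert_cat insert_scale scaleN1r. Qed.

Lemma tsub_mem u v x : (forall z, z \in u -> F x z.2.1 /\ F x z.2.2) ->
  (forall z, z \in v -> F x z.2.1 /\ F x z.2.2) ->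
  forall z, z \in tsub u v -> F x z.2.1 /\ F x z.2.2.
Proof.
move=> hu hv z; rewrite mem_cat => /orP[/hu//|/mapP[z' zv ->]].
exact: hv z' zv.
Qed.

Lemma tsub_at_mem U x : sp_adapted F U -> 0 <= x ->
  forall z, z \in tsub (sp_at U x) (w x) -> F x z.2.1 /\ F x z.2.2.
Proof.
move=> hU x0; apply: tsub_mem; last exact: wF.
by move=> z /(sp_at_mem pX hU)[].
Qed.

Lemma sp_distE U x s : sp_adapted F U -> 0 <= x -> x <= s ->
  sp_dist U x = nm (insert (cpow 1 s (s + 1)) (sp_at U x) -
                    insert (cpow 1 s (s + 1)) (w x)) ^+ 2.
Proof.
move=> hU x0 xs; rewrite -insert_tsub /sp_dist (tensor_normsqE tA pX (le_trans x0 xs)) //.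
by move=> z /(tsub_at_mem hU x0)[z1 z2]; split; apply: (fp_incr pX x0 xs).
Qed.

Lemma sp_dist_ge0 U x : sp_adapted F U -> 0 <= x -> 0 <= sp_dist U x.
Proof. by move=> hU x0; rewrite (sp_distE hU x0 (lexx x)) sqr_ge0. Qed.

Lemma normsq_sub_le U V x : sp_adapted F U -> sp_adapted F V -> 0 <= x ->
  normsq (sp_at (sp_sub U V) x) <= 2 * sp_dist U x + 2 * sp_dist V x.
Proof.
move=> hU hV x0; have hUV := sp_sub_adapted pX hU hV.
rewrite (tensor_normsqE tA pX x0); last by move=> z /(sp_at_mem pX hUV)[].
rewrite insert_at_sub !(sp_distE _ x0 (lexx x)) //.
set y := cpow 1 x (x + 1).
set a := insert y (sp_at U x); set b := insert y (sp_at V x); set c := insert y (w x).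
have -> : a - b = (a - c) - (b - c) by rewrite opprB addrA subrK.
have h := nmB tA (a - c) (b - c).
have := nm_ge0 star phi (a - c - (b - c)).
have := nm_ge0 star phi (a - c); have := nm_ge0 star phi (b - c).
move: (nm (a - c)) (nm (b - c)) (nm _) h => p q r h q0 p0 r0.
have := sqr_ge0 (p - q); nra.
Qed.

Definition uniform N : step_process R A :=
  frozen phi X L (fun z : 'I_N.+1 => ptn 0 t N.+1 z) (fun z : 'I_N.+1 => ptn 0 t N.+1 z.+1).

Let ug N := ptn_grid t0 (ltn0Sn N).

Lemma uniform_adapted N : sp_adapted F (uniform N).
Proof. exact: (frozen_adapted pX (ug N)). Qed.

Arguments uniform_adapted : clear implicits.

Lemma uniform_within N : sp_within t (uniform N).
Proof. exact: (frozen_within (ug N)). Qed.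

Arguments uniform_within : clear implicits.

Lemma at_out U x : sp_within t U -> t <= x -> forall y, insert y (sp_at U x) = 0.
Proof.
move=> hU tx y; rewrite insert_at big_pred0 // => z.
by apply/negbTE; rewrite negb_and -leNgt -ltNge (le_trans (hU z)) ?orbT.
Qed.

Definition mesh N : R := t / N.+1%:R.

Lemma mesh_small K e : 0 <= K -> 0 < e -> exists N0, forall N, (N0 <= N)%N ->
  K * Num.sqrt (mesh N) <= e.
Proof.
move=> K0 e0; pose B := (K ^+ 2 * t) / e ^+ 2.
have B0 : 0 <= B by apply: divr_ge0; rewrite ?sqr_ge0 ?mulr_ge0 ?sqr_ge0.
exists (Num.Def.archi_bound B) => N hN.
have N0 : (0 : R) < N.+1%:R by rewrite ltr0n.
rewrite -[K]ger0_norm // -sqrtr_sqr -sqrtrM ?sqr_ge0 // -[e]ger0_norm ?(ltW e0) //.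
rewrite -[`|e|]sqrtr_sqr; apply: ler_wsqrtr; rewrite /mesh mulrA ler_pdivrMr //.
rewrite [_ ^+ 2 * N.+1%:R]mulrC -ler_pdivrMr ?exprn_gt0 //; apply: le_trans (ltW (archi_boundP B0)) _.
by rewrite ler_nat (leq_trans hN).
Qed.

Lemma uniform_near : exists2 K, 0 <= K & forall N x, 0 <= x -> x < t ->
  nm (insert 1 (sp_at (uniform N) x) - insert 1 (w x)) <= K * Num.sqrt (mesh N) /\
  nm (insert (cpow 1 t (t + 1)) (sp_at (uniform N) x) - insert (cpow 1 t (t + 1)) (w x))
    <= K * Num.sqrt (mesh N).
Proof.
have [K K0 hK] := lact_near tA pX t0 L; exists K => // N x x0 xt.
have [s [s0 sx xs hs]] := insert_frozen_grid phi X L (ug N) x0 xt.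
rewrite /uniform !hs !w_in //.
apply: (hK s x x (mesh N) s0 x0 sx (lexx x) (ltW xt) xs).
by rewrite subrr divr_ge0.
Qed.

Lemma uniform_dist_bound : exists2 K, 0 <= K & forall N x, 0 <= x ->
  `|sp_dist (uniform N) x| <= if x < t then K * mesh N else 0.
Proof.
have [K K0 hK] := uniform_near; exists (K ^+ 2) => [|N x x0]; first exact: sqr_ge0.
rewrite ger0_norm ?sp_dist_ge0 //; last exact: uniform_adapted.
case: ltP => xt.
  rewrite (sp_distE (uniform_adapted N) x0 (ltW xt)).
  have [_ h] := hK N x x0 xt.
  have m0 : 0 <= mesh N by rewrite divr_ge0.
  rewrite -[mesh N]sqr_sqrtr // -exprMn ler_pXn2r ?nnegrE ?nm_ge0 //.
  by rewrite mulr_ge0 ?sqrtr_ge0.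
rewrite (sp_distE (uniform_adapted N) x0 (lexx x)).
by rewrite (at_out (uniform_within N) xt) w_out // /insert big_nil subrr nm0 expr0n.
Qed.

(** The distance to [w] is the pointwise limit of the distances to the frozen
    biprocesses, which are step functions. *)
Lemma uniform_dist_measurable N : measurable_fun half (sp_dist (uniform N)).
Proof.
apply: (measurable_fun_cvg (h := fun M => fun x => normsq (sp_at (sp_sub (uniform N) (uniform M)) x))).
  move=> M; have h := sp_sub_adapted pX (uniform_adapted N) (uniform_adapted M).
  have [i1 _] := energy_integral star phi h.
  by apply/measurable_EFinP; exact: (measurable_int leb).
move=> x; rewrite /half_line /= in_itv /= andbT => x0.
have hU := uniform_adapted N.
have hUM M := sp_sub_adapted pX (uniform_adapted N) (uniform_adapted M).
case: (ltP x t) => xt; last first.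
  have -> : (fun M => normsq (sp_at (sp_sub (uniform N) (uniform M)) x)) = fun=> 0.
    apply/funext => M; rewrite (tensor_normsqE tA pX x0).
      by rewrite insert_at_sub !(at_out (uniform_within _) xt) subrr nm0 expr0n.
    by move=> z /(sp_at_mem pX (hUM M))[].
  have -> : sp_dist (uniform N) x = 0; last exact: cvg_cst.
  rewrite (sp_distE hU x0 (lexx x)).
  by rewrite (at_out (uniform_within N) xt) w_out // /insert big_nil subrr nm0 expr0n.
rewrite (sp_distE hU x0 (ltW xt)); set y := cpow 1 t (t + 1).
have -> : (fun M => normsq (sp_at (sp_sub (uniform N) (uniform M)) x)) =
    (fun M => nm (insert y (sp_at (uniform N) x) - insert y (sp_at (uniform M) x)) ^+ 2).
  apply/funext => M; rewrite -insert_at_sub; apply: (tensor_normsqE tA pX t0) => z.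
  by case/(sp_at_mem pX (hUM M)) => _ [z1 z2]; split; apply: (fp_incr pX x0 (ltW xt)).
rewrite expr2; under eq_fun do rewrite expr2.
have cv : nm (insert y (sp_at (uniform N) x) - insert y (sp_at (uniform M) x)) @[M --> \oo] -->
   nm (insert y (sp_at (uniform N) x) - insert y (w x)); last exact: (cvgM cv cv).
have [K K0 hK] := uniform_near; apply/cvgrPdist_le => e e0.
have [N0 hN0] := mesh_small K0 e0; exists N0 => // M /= NM.
have [_ h] := hK M x x0 xt; apply: le_trans (hN0 M NM); apply: le_trans h.
set a := insert y _; set b := insert y (w x); set c := insert y _.
have h1 := nmD tA (a - c) (c - b); have h2 := nmD tA (a - b) (b - c).
rewrite !addrA !subrK in h1 h2; rewrite [nm (b - c)](nmBC tA) in h2.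
by rewrite ler_norml; apply/andP; split; lra.
Qed.

Lemma uniform_dist_small e : 0 < e -> exists N0, forall N, (N0 <= N)%N ->
  leb.-integrable half (EFin \o sp_dist (uniform N)) /\
  \int[leb]_(x in half) sp_dist (uniform N) x <= e.
Proof.
move=> e0; have [K K0 hK] := uniform_dist_bound.
have Kt0 : 0 <= K * t * t by rewrite !mulr_ge0.
exists (Num.Def.archi_bound (K * t * t / e)) => N hN.
have m0 : 0 <= mesh N by rewrite divr_ge0.
have [h1 h2] := bounded_integrable t0 (mulr_ge0 K0 m0) (uniform_dist_measurable N) (hK N).
split=> //; apply: le_trans (ler_norm _) (le_trans h2 _).
have -> : K * mesh N * t = K * t * t / N.+1%:R by rewrite /mesh; ring.
rewrite ler_pdivrMr ?ltr0n // [e * _]mulrC -ler_pdivrMr //.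
have q : 0 <= K * t * t / e by rewrite divr_ge0 // ltW.
apply: le_trans (ltW (archi_boundP q)) _.
by rewrite ler_nat (leq_trans hN).
Qed.

Lemma E_cauchy (z : nat -> A) : (exists2 K, 0 <= K & forall N M,
    (N <= M)%N -> nm (z N - z M) <= K * Num.sqrt (mesh N)) ->
  exists v : L2, forall e, 0 < e -> exists N0, forall N, (N0 <= N)%N -> nr (E (z N) - v) <= e.
Proof.
move=> [K K0 hK].
have [|v hv] := @cauchy_limit R L2 (fun N => E (z N)).
  move=> e e0; have [N0 hN0] := mesh_small K0 e0; exists N0 => n n' hn hn'.
  rewrite nr_le -(EB EL En) En.
  have [nn|/ltnW nn] := leqP n n'; first exact: le_trans (hK _ _ nn) (hN0 _ hn).
  by rewrite (nmBC tA); apply: le_trans (hK _ _ nn) (hN0 _ hn').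
exists v => e e0; have [N0 hN0] := (cvg_complexP _ _).1 hv e e0.
by exists N0 => N hN; rewrite -nr_le; apply: hN0.
Qed.

Lemma mesh_le N M : (N <= M)%N -> mesh M <= mesh N.
Proof.
by move=> NM; rewrite ler_wpM2l // lef_pV2 ?posrE ?ltr0n // ler_nat.
Qed.

Lemma grid_weaken h h' (I : finType) (lo hi : I -> R) : h <= h' ->
  grid t h lo hi -> grid t h' lo hi.
Proof.
by move=> hh [g1 g2 g3 g4 g5]; split=> // z; apply: le_trans hh.
Qed.

Lemma uniform_int_limit k : (0 < k)%N -> exists v : L2, forall e, 0 < e ->
  exists N0, forall N, (N0 <= N)%N -> nr (E (sp_int D k (uniform N)) - v) <= e.
Proof.
move=> k0; apply: E_cauchy.
have [K K0 hK] := frozen_close tA pX pD t0 L k0 (D_additive tA pX pD k0).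
exists K => // N M NM; apply: hK; first exact: ug.
exact: grid_weaken (mesh_le NM) (ug M).
Qed.

(** The drifts of the frozen biprocesses converge to the integral of the drift
    of [w]; this is how the latter is seen to exist. *)
Lemma uniform_drift_limit : exists v : L2,
  (forall e, 0 < e -> exists N0, forall N, (N0 <= N)%N ->
     nr (E (sp_drift (uniform N)) - v) <= e) /\
  is_vector_integral (fun x => E (insert 1 (w x))) v.
Proof.
have [K K0 hK] := uniform_near.
have [|v hv] := E_cauchy (z := fun N => sp_drift (uniform N)).
  exists ((K + K) * t) => [|N M NM]; first by rewrite mulr_ge0 ?addr_ge0.
  rewrite -sp_drift_sub mulrAC.
  have hNM := sp_sub_adapted pX (uniform_adapted N) (uniform_adapted M).
  apply: (drift_le tA hNM t0).
  - by rewrite mulr_ge0 ?addr_ge0 ?sqrtr_ge0.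
  - by move=> [z|z]; apply: uniform_within.
  move=> x x0 xt; rewrite insert_at_sub.
  have [h1 _] := hK N x x0 xt; have [h2 _] := hK M x x0 xt.
  set a := insert 1 _; set b := insert 1 _; set c := insert 1 (w x) in h1 h2.
  have -> : a - b = (a - c) - (b - c) by rewrite opprB addrA subrK.
  apply: le_trans (nmB tA _ _) _; rewrite mulrDl; apply: lerD => //.
  by apply: le_trans h2 _; rewrite ler_wpM2l // ler_wsqrtr // mesh_le.
exists v; split=> //.
apply: (vector_integral_limit (T := t)
   (g_ := fun N x => E (insert 1 (sp_at (uniform N) x)))
   (u_ := fun N => E (sp_drift (uniform N)))
   (d_ := fun N => K * Num.sqrt (mesh N))) => //.
- by move=> N; rewrite mulr_ge0 ?sqrtr_ge0.
- by move=> N; apply: (vector_integral_step EL En) => z; have [] := uniform_adapted N z.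
- move=> N x x0; rewrite -(EB EL En) En; case: ltP => xt; first exact: (hK N x x0 xt).1.
  by rewrite (at_out (uniform_within N) xt) w_out // /insert big_nil subrr nm0.
- move=> e e0; have [N1 h1] := mesh_small K0 e0; have [N2 h2] := hv e e0.
  exists (maxn N1 N2) => N; rewrite geq_max => /andP[n1 n2].
  by split; [apply: h1|apply: h2].
Qed.

Lemma cvg0_nr (Y : nat -> L2) : Y @ \oo --> 0 <->
  forall e, 0 < e -> exists N0, forall N, (N0 <= N)%N -> nr (Y N) <= e.
Proof.
split=> [/cvg_complexP h e e0|h].
  have [N0 hN] := h e e0; exists N0 => N NN.
  by have := hN N NN; rewrite subr0 nr_le.
apply/cvg_complexP => e e0; have [N0 hN] := h e e0; exists N0 => N NN.
by rewrite subr0 nr_le; apply: hN.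
Qed.

Lemma uniform_approximates : sp_approximates uniform.
Proof.
split; [exact: uniform_adapted|exact: uniform_dist_measurable| |].
  apply/fine_cvgP; split.
    have [N0 hN0] := uniform_dist_small ltr01; exists N0 => // N /= NN.
    exact: (integrable_fin_num (@half_measurable R) (hN0 N NN).1).
  apply/cvgrPdist_le => e e0; have [N0 hN0] := uniform_dist_small e0.
  exists N0 => // N /= NN; rewrite distrC subr0 ger0_norm; first exact: (hN0 N NN).2.
  apply: Rintegral_ge0 => x; rewrite /half_line /= in_itv /= andbT => x0.
  exact: sp_dist_ge0 (uniform_adapted N) x0.
have [v [hv vv]] := uniform_drift_limit.
exists (fun N => E (sp_drift (uniform N)) - v); split; last exact/cvg0_nr.
move=> N; have -> : (fun x => E (insert 1 (tsub (sp_at (uniform N) x) (w x)))) =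
   (fun x => E (insert 1 (sp_at (uniform N) x)) - E (insert 1 (w x))).
  by apply/funext => x; rewrite insert_tsub (EB EL En).
apply: vector_integral_sub => //.
by apply: (vector_integral_step EL En) => z; have [] := uniform_adapted N z.
Qed.
(** Energy and drift of the difference of two approximating sequences tend to
    zero, so that their integrals have the same limit.  The drift of the
    difference is identified as an integral in the completion. *)
Lemma approximation_limit k (U_ : nat -> step_process R A) v : (0 < k)%N ->
  sp_approximates U_ ->
  (forall e, 0 < e -> exists N0, forall N, (N0 <= N)%N ->
     nr (E (sp_int D k (uniform N)) - v) <= e) ->
  forall e, 0 < e -> exists N0, forall N, (N0 <= N)%N -> nr (E (sp_int D k (U_ N)) - v) <= e.
Proof.
move=> k0 [aU mU iU [Y [hY Y0]]] hv e e0.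
have [_ _ _ [Y' [hY' Y'0]]] := uniform_approximates.
have mh := @half_measurable R.
have half_ge0 x : half x -> 0 <= x by rewrite /half_line /= in_itv /= andbT.
(* A third of [e] for the energy, the drift and the reference sequence each. *)
pose q := e / 3; have q0 : 0 < q by rewrite divr_gt0.
pose B1 := `|ka (k + k)| + 1; have B10 : 0 < B1 by rewrite ltr_wpDl.
pose B2 := `|ka k| + 1; have B20 : 0 < B2 by rewrite ltr_wpDl.
pose e1 := q ^+ 2 / B1 / 4; have e10 : 0 < e1 by rewrite !divr_gt0 ?exprn_gt0.
pose e2 := q / B2 / 2; have e20 : 0 < e2 by rewrite !divr_gt0.
have [N1 h1] := hv q q0.
have [N2 h2] := uniform_dist_small e10.
have [N3 h3] := (cvg0_nr _).1 Y0 e2 e20.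
have [N4 h4] := (cvg0_nr _).1 Y'0 e2 e20.
have [N5 h5] : exists N5, forall N, (N5 <= N)%N ->
    (\int[leb]_(x in half) (sp_dist (U_ N) x)%:E <= e1%:E)%E.
  have /fine_cvgP[[N5 _ f1] /cvgrPdist_le/(_ _ e10)[N6 _ f2]] := iU.
  exists (maxn N5 N6) => N; rewrite geq_max => /andP[n5 n6].
  have fn := f1 N n5; have := f2 N n6; rewrite /= sub0r normrN => f3.
  by rewrite -(fineK fn) lee_fin (le_trans (ler_norm _)).
pose M := (N1 + N2 + N3 + N4 + N5)%N.
exists M => N MN.
have n1 : (N1 <= N)%N by apply: leq_trans MN; rewrite /M; lia.
have n2 : (N2 <= N)%N by apply: leq_trans MN; rewrite /M; lia.
have n3 : (N3 <= N)%N by apply: leq_trans MN; rewrite /M; lia.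
have n4 : (N4 <= N)%N by apply: leq_trans MN; rewrite /M; lia.
have n5 : (N5 <= N)%N by apply: leq_trans MN; rewrite /M; lia.
have {}h1 := h1 N n1; have {h2}[i2 h2] := h2 N n2.
have {}h3 := h3 N n3; have {}h4 := h4 N n4; have {}h5 := h5 N n5.
have hUV := sp_sub_adapted pX (aU N) (uniform_adapted N).
have drift_small : nm (sp_drift (sp_sub (U_ N) (uniform N))) <= e2 + e2.
  rewrite -En sp_drift_sub (EB EL En).
  have dE : E (sp_drift (U_ N)) - E (sp_drift (uniform N)) = Y N - Y' N.
    pose g x := E (insert 1 (sp_at (U_ N) x)) - E (insert 1 (sp_at (uniform N) x)).
    apply: (vector_integral_unique tA EL En Ed (g := g)).
      by apply: vector_integral_sub; apply: (vector_integral_step EL En) => z;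
        [have [] := aU N z|have [] := aU N z|have [] := uniform_adapted N z|
         have [] := uniform_adapted N z].
    have -> : g = (fun x => E (insert 1 (tsub (sp_at (U_ N) x) (w x))) -
       E (insert 1 (tsub (sp_at (uniform N) x) (w x)))).
      apply/funext => x; rewrite !insert_tsub !(EB EL En) opprB addrA subrK //.
    exact: vector_integral_sub.
  by rewrite dE; apply: le_trans (nrB _ _) _; apply: lerD.
have energy_small : sp_energy star phi (sp_sub (U_ N) (uniform N)) <= 4 * e1.
  have [j1 j2] := energy_integral star phi hUV.
  rewrite -j2 -lee_fin fineK; last exact: (integrable_fin_num mh j1).
  apply: (@le_trans _ _ (\int[leb]_(x in half)
     (2%:E * (sp_dist (U_ N) x)%:E + 2%:E * (sp_dist (uniform N) x)%:E))%E).
    apply: ge0_le_integral => //.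
    - move=> x /half_ge0 x0; rewrite lee_fin; apply: (tensor_normsq_ge0 tA pX x0) => z.
      by case/(sp_at_mem pX hUV).
    - exact: (measurable_int leb j1).
    - apply: emeasurable_funD; apply: measurable_funeM; apply/measurable_EFinP => //.
      exact: uniform_dist_measurable.
    - move=> x /half_ge0 x0; rewrite -!EFinM -EFinD lee_fin.
      exact: normsq_sub_le (aU N) (uniform_adapted N) x0.
  rewrite ge0_integralD //; last 4 first.
  - move=> x /half_ge0 x0; rewrite -EFinM lee_fin mulr_ge0 ?sp_dist_ge0 //.
  - by apply: measurable_funeM; apply/measurable_EFinP.
  - move=> x /half_ge0 x0; rewrite -EFinM lee_fin mulr_ge0 ?sp_dist_ge0 //.
    exact: uniform_adapted.
  - by apply: measurable_funeM; apply/measurable_EFinP; exact: uniform_dist_measurable.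
  rewrite !ge0_integralZl_EFin //; last 4 first.
  - by move=> x /half_ge0 x0; rewrite lee_fin sp_dist_ge0 //; exact: uniform_adapted.
  - by apply/measurable_EFinP; exact: uniform_dist_measurable.
  - by move=> x /half_ge0 x0; rewrite lee_fin sp_dist_ge0.
  - by apply/measurable_EFinP.
  have h2' : (\int[leb]_(x in half) (sp_dist (uniform N) x)%:E <= e1%:E)%E.
    by rewrite -[X in (X <= _)%E]fineK ?lee_fin //; exact: (integrable_fin_num mh i2).
  apply: le_trans (leeD (lee_wpmul2l _ h5) (lee_wpmul2l _ h2')) _ => //.
  by rewrite -!EFinM -EFinD lee_fin; lra.
have energy0 : 0 <= sp_energy star phi (sp_sub (U_ N) (uniform N)).
  have [_ <-] := energy_integral star phi hUV; apply: Rintegral_ge0 => x /half_ge0 x0.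
  by apply: (tensor_normsq_ge0 tA pX x0) => z; case/(sp_at_mem pX hUV).
have := sp_int_bound tA pX pD k0 (D_additive tA pX pD k0) hUV.
have b1 : Num.sqrt (ka (k + k) * sp_energy star phi (sp_sub (U_ N) (uniform N))) <= q.
  rewrite -[q]ger0_norm ?(ltW q0) // -sqrtr_sqr; apply: ler_wsqrtr.
  apply: le_trans (ler_norm _) _; rewrite normrM [X in _ * X]ger0_norm //.
  apply: (@le_trans _ _ (B1 * (4 * e1))).
    by apply: ler_pM => //; rewrite lerDl.
  by rewrite /e1 le_eqVlt; apply/orP; left; apply/eqP; field; rewrite gt_eqF.
have b2 : `|ka k| * nm (sp_drift (sp_sub (U_ N) (uniform N))) <= q.
  apply: (@le_trans _ _ (B2 * (e2 + e2))).
    by apply: ler_pM => //; rewrite ?nm_ge0 // lerDl.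
  by rewrite /e2 le_eqVlt; apply/orP; left; apply/eqP; field; rewrite gt_eqF.
rewrite sp_int_sub => h6; rewrite -[E (sp_int D k (U_ N))](subrK (E (sp_int D k (uniform N)))) -addrA.
apply: le_trans (nrD _ _) _; rewrite -(EB EL En) En.
have -> : e = q + q + q by rewrite /q; field.
by apply: lerD => //; apply: le_trans h6 _; apply: lerD.
Qed.
End Approximation.

(** * The formula for polynomials *)

Section Polynomials.
Variables (R : realType) (A : algType R[i]) (star : A -> A) (phi : {scalar A}).
Hypothesis tA : tracial star phi.
Variables (F : R -> set A) (X : R -> R -> A) (m : nat -> R -> R) (ka : nat -> R).
Hypothesis pX : free_process star phi F X m ka.
Variable D : nat -> R -> R -> A.
Hypothesis pD : diagonal_measures star phi F X D.
Local Notation nm := (nm star phi).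

(** The words of [\partial^k p / k!] with their coefficients. *)
Definition pterms (p : {poly R[i]}) k : seq (R[i] * (nat * seq nat)) :=
  [seq (p`_n, q) | n <- iota 0 (size p), q <- comps n k].

Lemma sp_int_uniform t L k N : (0 < k)%N -> 0 <= t ->
  sp_int D k (uniform phi X t L N) = \sum_(q <- L) q.1 *: riemann phi X D q.2 k 0 t N.+1.
Proof.
move=> k0 t0; rewrite /uniform sp_int_frozen /lact exchange_big /=; apply: eq_bigr => q _.
rewrite /riemann scaler_sumr; apply: eq_bigr => z _.
by rewrite (D_additive tA pX pD k0) ?ptn_ge // ptn_le.
Qed.

Lemma X_00 : X 0 0 = 0.
Proof.
have := fp_add pX (lexx 0) (lexx 0) (lexx 0).
by move/eqP; rewrite -subr_eq0 addrK => /eqP.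
Qed.

Lemma polyv0 (p : {poly R[i]}) : polyv p (0 : A) = (p`_0)%:A.
Proof.
rewrite /polyv; case: (size p) (nth_default (0 : R[i]) (s := p) (n := 0%N)) => [->//|n _].
  by rewrite scale0r big_ord0.
rewrite big_ord_recl expr0 big1 ?addr0 // => z _.
by rewrite expr0n scaler0.
Qed.

Lemma big_pterms (p : {poly R[i]}) k (V : nmodType) (f : R[i] * (nat * seq nat) -> V) :
  \sum_(q <- pterms p k) f q = \sum_(n < size p) \sum_(q <- comps n k) f (p`_n, q).
Proof.
rewrite /pterms big_allpairs_dep /=.
have -> : iota 0 (size p) = index_iota 0 (size p) by rewrite /index_iota subn0.
by rewrite big_mkord.
Qed.

Lemma ito_polynomial (p : {poly R[i]}) t : 0 <= t -> exists2 K, 0 <= K & forall N,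
  nm (polyv p (X 0 t) - (p`_0)%:A -
    \sum_(k < size p) sp_int D k.+1 (uniform phi X t (pterms p k.+1) N)) <=
  K * Num.sqrt N.+1%:R^-1.
Proof.
move=> t0.
pose f (n : 'I_(size p)) N := p`_n *: (X 0 t ^+ n - X 0 0 ^+ n -
  \sum_(k < n) \sum_(q <- comps n k.+1) riemann phi X D q k.+1 0 t N).
have [n ns|K K0 hK] := @rate_sum _ _ _ _ tA _ (index_enum 'I_(size p)) f
    (fun N => Num.sqrt N%:R^-1).
  have [K K0 hK] := ito_monomial tA pX pD t0 n.
  exists (cabs p`_n * K) => [|N N0]; first by rewrite mulr_ge0 ?cabs_ge0.
  by rewrite (nmZ tA) -mulrA ler_wpM2l ?cabs_ge0 // hK.
exists K => // N; have := hK N.+1 isT; congr (nm _ <= _).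
rewrite /f; under eq_bigr do rewrite !scalerBr.
rewrite !sumrB X_00 -!/(polyv p _) polyv0; congr (_ - _).
under [RHS]eq_bigr do rewrite sp_int_uniform // big_pterms /=.
rewrite exchange_big /=; apply: eq_bigr => n _.
rewrite scaler_sumr (big_ord_widen (size p) (fun k => p`_n *:
  (\sum_(q <- comps n k.+1) riemann phi X D q k.+1 0 t N.+1))); last exact: ltnW.
rewrite big_mkcond; apply: eq_bigr => k _; case: ltnP => [_|nk]; first by rewrite scaler_sumr.
by rewrite comps_gt ?big_nil.
Qed.
End Polynomials.

Section Reindexing.
Variables (R : realType) (A : algType R[i]) (phi : {scalar A}) (X : R -> R -> A).

Lemma inner_take (l : seq nat) : inner l = take (size l).-1 l.
Proof. by case: l => // x l /=; rewrite lastI -cats1 take_size_cat ?size_belast. Qed.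

Definition exponents n k (z : k.+1.-tuple 'I_n.+1) : nat * seq nat :=
  (val (thead z), [seq val e | e <- behead z]).

Lemma exponentsE n k (z : k.+1.-tuple 'I_n.+1) :
  (exponents z).1 :: (exponents z).2 = [seq val e | e <- z].
Proof. by case/tupleP: z => e z; rewrite /exponents theadE. Qed.

Lemma exponents_inj n k : injective (@exponents n k).
Proof.
move=> z z' e; apply/val_inj/(inj_map (@val_inj _ _ _)).
by rewrite -!exponentsE e.
Qed.

Lemma comps_exponents n k :
  perm_eq [seq exponents z | z <- enum [pred z : k.+1.-tuple 'I_n.+1 |
     ((\sum_(j <- z) j) + k == n)%N]] (comps n k).
Proof.
have sumE (z : k.+1.-tuple 'I_n.+1) :
    (\sum_(j <- z) j = (exponents z).1 + sumn (exponents z).2)%N.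
  rewrite -[RHS]/(sumn (_ :: _)) exponentsE sumnE big_map //.
apply: uniq_perm; [by rewrite (map_inj_uniq (@exponents_inj n k)) enum_uniq|exact: uniq_comps|].
case=> a l; rewrite mem_comps /=; apply/mapP/andP => [[z]|[/eqP sl /eqP e]].
  rewrite mem_enum inE sumE => /eqP e [-> ->] /=.
  by rewrite size_map size_behead size_tuple; split=> //; apply/eqP.
have small b : b \in a :: l -> (b < n.+1)%N.
  move=> bl; rewrite ltnS -e (leq_trans _ (leq_addr _ _)) // -[(a + _)%N]/(sumn (a :: l)).
  elim: (a :: l) bl => //= c s IH; rewrite inE => /predU1P[->|/IH h]; first exact: leq_addr.
  exact: leq_trans (leq_addl _ _).
have sz : size [seq inord b : 'I_n.+1 | b <- a :: l] == k.+1 by rewrite size_map /= sl.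
have vE : [seq val b | b <- Tuple sz] = a :: l.
  rewrite -map_comp -[RHS]map_id; apply/eq_in_map => b bl /=.
  by rewrite inordK ?small.
have xE := exponentsE (Tuple sz); rewrite vE in xE.
have [E1 E2] : (exponents (Tuple sz)).1 = a /\ (exponents (Tuple sz)).2 = l.
  by case: xE.
exists (Tuple sz); last by rewrite [RHS]surjective_pairing E1 E2.
by rewrite mem_enum inE sumE E1 E2 e.
Qed.

Lemma wact_exponents n k (z : k.+2.-tuple 'I_n.+1) s y :
  (\prod_(1 <= j < k.+1) phi (X 0 s ^+ tnth z (inord j))) *:
    (X 0 s ^+ tnth z ord0 * y * X 0 s ^+ tnth z ord_max) =
  wact phi X (exponents z) s y.
Proof.
have nthE j : (j < k.+2)%N ->
    tnth z (inord j) = nth 0%N ((exponents z).1 :: (exponents z).2) j :> nat.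
  move=> jk; rewrite exponentsE (nth_map ord0) ?size_tuple // (tnth_nth ord0) inordK //.
have sl : size (exponents z).2 = k.+1 by rewrite size_map size_behead size_tuple.
rewrite /wact /wcoef inner_take sl /=; congr (_ *: (_ * _ * _)).
- rewrite big_add1 /= big_mkord (big_nth 0%N) size_takel ?sl // big_mkord.
  apply: eq_bigr => j _; rewrite nth_take // nthE //.
  by have := ltn_ord j; lia.
- have -> : ord_max = inord k.+1 :> 'I_k.+2 by apply/val_inj; rewrite /= inordK.
  by rewrite nthE //= (last_nth 0%N) sl.
Qed.
End Reindexing.

Lemma enum_enum_val (I : finType) : enum I = [seq enum_val z | z <- enum 'I_#|I|].
Proof.
have [x0 _|I0] := pickP (@predT I).
  apply: (@eq_from_nth _ x0) => [|n]; first by rewrite size_map size_enum_ord -cardE.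
  rewrite -cardE => nI; rewrite (nth_map (Ordinal nI)) ?size_enum_ord //.
  by rewrite (enum_val_nth x0) (nth_ord_enum (Ordinal nI) (Ordinal nI)).
have c0 : #|I| = 0%N by apply: eq_card0.
by rewrite (size0nil (etrans (esym (cardE I)) c0)) (size0nil (etrans (size_enum_ord _) c0)).
Qed.

(** * From operators to the algebra and back *)

Section Transfer.
Variables (R : realType) (H : completeNormedModType R[i]).
Variables (dot : {dot H for @Num.conj R[i]}) (hH : hilbert_norm dot).
Variables (A : set (H -> H)) (hA : von_neumann_algebra dot A).
Variables (phi : (H -> H) -> R[i]) (hphi : faithful_normal_trace_state dot A phi).
Variable A_ : R -> set (H -> H).
Hypothesis hA_ : forall t : R, 0 <= t -> von_neumann_algebra dot (A_ t) /\ A_ t `<=` A.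
Hypothesis hA_incr : forall s t : R, 0 <= s -> s <= t -> A_ s `<=` A_ t.
Variable mu_ : R -> probability (measurableTypeR R) R.
Variable X : R -> R -> (H -> H).
Hypothesis hX : adapted_free_stochastic_measure dot A phi A_ mu_ X.
Variables (r : nat -> R).
Hypothesis hmu_ : forall t, 0 <= t -> is_free_cumulants (mu_ t) (fun k => t * r k).
Hypothesis hvar : moment (mu_ 1) 2 - moment (mu_ 1) 1 ^+ 2 = 1.
Variable Delta : nat -> R -> R -> (H -> H).
Hypothesis hDelta : forall k : nat, (0 < k)%N -> is_diagonal_measure X k (Delta k).
Variables (L2 : completeNormedModType R[i]) (emb : (H -> H) -> L2).
Hypothesis hL2 : is_L2_completion dot A phi emb.
Local Notation V := (op_alg hH hA hphi).
Local Notation star := (@op_star R H dot A phi hH hA hphi).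
Local Notation tr := (@op_tr R H dot A phi hH hA hphi : {scalar V}).
Local Notation val := (@op_val R H dot A phi hH hA hphi).
Local Notation up := (op_lift hH hA hphi).
Local Notation XV := (XV hH hA hphi X).
Local Notation DV := (DV hH hA hphi Delta).
Local Notation filt := (filt (hH:=hH) (hA:=hA) (hphi:=hphi) A_).
Let tV := op_alg_tracial hH hA hphi.
Let pX := XV_free_process hH hA hphi hA_ hA_incr hX hmu_ hvar.
Let pD := DV_diagonal hH hA hphi hA_ hA_incr hX hmu_ hvar hDelta.

Definition embV (a : V) : L2 := emb (val a).

Lemma embVL (c : R[i]) (a b : V) : embV (c *: a + b) = c *: embV a + embV b.
Proof. exact: (L2_linear hL2 c (op_valP a) (op_valP b)). Qed.

Lemma adj_val (a : V) : adj dot (val a) = val (star a).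
Proof. exact: (adjP hH (op_starP a)). Qed.

Lemma embVn (a : V) : nr (embV a) = nm star tr a.
Proof.
have := L2_isometric hL2 (op_valP a); rewrite adj_val -/(embV a) nrE -RCX.
have -> : phi (val (star a) \o val a) = tr (star a * a) by [].
by rewrite (nmE tV) => /(@complexI R) h; apply: (@pexpIrn _ 2); rewrite ?nnegrE ?nr_ge0 ?nm_ge0.
Qed.

Lemma embVd (v : L2) (e : R) : 0 < e -> exists a : V, nr (v - embV a) <= e.
Proof.
move=> e0; have e0' : 0 < e%:C%C :> R[i] by rewrite ltcR.
have [S AS h] := L2_dense hL2 v e0'; exists (up S).
by rewrite /embV op_liftK // -nr_le ltW.
Qed.

Definition down (u : seq (R[i] * (V * V))) : bitensor H :=
  [seq (v.1, (val v.2.1, val v.2.2)) | v <- u].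

Lemma bi_mul_down u : bi_mul (down u) = val (insert 1 u).
Proof.
rewrite /bi_mul /down big_map /insert op_val_sum; apply: eq_bigr => v _.
by rewrite mulr1.
Qed.

Lemma bi_normsq_down u : bi_normsq dot phi (down u) = tensor_normsq star tr u.
Proof.
rewrite /bi_normsq /bi_dot /down big_map /tensor_normsq; congr complex.Re.
apply: eq_bigr => v _; rewrite big_map; apply: eq_bigr => w _ /=.
by rewrite !adj_val.
Qed.

Lemma bi_sub_down u w : bi_sub (down u) (down w) = down (tsub u w).
Proof. by rewrite /bi_sub /bi_scale /down /tsub map_cat -!map_comp. Qed.

Definition of_sb (U : simple_biprocess H) : step_process R V :=
  @StepProcess R V 'I_(sb_size U) (@sb_lo _ _ U) (@sb_hi _ _ U)
    (fun z => up (sb_left z)) (fun z => up (sb_right z)).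

Lemma of_sb_adapted U : sb_adapted A_ U -> sp_adapted filt (of_sb U).
Proof.
by move=> hU z; have [/andP[h1 h2] h3 h4] := hU z; split=> //; apply: (filt_op_lift hH hA hphi hA_).
Qed.

Lemma sb_eval_down U s : sb_adapted A_ U -> sb_eval U s = down (sp_at (of_sb U) s).
Proof.
move=> hU; rewrite /sb_eval /down /sp_at -map_comp; apply: eq_map => z /=.
have [/andP[h1 _] h3 h4] := hU z; have [_ sA] := hA_ h1.
by rewrite !op_liftK //; apply: sA.
Qed.

Lemma sb_integral_val k U : (0 < k)%N -> sb_adapted A_ U ->
  sb_integral (Delta k) U = val (sp_int DV k (of_sb U)).
Proof.
move=> k0 hU; rewrite /sb_integral /sp_int op_val_sum; apply: eq_bigr => z _.
have [/andP[h1 h2] h3 h4] := hU z; have [_ sA] := hA_ h1.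
have e1 : val (up (sb_left z)) = sb_left z by apply/op_liftK/sA.
have e2 : val (up (sb_right z)) = sb_right z by apply/op_liftK/sA.
rewrite !op_valM op_valB /= e1 e2.
have vD := val_DV hH hA hphi hA_ hA_incr hX hmu_ hvar hDelta k0 (lexx 0).
by rewrite !vD //; apply: le_trans h2.
Qed.

Definition to_sb (U : step_process R V) : simple_biprocess H :=
  @SimpleBiprocess R H #|sp_index U|
    (fun z => sp_lo (enum_val z)) (fun z => sp_hi (enum_val z))
    (fun z => val (sp_left (enum_val z))) (fun z => val (sp_right (enum_val z))).

Lemma to_sb_adapted U : sp_adapted filt U -> sb_adapted A_ (to_sb U).
Proof. by move=> hU z; have [h1 h2 h3 h4] := hU (enum_val z); split; rewrite ?h1. Qed.

Lemma sb_eval_to_sb U s : sb_eval (to_sb U) s = down (sp_at U s).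
Proof.
rewrite /sb_eval /down /sp_at -map_comp /=.
have -> : enum [pred z : sp_index U | sp_lo z <= s < sp_hi z] =
    [seq enum_val z | z <- enum [pred z : 'I_#|sp_index U| |
       sp_lo (enum_val z) <= s < sp_hi (enum_val z)]].
  by rewrite /enum_mem -!enumT enum_enum_val filter_map.
by rewrite -map_comp.
Qed.

Lemma approximates_sp w W_ :
  approximates dot phi A_ emb W_ (fun s => down (w s)) ->
  sp_approximates star tr filt embV w (fun n => of_sb (W_ n)).
Proof.
move=> [h1 h2 h3 [Y [h4 h5]]].
have E n s : bi_sub (sb_eval (W_ n) s) (down (w s)) =
    down (tsub (sp_at (of_sb (W_ n)) s) (w s)).
  by rewrite (sb_eval_down _ (h1 n)) bi_sub_down.
have Ed n : (fun s => bi_normsq dot phi (bi_sub (sb_eval (W_ n) s) (down (w s)))) =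
    sp_dist star tr w (of_sb (W_ n)).
  by apply/funext => s; rewrite E bi_normsq_down.
split.
- by move=> n; apply: of_sb_adapted.
- by move=> n; rewrite -Ed.
- have E' : (fun n => (\int[@lebesgue_measure R]_(s in half_line)
       (sp_dist star tr w (of_sb (W_ n)) s)%:E)%E) =
     (fun n => (\int[@lebesgue_measure R]_(s in half_line)
       (bi_normsq dot phi (bi_sub (sb_eval (W_ n) s) (down (w s))))%:E)%E).
    by apply/funext => n; rewrite -Ed.
  by rewrite E'.
exists Y; split=> // n; have := h4 n; congr (is_vector_integral _ _).
by apply/funext => s; rewrite E bi_mul_down.
Qed.

Lemma sp_approximates_sb w U_ : sp_approximates star tr filt embV w U_ ->
  approximates dot phi A_ emb (fun n => to_sb (U_ n)) (fun s => down (w s)).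
Proof.
move=> [h1 h2 h3 [Y [h4 h5]]].
have E n s : bi_sub (sb_eval (to_sb (U_ n)) s) (down (w s)) =
    down (tsub (sp_at (U_ n) s) (w s)).
  by rewrite sb_eval_to_sb bi_sub_down.
have Ed n : (fun s => bi_normsq dot phi (bi_sub (sb_eval (to_sb (U_ n)) s) (down (w s)))) =
    sp_dist star tr w (U_ n).
  by apply/funext => s; rewrite E bi_normsq_down.
split.
- by move=> n; apply: to_sb_adapted.
- by move=> n; rewrite Ed.
- have E' : (fun n => (\int[@lebesgue_measure R]_(s in half_line)
       (sp_dist star tr w (U_ n) s)%:E)%E) =
     (fun n => (\int[@lebesgue_measure R]_(s in half_line)
       (bi_normsq dot phi (bi_sub (sb_eval (to_sb (U_ n)) s) (down (w s))))%:E)%E).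
    by apply/funext => n; rewrite -Ed.
  by rewrite -E'.
exists Y; split=> // n; have := h4 n; congr (is_vector_integral _ _).
by apply/funext => s; rewrite E bi_mul_down.
Qed.

(** The frozen biprocesses are one approximating sequence; its integrals form a
    Cauchy sequence, and every other sequence has the same limit. *)
Lemma word_integral k t L w : (0 < k)%N -> 0 <= t ->
  (forall x, 0 <= x -> forall v, v \in w x -> filt x v.2.1 /\ filt x v.2.2) ->
  (forall x, 0 <= x -> x < t -> forall y, insert y (w x) = lact tr XV L x y) ->
  (forall x, t <= x -> w x = [::]) ->
  exists2 J : L2, is_stochastic_integral dot phi A_ emb (Delta k) (fun s => down (w s)) J &
    forall e, 0 < e -> exists N0, forall N, (N0 <= N)%N ->
      nr (embV (sp_int DV k (uniform tr XV t L N)) - J) <= e.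
Proof.
move=> k0 t0 wF w_in w_out.
have [J hJ] := uniform_int_limit tV pX pD embVL embVn L t0 k0.
exists J => //; split.
- move=> s s0 v /mapP[u us ->]; exact: (wF s s0 u us).
- exists (fun N => to_sb (uniform tr XV t L N)).
  apply: sp_approximates_sb; exact: (uniform_approximates tV pX embVL embVn t0 wF w_in w_out).
move=> W_ hW; have aW := approximates_sp hW.
apply/cvg_complexP => e e0.
have [N0 hN0] := approximation_limit tV pX pD embVL embVn embVd t0 wF w_in w_out k0 aW hJ e0.
exists N0 => N NN; rewrite nr_le sb_integral_val //; first exact: hN0.
by have [] := hW.
Qed.

Lemma polyX_val s n : 0 <= s -> polyop 'X^n (X 0 s) = val (XV 0 s ^+ n).
Proof.
move=> s0; rewrite op_valX (val_XV hH hA hphi hX (lexx 0) s0) /polyop size_polyXn.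
rewrite big_ord_recr /= coefXn eqxx scale1r big1 ?add0r // => z _.
by rewrite coefXn ltn_eqF ?scale0r.
Qed.

Lemma polyop_val (p : {poly R[i]}) s : 0 <= s -> polyop p (X 0 s) = val (polyv p (XV 0 s)).
Proof.
move=> s0; rewrite /polyv op_val_sum; apply: eq_bigr => z _.
by rewrite op_valZ op_valX (val_XV hH hA hphi hX (lexx 0) s0).
Qed.

Definition integrand (p : {poly R[i]}) k s : seq (R[i] * (V * V)) :=
  flatten [seq [seq (k.+1`!%:R^-1 * (p`_n * k.+1`!%:R *
      \prod_(1 <= j < k.+1) tr (XV 0 s ^+ tnth z (inord j))),
      (XV 0 s ^+ tnth z ord0, XV 0 s ^+ tnth z ord_max))
    | z : k.+2.-tuple 'I_n.+1
      <- enum [pred z : k.+2.-tuple 'I_n.+1 | ((\sum_(j <- z) j) + k.+1 == n)%N]]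
    | n <- iota 0 (size p)].

Lemma integrand_down p k s : 0 <= s -> bi_scale (k.+1`!%:R)^-1
    (phi_mid phi (subst_tensor (X 0 s) (dpoly k.+1 p))) = down (integrand p k s).
Proof.
move=> s0; rewrite /bi_scale /phi_mid /subst_tensor /dpoly /down /integrand.
rewrite !map_flatten -!map_comp; congr flatten; apply: eq_map => n /=.
rewrite /dpoly_monomial -!map_comp; apply: eq_map => z /=.
rewrite !tnth_map !polyX_val //; congr (_ * (_ * _), _).
by apply: eq_bigr => j _; rewrite !tnth_map polyX_val.
Qed.

Lemma insert_integrand p k s y : insert y (integrand p k s) =
  lact tr XV (pterms p k.+1) s y.
Proof.
rewrite /insert /integrand big_flatten big_map /lact big_pterms.
have -> : iota 0 (size p) = index_iota 0 (size p) by rewrite /index_iota subn0.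
rewrite big_mkord; apply: eq_bigr => n _; rewrite big_map /=.
rewrite -(perm_big _ (comps_exponents n k.+1)) big_map /=; apply: eq_bigr => z _.
rewrite -wact_exponents scalerA; congr (_ *: _).
have f0 : k.+1`!%:R != 0 :> R[i] by rewrite pnatr_eq0 -lt0n fact_gt0.
by field.
Qed.

Lemma integrand_adapted p k s v : 0 <= s -> v \in integrand p k s ->
  filt s v.2.1 /\ filt s v.2.2.
Proof.
move=> s0 /flatten_mapP[n _ /mapP[z _ ->]] /=.
have h := fp_sub pX s0; have FX := XF pX s0 (lexx s).
by split; apply: (subalgX h).
Qed.

(** The integrals of order [size p] and above vanish, and those of lower order
    are limits of the Riemann sums that add up to the increment of [p (X)]. *)
Lemma ito_formula p t : 0 <= t -> exists J : nat -> L2,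
  (forall k, is_stochastic_integral dot phi A_ emb (Delta k.+1)
     (bi_restrict 0 t (fun s => bi_scale (k.+1`!%:R)^-1
        (phi_mid phi (subst_tensor (X 0 s) (dpoly k.+1 p))))) (J k.+1)) /\
  (fun n => \sum_(1 <= k < n) J k) @ \oo --> emb (polyop p (X 0 t)) - p.[0] *: emb id.
Proof.
move=> t0.
pose w k s := if 0 <= s < t then integrand p k s else [::].
have wE k : bi_restrict 0 t (fun s => bi_scale (k.+1`!%:R)^-1
    (phi_mid phi (subst_tensor (X 0 s) (dpoly k.+1 p)))) = (fun s => down (w k s)).
  apply/funext => s; rewrite /bi_restrict /w; case: ifP => // /andP[s0 _].
  exact: integrand_down.
have wI k : exists2 J : L2, is_stochastic_integral dot phi A_ emb (Delta k.+1)
    (fun s => down (w k s)) J & forall e, 0 < e -> exists N0, forall N, (N0 <= N)%N ->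
    nr (embV (sp_int DV k.+1 (uniform tr XV t (pterms p k.+1) N)) - J) <= e.
  apply: word_integral => // x x0.
  - by move=> v; rewrite /w; case: ifP => // _; apply: integrand_adapted.
  - by move=> xt y; rewrite /w x0 xt insert_integrand.
  - by rewrite /w [x < t]ltNge x0 andbF.
pose J n := if n is k.+1 then s2val (cid2 (wI k)) else 0.
exists J; split=> [k|]; first by rewrite wE; exact: (s2valP (cid2 (wI k))).
have JE k e : 0 < e -> exists N0, forall N, (N0 <= N)%N ->
    nr (embV (sp_int DV k.+1 (uniform tr XV t (pterms p k.+1) N)) - J k.+1) <= e.
  exact: (s2valP' (cid2 (wI k))).
have J_out k : (size p <= k)%N -> J k.+1 = 0.
  move=> pk; apply: nr_eq0; apply/le_anti; rewrite nr_ge0 andbT.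
  apply: (@le_small _ _ _ 1) => // e e0 _; rewrite add0r mul1r.
  have [N0 hN0] := JE k e e0; have := hN0 N0 (leqnn _).
  rewrite (sp_int_uniform tV pX pD) // big_pterms big1 => [|n _].
    by rewrite (E0 embVn) sub0r nrN.
  by rewrite comps_gt ?big_nil // (leq_trans (ltn_ord n)) // leqW.
have JS : \sum_(k < size p) J k.+1 = emb (polyop p (X 0 t)) - p.[0] *: emb id.
  have [K K0 hK] := ito_polynomial tV pX pD p t0.
  have -> : emb (polyop p (X 0 t)) - p.[0] *: emb id = embV (polyv p (XV 0 t) - (p`_0)%:A).
    by rewrite (EB embVL embVn) (EZ embVL embVn) horner_coef0 polyop_val.
  set Q := polyv p _ - _ in hK *.
  apply/eqP; rewrite -subr_eq0; apply/eqP/nr_eq0/le_anti; rewrite nr_ge0 andbT.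
  have K1 : 0 <= K + (size p)%:R by rewrite addr_ge0.
  apply: (le_small K1) => e e0 e1; rewrite add0r.
  have [N1 hN1] : exists N1, forall N, (N1 <= N)%N -> forall k, (k < size p)%N ->
     nr (embV (sp_int DV k.+1 (uniform tr XV t (pterms p k.+1) N)) - J k.+1) <= e.
    elim: (size p) => [|d [N1 hN1]]; first by exists 0%N.
    have [N2 hN2] := JE d e e0; exists (maxn N1 N2) => N; rewrite geq_max => /andP[n1 n2] k.
    by rewrite ltnS leq_eqVlt => /predU1P[->|kd]; [apply: hN2|apply: hN1].
  have [N2 hN2] := mesh_small ler01 ler01 e0.
  pose N := maxn N1 N2.
  have h1 := hN1 N (leq_maxl _ _).
  have h2 : nm star tr (Q - \sum_(k < size p) sp_int DV k.+1 (uniform tr XV t (pterms p k.+1) N)) <= K * e.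
    apply: le_trans (hK N) _; rewrite ler_wpM2l //.
    by have := hN2 N (leq_maxr _ _); rewrite mul1r /mesh mul1r.
  set S := \sum_(k < size p) sp_int _ _ _ in h2.
  have -> : \sum_(k < size p) J k.+1 - embV Q = - (embV (S) - \sum_(k < size p) J k.+1) -
      embV (Q - S).
    by rewrite (EB embVL embVn) !opprB addrA subrK.
  apply: le_trans (nrB _ _) _; rewrite nrN embVn addrC mulrDl; apply: lerD => //.
  rewrite (E_sum embVL embVn) -sumrB.
  have : nr (\sum_(k < size p) (embV (sp_int DV k.+1 (uniform tr XV t (pterms p k.+1) N)) - J k.+1))
     <= \sum_(k < size p) e.
    elim/big_ind2 : _ => [|x u y v hx hy|k _]; first by rewrite /nr normr0.
      by apply: le_trans (nrD _ _) _; apply: lerD.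
    exact: h1.
  by rewrite sumr_const card_ord mulr_natl.
rewrite -JS; apply/cvg_complexP => e e0; exists (size p).+1 => n hn.
rewrite big_add1 big_mkord.
have -> : \sum_(k < n.-1) J k.+1 = \sum_(k < size p) J k.+1.
  rewrite [RHS](big_ord_widen n.-1 (fun k => J k.+1)); last by case: n hn.
  rewrite [RHS]big_mkcond; apply: eq_bigr => k _; case: ltnP => // pk.
  exact: J_out.
by rewrite subrr normr0 ler0c ltW.
Qed.
End Transfer.

Theorem corollary2 (R : realType) (H : completeNormedModType R[i])
    (dot : {dot H for @Num.conj R[i]}) (hH : hilbert_norm dot)
    (A : set (H -> H)) (hA : von_neumann_algebra dot A)
    (phi : (H -> H) -> R[i]) (hphi : faithful_normal_trace_state dot A phi)
    (A_ : R -> set (H -> H))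
    (hA_ : forall t : R, 0 <= t -> von_neumann_algebra dot (A_ t) /\ A_ t `<=` A)
    (hA_incr : forall s t : R, 0 <= s -> s <= t -> A_ s `<=` A_ t)
    (mu : probability (measurableTypeR R) R)
    (hmu_supp : compactly_supported mu)
    (hmu_div : freely_infinitely_divisible mu)
    (hmu_var : 'V_mu[@id R] = 1%E)
    (r : nat -> R) (hr : is_free_cumulants mu r)
    (mu_ : R -> probability (measurableTypeR R) R)
    (hmu_ : forall t : R, 0 <= t ->
       compactly_supported (mu_ t) /\
       is_free_cumulants (mu_ t) (fun k => t * r k))
    (X : R -> R -> (H -> H))
    (hX : adapted_free_stochastic_measure dot A phi A_ mu_ X)
    (Delta : nat -> R -> R -> (H -> H))
    (hDelta : forall k : nat, (0 < k)%N -> is_diagonal_measure X k (Delta k))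
    (L2 : completeNormedModType R[i]) (emb : (H -> H) -> L2)
    (hL2 : is_L2_completion dot A phi emb)
    (p : {poly R[i]}) (t : R) (ht : 0 <= t) :
  exists J : nat -> L2,
    (forall k : nat,
       is_stochastic_integral dot phi A_ emb (Delta k.+1)
         (bi_restrict 0 t (fun s =>
            bi_scale (k.+1`!%:R)^-1
              (phi_mid phi (subst_tensor (X 0 s) (dpoly k.+1 p)))))
         (J k.+1)) /\
    (fun n => \sum_(1 <= k < n) J k) @ \oo -->
      emb (polyop p (X 0 t)) - p.[0] *: emb id.
Proof.
have hm t0 : 0 <= t0 -> is_free_cumulants (mu_ t0) (fun k => t0 * r k).
  by move=> h; have [] := hmu_ t0 h.
have mE n : moment (mu_ 1) n = moment mu n.
  rewrite (hm 1 ler01) (hr n); apply: eq_bigr => P _; apply: eq_bigr => B _.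
  by rewrite mul1r.
have hvar : moment (mu_ 1) 2 - moment (mu_ 1) 1 ^+ 2 = 1.
  by rewrite !mE; apply: variance_moments.
exact: (ito_formula hH hA hphi hA_ hA_incr hX hm hvar hDelta hL2 p ht).
Qed.
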